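(* Let $f(u)=u-u^q$ with $q\ge3$ an odd integer, where either $d=2$, or $d=3$ and $q\in\{3,5\}$; let $g\in C^1(\mathbb{R})$ be globally Lipschitz, and let $\{u_h^n\}_{n=0}^N$ be the solution of the fully discrete finite element scheme described in the context. Suppose the mesh assumption given in the context holds. Then there is a constant $C>0$, independent of $h$ and $\tau$, such that $$\sup_{0\le n\le N}\mathbb{E}\bigl[\|u_h^n\|_{L^2}^2\bigr]+\sum_{n=0}^{N-1}\mathbb{E}\bigl[\|u_h^{n+1}-u_h^n\|_{L^2}^2\bigr]+\tau\sum_{n=0}^{N-1}\mathbb{E}\bigl[\|\nabla u_h^{n+1}\|_{L^2}^2\bigr]+\frac{\tau}{2}\sum_{n=0}^{N-1}\mathbb{E}\bigl[\|u_h^{n+1}\|_{L^{q+1}}^{q+1}\bigr]\le C.$$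
   Context: **Setting.** $\mathcal{D}\subset\mathbb{R}^d$ is a bounded domain, $T>0$, $(\Omega,\mathcal{F},\{\mathcal{F}_t\}_{t\ge0},\mathbb{P})$ is a filtered probability space carrying a standard real-valued Wiener process $W$, $\mathbb{E}$ is expectation, $(\cdot,\cdot)$ is the $L^2(\mathcal{D})$ inner product, and $\|\cdot\|_{L^p}=\|\cdot\|_{L^p(\mathcal{D})}$. The scheme approximates the SPDE $du=[\Delta u+f(u)]dt+g(u)dW(t)$ with $\partial u/\partial\nu=0$ on $\partial\mathcal{D}$ and $u(\cdot,0)=u_0$, where $f(u)=u-u^q$, $g\in C^1(\mathbb{R})$ satisfies $|g(a)-g(b)|\le\kappa_1|a-b|$ for all $a,b\in\mathbb{R}$ and some $\kappa_1>0$, and $u_0$ is a sufficiently smooth initial function. **Mesh.** $t_n=n\tau$, $n=0,\dots,N$, is a uniform partition of $[0,T]$ ($\tau=T/N$). $\mathcal{T}_h$ is a conforming, shape-regular simplicial triangulation of $\mathcal{D}$ of mesh size $h$. Mesh assumption: for every edge $E$ of the triangulation, $$\frac{1}{d(d-1)}\sum_{K\supset E}|\kappa_E^K|\cot\theta_E^K\ge0,$$ where the sum is over simplices $K\in\mathcal{T}_h$ containing $E$; if $a_1,\dots,a_{d+1}$ are the vertices of $K$, $E$ joins $a_i$ and $a_j$, and $F_i$ denotes the $(d-1)$-dimensional face of $K$ opposite $a_i$, then $\theta_E^K$ is the angle between $F_i$ and $F_j$, $\kappa_E^K=F_i\cap F_j$ is the $(d-2)$-dimensional simplex opposite to $E$,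 and $|\kappa_E^K|$ is its $(d-2)$-dimensional measure. **Scheme.** $V_h=\{v_h\in H^1(\mathcal{D}):v_h|_K\in\mathcal{P}_1(K)\ \forall K\in\mathcal{T}_h\}$. $I_h:C(\overline{\mathcal{D}})\to V_h$ is the nodal interpolation $I_hv=\sum_iv(a_i)\varphi_i$, with $\varphi_i$ the nodal basis function at vertex $a_i$. $P_h:L^2(\mathcal{D})\to V_h$ is the $L^2$-projection; it satisfies the standard estimates $\|w-P_hw\|_{L^2}+h\|\nabla(w-P_hw)\|_{L^2}\le Ch^{\min\{2,s\}}\|w\|_{H^s}$ for $w\in H^s(\mathcal{D})$ and $\|w-P_hw\|_{L^\infty}\le Ch^{2-d/2}\|w\|_{H^2}$. The discrete solution is an $\mathcal{F}_{t_n}$-adapted $V_h$-valued process $\{u_h^n\}$ with $u_h^0=P_hu_0$ such that, $\mathbb{P}$-almost surely, for $n=0,\dots,N-1$, $$(u_h^{n+1},v_h)+\tau(\nabla u_h^{n+1},\nabla v_h)=(u_h^n,v_h)+\tau(I_hf^{n+1},v_h)+(g(u_h^n),v_h)\,\bar\Delta W_{n+1}\quad\forall v_h\in V_h,$$ where $f^{n+1}=u_h^{n+1}-(u_h^{n+1})^q$ and $\bar\Delta W_{n+1}=W(t_{n+1})-W(t_n)$. *)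

(* Defs.v *)
From HB Require Import structures.
From mathcomp Require Import all_boot all_order all_algebra.
From mathcomp Require Import all_classical all_reals all_analysis.

Set Implicit Arguments.
Unset Strict Implicit.
Unset Printing Implicit Defensive.

Import Order.TTheory GRing.Theory Num.Theory.
Import numFieldNormedType.Exports.

Local Open Scope classical_set_scope.
Local Open Scope ring_scope.

(* The sigma-algebra of R^n generated by the coordinates (i.e. the Borel sets),
   and the n-dimensional Lebesgue measure as an iterated product.            *)

Definition rV_display (d : measure_display) : measure_display.
Proof. exact. Qed.

Section measurable_rV.
Context {d : measure_display} {T : measurableType d} (n : nat).

Let coord (i : 'I_n) (v : 'rV[T]_n) : T := v ord0 i.

Let rV_set0 : g_sigma_preimage coord set0.
Proof. exact: sigma_algebra0. Qed.

Let rV_setC A : g_sigma_preimage coord A -> g_sigma_preimage coord (~` A).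
Proof. exact: sigma_algebraC. Qed.

Let rV_bigcup (F : _^nat) : (forall i, g_sigma_preimage coord (F i)) ->
  g_sigma_preimage coord (\bigcup_i (F i)).
Proof. exact: sigma_algebra_bigcup. Qed.

HB.instance Definition _ := @isMeasurable.Build (rV_display d)
  'rV[T]_n (g_sigma_preimage coord) rV_set0 rV_setC rV_bigcup.

End measurable_rV.

Lemma measurable_coord d (T : measurableType d) n (i : 'I_n) :
  measurable_fun [set: 'rV[T]_n] (fun v => v ord0 i).
Proof.
move=> _ Y mY; rewrite setTI; apply: sub_sigma_algebra => /=.
rewrite -bigcup_seq/=; exists i => /=; first by rewrite mem_index_enum.
by exists Y => //; rewrite setTI.
Qed.

Lemma measurable_fun_rVP d1 d2 (T1 : measurableType d1) (T2 : measurableType d2)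
    n (f : T1 -> 'rV[T2]_n) :
  measurable_fun [set: T1] f <->
  forall i, measurable_fun [set: T1] (fun x => f x ord0 i).
Proof.
split=> [mf i|mf].
  exact: (measurableT_comp (measurable_coord i) mf).
move=> _ A mA; rewrite setTI.
have : preimage_set_system [set: T1] f
    (g_sigma_preimage (fun (i : 'I_n) (v : 'rV[T2]_n) => v ord0 i)) (f @^-1` A).
  by exists A => //; rewrite setTI.
rewrite -g_sigma_preimage_comp; apply: smallest_sub => //.
  exact: sigma_algebra_measurable.
rewrite -bigcup_seq/=; apply: bigcup_sub => i _ _ [B mB <-].
exact: mf.
Qed.

Section lebesgue_rV.
Context {R : realType}.

Definition rV_cons n (p : R * 'rV[R]_n) : 'rV[R]_n.+1 :=
  row_mx (p.1%:M : 'rV_1) p.2.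

Lemma rV_cons_head n x (v : 'rV[R]_n) : rV_cons (x, v) ord0 ord0 = x.
Proof.
rewrite /rV_cons (_ : ord0 = @lshift 1 n ord0 :> 'I_(1 + n)); last exact: val_inj.
by apply: etrans (@row_mxEl _ _ _ _ _ _ _ _) _; rewrite mxE eqxx.
Qed.

Lemma rV_cons_lift n x (v : 'rV[R]_n) (j : 'I_n) :
  rV_cons (x, v) ord0 (lift ord0 j) = v ord0 j.
Proof.
rewrite /rV_cons (_ : lift _ _ = @rshift 1 n j :> 'I_(1 + n)); last exact: val_inj.
exact: row_mxEr.
Qed.

Lemma measurable_rV_cons n : measurable_fun [set: R * 'rV[R]_n] (@rV_cons n).
Proof.
apply/measurable_fun_rVP => i; case: (unliftP ord0 i) => [j|] ->.
  rewrite (_ : (fun _ => _) = (fun v : 'rV[R]_n => v ord0 j) \o snd).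
    exact: (measurableT_comp (measurable_coord j) measurable_snd).
  by apply/funext => -[x v]; rewrite rV_cons_lift.
rewrite (_ : (fun _ => _) = fst); first exact: measurable_fst.
by apply/funext => -[x v]; rewrite rV_cons_head.
Qed.

Section step.
Variables (n : nat) (mu : {sigma_finite_measure set 'rV[R]_n -> \bar R}).

Definition lebesgue_rV_step : set 'rV[R]_n.+1 -> \bar R :=
  pushforward (@lebesgue_measure R \x mu)%E (@rV_cons n).

Let step0 : lebesgue_rV_step set0 = 0%E.
Proof. by rewrite /lebesgue_rV_step /pushforward preimage_set0 measure0. Qed.

Let step_ge0 A : (0 <= lebesgue_rV_step A)%E.
Proof. by rewrite /lebesgue_rV_step /pushforward; exact: measure_ge0. Qed.

Let step_sigma_additive : semi_sigma_additive lebesgue_rV_step.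
Proof.
by apply: measure_semi_sigma_additive; exact: measurable_rV_cons.
Qed.

HB.instance Definition _ := isMeasure.Build _ _ _
  lebesgue_rV_step step0 step_ge0 step_sigma_additive.

Let step_sigma_finite : sigma_finite setT lebesgue_rV_step.
Proof.
have /sigma_finiteP[F [UF ndF mF]] := sigma_finiteT (@lebesgue_measure R).
have /sigma_finiteP[G [UG ndG mG]] := sigma_finiteT mu.
pose head (v : 'rV[R]_n.+1) : R := v ord0 ord0.
pose tail (v : 'rV[R]_n.+1) : 'rV[R]_n := \row_j v ord0 (lift ord0 j).
have mhead : measurable_fun setT head by exact: measurable_coord.
have mtail : measurable_fun setT tail.
  apply/measurable_fun_rVP => i.
  rewrite (_ : (fun _ => _) = fun v : 'rV[R]_n.+1 => v ord0 (lift ord0 i)).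
    exact: measurable_coord.
  by apply/funext => v; rewrite mxE.
exists (fun k => head @^-1` F k `&` tail @^-1` G k).
  rewrite predeqE => v; split=> // _.
  have : setT (head v) by []; rewrite UF => -[i _ Fi].
  have : setT (tail v) by []; rewrite UG => -[j _ Gj].
  exists (maxn i j) => //; split.
    by have /subsetPset := ndF _ _ (leq_maxl i j); exact.
  by have /subsetPset := ndG _ _ (leq_maxr i j); exact.
move=> k; have [mFk Fk] := mF k; have [mGk Gk] := mG k; split.
  apply: measurableI; rewrite -[X in measurable X]setTI.
    exact: mhead.
  exact: mtail.
rewrite /lebesgue_rV_step /pushforward (_ : _ @^-1` _ = F k `*` G k).
  by rewrite product_measure1E// lte_mul_pinfty// ge0_fin_numE.
apply/seteqP; split=> -[x v]; rewrite /= /head /tail rV_cons_head;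
  (rewrite (_ : \row_j _ = v); last by apply/rowP => j; rewrite mxE rV_cons_lift);
  by [].
Qed.

HB.instance Definition _ := Measure_isSigmaFinite.Build _ _ _
  lebesgue_rV_step step_sigma_finite.

End step.

Fixpoint lebesgue_rV n : {sigma_finite_measure set 'rV[R]_n -> \bar R} :=
  if n is n'.+1 then lebesgue_rV_step (lebesgue_rV n') else \d_(0 : 'rV[R]_0).

Lemma lebesgue_rV_box n (a b : 'I_n -> R) : (forall i, a i <= b i) ->
  lebesgue_rV n [set x | forall i, x ord0 i \in `[a i, b i]] = (\prod_i (b i - a i))%:E.
Proof.
elim: n a b => [|n IH] a b ab /=.
  rewrite big_ord0 diracE mem_set//; by case.
rewrite /lebesgue_rV_step /pushforward.
rewrite (_ : _ @^-1` _ = `[a ord0, b ord0] `*` [set x : 'rV[R]_n | forall i, x ord0 i \in `[a (lift ord0 i), b (lift ord0 i)]]); last first.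
  apply/seteqP; split => -[x v] /=.
    move=> h; split=> [|i]; first by have := h ord0; rewrite rV_cons_head.
    by have := h (lift ord0 i); rewrite rV_cons_lift.
  by move=> [h1 h2] i; case: (unliftP ord0 i) => [j|] ->; rewrite ?rV_cons_lift ?rV_cons_head.
rewrite product_measure1E//; last first.
  rewrite (_ : mkset _ = \bigcap_(i in [set: 'I_n]) ((fun v : 'rV[R]_n => v ord0 i) @^-1` `[a (lift ord0 i), b (lift ord0 i)])).
    apply: fin_bigcap_measurable => // i _; rewrite -[X in measurable X]setTI; exact: measurable_coord.
  by apply/seteqP; split => [x h i _|x h i]; exact: h.
rewrite IH//= lebesgue_measure_itv/= lte_fin big_ord_recl EFinM.
have := ab ord0; rewrite le_eqVlt => /orP[/eqP->|->]; last by rewrite EFinB.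
by rewrite ltxx subrr !mul0e.
Qed.

End lebesgue_rV.

(* Euclidean structure of R^n (the norm `|_| of 'rV[R]_n is the max norm). *)
Section euclid.
Context {R : realType} {n : nat}.
Implicit Types (x y : 'rV[R]_n) (A : set 'rV[R]_n).

Definition dotv x y : R := \sum_(i < n) x ord0 i * y ord0 i.
Definition enorm x : R := Num.sqrt (dotv x x).
Definition diam A : R := sup [set enorm (xy.1 - xy.2) | xy in A `*` A].
Definition insphere_diam A : R :=
  sup [set 2 * r | r in [set r : R |
    0 <= r /\ exists c, [set x | enorm (x - c) <= r] `<=` A]].

End euclid.

(* Functions on an open set D are represented by functions on R^d; only their
   values on D (or on its closure) are used.                                 *)
Section function_spaces.
Context {R : realType} {d : nat}.
Implicit Types (D : set 'rV[R]_d) (v w phi : 'rV[R]_d -> R)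
  (G H : 'rV[R]_d -> 'rV[R]_d).

Definition Lpnorm D (p : nat) v : \bar R :=
  ('N[lebesgue_rV d]_(p%:R%:E) [(EFin \o v) \_ D])%E.

Definition inL2 D v := measurable_fun D v /\ (Lpnorm D 2 v < +oo)%E.

Definition ip D v w : R := \int[lebesgue_rV d]_(x in D) (v x * w x).

Definition ipv D G H : R := \int[lebesgue_rV d]_(x in D) dotv (G x) (H x).

Definition partial (i : 'I_d) phi : 'rV[R]_d -> R :=
  fun x => 'D_(delta_mx ord0 i) phi x.

(* C^infty: all iterated partial derivatives exist and are differentiable. *)
Definition smooth phi := forall (s : seq 'I_d) (x : 'rV[R]_d),
  differentiable (foldr partial phi s) x.

Definition test_function D phi := smooth phi /\
  exists2 K, compact K /\ K `<=` D & forall x, ~ K x -> phi x = 0.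

Definition weak_gradient D v G := forall (i : 'I_d) phi, test_function D phi ->
  ip D v (partial i phi) = - ip D (fun x => G x ord0 i) phi.

Definition L2_weak_gradient D v : set ('rV[R]_d -> 'rV[R]_d) :=
  [set G : 'rV[R]_d -> 'rV[R]_d | (forall i, inL2 D (fun x => G x ord0 i)) /\ weak_gradient D v G].

Definition inH1 D v := inL2 D v /\ L2_weak_gradient D v !=set0.

(* The weak gradient is unique up to a null set; [grad] selects one. *)
Definition grad D v : 'rV[R]_d -> 'rV[R]_d :=
  xget (fun=> 0) (L2_weak_gradient D v).

Definition is_domain D := [/\ open D, connected D & D !=set0].

End function_spaces.

(* A d-simplex is given by its d+1 vertices p k. *)
Section simplex.
Context {R : realType} {d : nat}.
Implicit Type p : 'I_d.+1 -> 'rV[R]_d.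

(* Row k is (1, p k); this matrix is invertible iff the p k are affinely
   independent, and then the barycentric coordinates lam of x are the solution
   of lam *m bary_mx p = (1, x).                                             *)
Definition bary_mx p : 'M[R]_d.+1 := \matrix_(k < d.+1) row_mx (1%:M : 'rV_1) (p k).

Definition affinely_independent p := bary_mx p \in unitmx.

Definition bary p (k : 'I_d.+1) (x : 'rV[R]_d) : R :=
  ((row_mx (1%:M : 'rV_1) x : 'rV_(d.+1)) *m invmx (bary_mx p)) ord0 k.

(* The gradient of the affine function [bary p k]; it is orthogonal to the face
   F_k opposite to p k and points to the inside of the simplex.              *)
Definition bary_grad p (k : 'I_d.+1) : 'rV[R]_d :=
  \row_(j < d) invmx (bary_mx p) (lift ord0 j) k.

Definition unit_normal p (k : 'I_d.+1) : 'rV[R]_d :=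
  (enorm (bary_grad p k))^-1 *: bary_grad p k.

(* Interior dihedral angle between the faces F_k and F_l: it is supplementary
   to the angle between their inner unit normals.                            *)
Definition dihedral_angle p (k l : 'I_d.+1) : R :=
  acos (- dotv (unit_normal p k) (unit_normal p l)).

(* m-dimensional measure of the m-simplex with vertex list s (size s = m+1):
   square root of the Gram determinant of its edges from the first vertex,
   divided by m!; it is 1 for a point.                                       *)
Definition simplex_measure (s : seq 'rV[R]_d) : R :=
  if s is p0 :: s' then
    Num.sqrt (\det (\matrix_(i < size s', j < size s')
                      dotv (s'`_i - p0) (s'`_j - p0))) / (size s')`!%:R
  else 0.

(* |kappa_E| for the edge E joining p k and p l: kappa_E = F_k `&` F_l is the
   (d-2)-simplex spanned by the other vertices.                              *)
Definition kappa_measure p (k l : 'I_d.+1) : R :=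
  simplex_measure [seq p m | m <- enum 'I_d.+1 & (m != k) && (m != l)].

End simplex.

Definition cot {R : realType} (x : R) : R := cos x / sin x.

(* Simplicial mesh: vertex coordinates, and for each cell the numbers of its
   d+1 vertices.                                                             *)
Record mesh (R : realType) (d : nat) := Mesh {
  nvert : nat;
  ncell : nat;
  vert : 'I_nvert -> 'rV[R]_d;
  cell : 'I_ncell -> 'I_d.+1 -> 'I_nvert }.

Section mesh_theory.
Context {R : realType} {d : nat}.
Implicit Types (M : mesh R d) (D : set 'rV[R]_d).

Definition corner M (K : 'I_(ncell M)) (k : 'I_d.+1) : 'rV[R]_d :=
  vert (cell K k).

Definition cell_verts M (K : 'I_(ncell M)) : {set 'I_(nvert M)} :=
  [set cell K k | k in [set: 'I_d.+1]].

Definition hull M (S : {set 'I_(nvert M)}) : set 'rV[R]_d :=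
  [set x | exists c : 'I_(nvert M) -> R,
    [/\ forall i, 0 <= c i, forall i, i \notin S -> c i = 0,
        \sum_i c i = 1 & x = \sum_i c i *: vert i]].

Definition simplex M (K : 'I_(ncell M)) : set 'rV[R]_d := hull (cell_verts K).

(* The last clause follows from the equality before it when D is the interior of
   its closure; in general closure D alone does not determine D up to null sets. *)
Definition triangulation D M :=
  [/\ injective (@vert R d M) /\ injective (@cell_verts M),
      forall i : 'I_(nvert M), exists K : 'I_(ncell M), i \in cell_verts K,
      forall K : 'I_(ncell M), affinely_independent (corner K),
      forall K K' : 'I_(ncell M),
        simplex K `&` simplex K' = hull (cell_verts K :&: cell_verts K')%SET &
      closure D = \bigcup_(K : 'I_(ncell M)) simplex K /\
      forall K : 'I_(ncell M), (simplex K)^° `<=` D].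

Definition mesh_size M : R := \big[Num.max/0]_(K < ncell M) diam (simplex K).

Definition shape_regular (sigma : R) M := forall K : 'I_(ncell M),
  diam (simplex K) <= sigma * insphere_diam (simplex K).

Definition is_edge M (i j : 'I_(nvert M)) := i != j /\
  exists K : 'I_(ncell M), i \in cell_verts K /\ j \in cell_verts K.

(* Cells have distinct vertices, so that for each cell K containing the edge
   {i, j} exactly one pair (k, l) contributes to the inner sum.              *)
Definition mesh_assumption M := forall i j : 'I_(nvert M), is_edge i j ->
  0 <= ((d * d.-1)%:R)^-1 *
       \sum_(K < ncell M)
         \sum_(kl : 'I_d.+1 * 'I_d.+1 | (cell K kl.1 == i) && (cell K kl.2 == j))
           kappa_measure (corner K) kl.1 kl.2 *
           cot (dihedral_angle (corner K) kl.1 kl.2).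

Definition P1_on (A : set 'rV[R]_d) (v : 'rV[R]_d -> R) :=
  exists (a : R) (b : 'rV[R]_d), forall x, A x -> v x = a + dotv b x.

(* v is affine on each closed simplex: an element of V_h is represented by its
   continuous version, which gives a meaning to its nodal values.            *)
Definition Vh D M : set ('rV[R]_d -> R) :=
  [set v | inH1 D v /\ forall K : 'I_(ncell M), P1_on (simplex K) v].

(* phi_i on a cell containing x is the barycentric coordinate attached to the
   vertex i, or 0 if i is not a vertex of that cell.                         *)
Definition nodal_basis M (i : 'I_(nvert M)) (x : 'rV[R]_d) : R :=
  if [pick K : 'I_(ncell M) | `[< simplex K x >]] is Some K
  then \sum_(k < d.+1 | cell K k == i) bary (corner K) k x else 0.

Definition interp M (v : 'rV[R]_d -> R) : 'rV[R]_d -> R :=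
  fun x => \sum_(i < nvert M) v (vert i) * nodal_basis i x.

Definition is_L2_projection D M (w p : 'rV[R]_d -> R) :=
  Vh D M p /\ forall v, Vh D M v -> ip D p v = ip D w v.

End mesh_theory.

Section stochastics.
Context {R : realType} {dO : measure_display} {Omega : measurableType dO}.
Variable P : probability Omega R.
Implicit Types (F : R -> set (set Omega)) (W : R -> Omega -> R).

Definition is_filtration F :=
  [/\ forall t, 0 <= t -> sigma_algebra [set: Omega] (F t),
      forall t, 0 <= t -> F t `<=` measurable &
      forall s t, 0 <= s -> s <= t -> F s `<=` F t].

Definition measurable_wrt (G : set (set Omega)) (X : Omega -> R) :=
  forall B : set R, measurable B -> G (X @^-1` B).

Definition increment W (s t : R) : Omega -> R := fun w => W t w - W s w.

Definition is_wiener F W :=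
  [/\ forall t, 0 <= t -> measurable_wrt (F t) (W t),
      {ae P, forall w, W 0 w = 0},
      forall s t (B : set R), 0 <= s -> s < t -> measurable B ->
        P (increment W s t @^-1` B) = normal_prob 0 (Num.sqrt (t - s)) B,
      forall s t A (B : set R), 0 <= s -> s < t -> F s A -> measurable B ->
        P (A `&` increment W s t @^-1` B) = (P A * P (increment W s t @^-1` B))%E &
      {ae P, forall w, {within `[0, +oo[, continuous (fun t => W t w)}}].

Definition expect (X : Omega -> \bar R) : \bar R := (\int[P]_w X w)%E.

(* V_h is finite dimensional, and its Borel sigma-algebra is generated by the
   point evaluations; measurability of u n is stated through them.           *)
Definition fe_solution d (D : set 'rV[R]_d) (M : mesh R d) F W
    (q : nat) (g : R -> R) (u0 : 'rV[R]_d -> R) (tau : R) (N : nat)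
    (u : nat -> Omega -> 'rV[R]_d -> R) :=
  [/\ forall n w, (n <= N)%N -> Vh D M (u n w),
      forall n x, (n <= N)%N -> closure D x ->
        measurable_wrt (F (n%:R * tau)) (fun w => u n w x),
      forall w, is_L2_projection D M u0 (u 0 w) &
      {ae P, forall w, forall n, (n < N)%N -> forall v, Vh D M v ->
        ip D (u n.+1 w) v + tau * ipv D (grad D (u n.+1 w)) (grad D v)
        = ip D (u n w) v
          + tau * ip D (interp M (fun x => u n.+1 w x - u n.+1 w x ^+ q)) v
          + ip D (fun x => g (u n w x)) v
            * increment W (n%:R * tau) (n.+1%:R * tau) w}].

End stochastics.

(* Main.v *)
(** Test the scheme with u^(n+1).  The nodal values of (u^(n+1))^q give the form
    B = (I_h (u^(n+1))^q, u^(n+1)), and everything rests on the coercivity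
    |u^(n+1)|^(q+1)_{L^(q+1)} <= K B with K depending only on d and q.  On one
    simplex the mass matrix is a multiple of (1 + delta_kl) in the barycentric
    coordinates, so coercivity is the scalar inequality
    c sum a_k^(q+1) <= sum a_k^(q+1) + (sum a_k^q) (sum a_k) for d + 1 reals, which is
    proved by distinguishing sign patterns; with one sign opposite to the three others
    it rests on a one-variable polynomial inequality, used for q = 3 and q = 5.

    Since q + 1 >= 4, the term B also absorbs the reaction term 2 tau |u^(n+1)|^2 up
    to a constant, so no smallness of tau is needed.  The noise is handled by the
    independence of the Wiener increment from F_(t_n): the linear term has mean zero,
    the quadratic one has mean at most 8 tau E |g(u^n)|^2.  A discrete Gronwall
    argument then gives a bound by the data. *)
From HB Require Import structures.
Require Import Defs.
From mathcomp Require Import all_boot all_order all_algebra all_fingroup.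
From mathcomp Require Import all_classical all_reals all_analysis.
From mathcomp Require Import measurable_realfun ring lra.
Set Implicit Arguments.
Unset Strict Implicit.
Unset Printing Implicit Defensive.
Import Order.TTheory GRing.Theory Num.Theory.
Import numFieldNormedType.Exports.
Local Open Scope classical_set_scope.
Local Open Scope ring_scope.

(** * The nodal form on one simplex *)

(** Nodal interpolation does not commute with products: on a simplex the integrand I_h(v^q) v can be
    negative at some points, and coercivity appears only after integration. The resulting scalar
    inequality is sensitive to q. In a tetrahedron, three values s in (2/3, 1) against one value -1
    give 12 s^(q+1) - 3 s^q - 3 s + 2, which tends to 2 - 3 s < 0 as q grows; in a triangle this
    pattern does not occur.

    The mass matrix of a simplex comes from its symmetries and one bisection, up to an unknown
    scalar. The same scalar gives the volume of the simplex, so it cancels in the coercivity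
    estimate.

    A second obstacle is probabilistic. The scheme holds path by path and provides neither
    integrability of the norms nor measurability of the weak gradient in the random parameter.
    Measurability is therefore read off the nodal values, and integrability is propagated from one
    time step to the next by the energy inequality itself. *)

Section node_values.
Variable R : realFieldType.
Implicit Types (a b e x y : R) (q : nat).

Lemma exprS_le_max a x q : 0 <= x -> x <= a -> x ^+ q <= a ^+ q.
Proof. by move=> x0 xa; rewrite lerXn2r ?nnegrE// (le_trans x0). Qed.

Lemma subX_mul_ge0 a x q : 0 <= a -> 0 <= x -> 0 <= (a ^+ q - x ^+ q) * (a - x).
Proof.
move=> a0 x0; have [ax|xa] := leP a x.
  by rewrite mulr_le0 ?subr_le0// exprS_le_max.
by rewrite mulr_ge0 ?subr_ge0// ?exprS_le_max// ltW.
Qed.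

Lemma expr_half a x q : (0 < q)%N -> 0 <= x -> x <= a / 2 -> x ^+ q <= a ^+ q / 2.
Proof.
case: q => // q _ x0 xa; rewrite !exprS.
have xq : x ^+ q <= a ^+ q by apply: exprS_le_max => //; lra.
have xq0 : 0 <= x ^+ q by rewrite exprn_ge0.
nra.
Qed.

(** Two values [a], [b] of one sign against [x], [y] of the other, all in absolute value. In this
    arrangement every summand is nonnegative: the products of differences by monotonicity of powers,
    the others as products of nonnegative numbers. *)
Let form22 q a b x y :=
  (a ^+ q - x ^+ q) * (a - x) + (a ^+ q - y ^+ q) * (a - y) +
  (b ^+ q - x ^+ q) * (b - x) + (b ^+ q - y ^+ q) * (b - y) +
  (a ^+ q * b + b ^+ q * a) + (x ^+ q * y + y ^+ q * x).

Let form22E q a b x y :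
  a ^+ q.+1 + b ^+ q.+1 + x ^+ q.+1 + y ^+ q.+1 +
  (a ^+ q + b ^+ q - x ^+ q - y ^+ q) * (a + b - x - y) = form22 q a b x y.
Proof. rewrite /form22 !exprS; ring. Qed.

(** Three cases, each keeping a single summand. If b >= a/8, the product a^q b suffices. Otherwise,
    if x <= a/4, the differences of [a] and [x] give a quarter of a^(q+1). Otherwise b < x/2, and
    the differences of [b] and [x] give x^(q+1)/4 with x > a/4; this last case fixes the constant
    4^-(q+2). *)
Let form22_ge_max q a b x y : (0 < q)%N -> 0 <= a -> 0 <= b -> 0 <= x -> 0 <= y ->
  (4%:R^-1) ^+ q.+2 * a ^+ q.+1 <= form22 q a b x y.
Proof.
move=> q0 a0 b0 x0 y0.
have aq : 0 <= a ^+ q by exact: exprn_ge0.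
have bq : 0 <= b ^+ q by exact: exprn_ge0.
have xq : 0 <= x ^+ q by exact: exprn_ge0.
have yq : 0 <= y ^+ q by exact: exprn_ge0.
have ax := subX_mul_ge0 q a0 x0; have ay := subX_mul_ge0 q a0 y0.
have bx := subX_mul_ge0 q b0 x0; have b_y := subX_mul_ge0 q b0 y0.
have ab : 0 <= b ^+ q * a by exact: mulr_ge0.
have ab' : 0 <= a ^+ q * b by exact: mulr_ge0.
have xy : 0 <= x ^+ q * y + y ^+ q * x by rewrite addr_ge0// mulr_ge0.
have aq1 : 0 <= a * a ^+ q by exact: mulr_ge0.
have small : (4%:R^-1 : R) ^+ q.+2 <= 8%:R^-1.
  rewrite exprS exprS; have : (4%:R^-1 : R) ^+ q <= 1 by rewrite exprn_ile1//; lra.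
  lra.
have smalla : (4%:R^-1 : R) ^+ q.+2 * a ^+ q.+1 <= 8%:R^-1 * (a * a ^+ q).
  by rewrite [a ^+ q.+1]exprS ler_wpM2r.
rewrite /form22.
have [b8|b8] := leP (a / 8%:R) b.
  have : a ^+ q * (a / 8%:R) <= a ^+ q * b by exact: ler_wpM2l.
  lra.
have [x4|x4] := leP x (a / 4%:R).
  have h : x ^+ q <= a ^+ q / 2 by apply: expr_half => //; lra.
  have : (a ^+ q / 2) * (a / 2) <= (a ^+ q - x ^+ q) * (a - x).
    by apply: ler_pM; lra.
  lra.
have h : b ^+ q <= x ^+ q / 2 by apply: expr_half => //; lra.
have h1 : (x ^+ q / 2) * (x / 2) <= (x ^+ q - b ^+ q) * (x - b).
  by apply: ler_pM; lra.
have h2 : (a / 4%:R) ^+ q.+1 <= x ^+ q.+1.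
  by apply: exprS_le_max; lra.
have : (4%:R^-1 : R) ^+ q.+2 * a ^+ q.+1 = (a / 4%:R) ^+ q.+1 / 4%:R.
  by rewrite exprMn [_ ^+ q.+2]exprS; ring.
rewrite [x ^+ q.+1]exprS in h2.
lra.
Qed.

(** The form is invariant under swaps inside a pair and under exchange of the pairs, so the
    preceding bound holds for each of the four values; averaging costs the extra factor 1/4. *)
Lemma form22_coercive q a b x y : (0 < q)%N -> 0 <= a -> 0 <= b -> 0 <= x -> 0 <= y ->
  (4%:R^-1) ^+ q.+3 * (a ^+ q.+1 + b ^+ q.+1 + x ^+ q.+1 + y ^+ q.+1) <=
  a ^+ q.+1 + b ^+ q.+1 + x ^+ q.+1 + y ^+ q.+1 +
  (a ^+ q + b ^+ q - x ^+ q - y ^+ q) * (a + b - x - y).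
Proof.
move=> q0 a0 b0 x0 y0; rewrite form22E.
have h1 := form22_ge_max q0 a0 b0 x0 y0.
have h2 := form22_ge_max q0 b0 a0 x0 y0.
have h3 := form22_ge_max q0 x0 y0 a0 b0.
have h4 := form22_ge_max q0 y0 x0 a0 b0.
have e2 : form22 q b a x y = form22 q a b x y by rewrite /form22; ring.
have e3 : form22 q x y a b = form22 q a b x y by rewrite /form22; ring.
have e4 : form22 q y x a b = form22 q a b x y by rewrite /form22; ring.
rewrite e2 in h2; rewrite e3 in h3; rewrite e4 in h4.
rewrite [_ ^+ q.+3]exprS; set c := (_ ^+ q.+2) in h1 h2 h3 h4 *.
rewrite -mulrA !mulrDr; lra.
Qed.

(* The squares were found numerically. *)
Let pair_quartic a x :
  x ^+ 3 * a + x * a ^+ 3 <= (2 / 3 - 1 / 100) * x ^+ 4 + (2 - 1 / 100) * a ^+ 4.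
Proof.
have := sqr_ge0 (a ^+ 2 - a * x / 4 - 7 / 20 * x ^+ 2).
have := sqr_ge0 (a * x - 1 / 2 * x ^+ 2).
have := sqr_ge0 (x ^+ 2); have := sqr_ge0 (a * x); have := sqr_ge0 (a ^+ 2).
rewrite !exprS expr0 !mulr1; nra.
Qed.

Let pair_sextic a x :
  x ^+ 5 * a + x * a ^+ 5 <= (2 / 3 - 1 / 100) * x ^+ 6 + (2 - 1 / 100) * a ^+ 6.
Proof.
have := sqr_ge0 (a ^+ 3 - a ^+ 2 * x / 4 - 21 / 50 * a * x ^+ 2 + 1 / 20 * x ^+ 3).
have := sqr_ge0 (a ^+ 2 * x - 1 / 5 * a * x ^+ 2 - 38 / 100 * x ^+ 3).
have := sqr_ge0 (a * x ^+ 2 - 71 / 100 * x ^+ 3).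
have := sqr_ge0 (x ^+ 3); have := sqr_ge0 (a * x ^+ 2).
have := sqr_ge0 (a ^+ 2 * x); have := sqr_ge0 (a ^+ 3).
rewrite !exprS expr0 !mulr1; nra.
Qed.

(** The products among [a], [b], [e] are nonnegative and dropped. What remains is twice the sum of
    the powers minus three mixed terms pairing [x] with each of the others. Each mixed term may use
    the full coefficient 2 - 1/100 of its own variable, but only a third of that of [x]: this is the
    origin of 2/3 in the pair inequalities, and 1/100 is the margin left for coercivity. *)
Lemma form13_coercive q a b e x : q = 3%N \/ q = 5%N ->
  0 <= a -> 0 <= b -> 0 <= e -> 0 <= x ->
  100%:R^-1 * (a ^+ q.+1 + b ^+ q.+1 + e ^+ q.+1 + x ^+ q.+1) <=
  a ^+ q.+1 + b ^+ q.+1 + e ^+ q.+1 + x ^+ q.+1 +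
  (a ^+ q + b ^+ q + e ^+ q - x ^+ q) * (a + b + e - x).
Proof.
move=> q35 a0 b0 e0 x0.
have pair z : x ^+ q * z + x * z ^+ q <=
    (2 / 3 - 1 / 100) * x ^+ q.+1 + (2 - 1 / 100) * z ^+ q.+1.
  by case: q35 => ->.
have := pair a; have := pair b; have := pair e.
have : 0 <= x ^+ q.+1 by exact: exprn_ge0.
have i1 : 0 <= a ^+ q * b by rewrite mulr_ge0// exprn_ge0.
have i2 : 0 <= a ^+ q * e by rewrite mulr_ge0// exprn_ge0.
have i3 : 0 <= b ^+ q * a by rewrite mulr_ge0// exprn_ge0.
have i4 : 0 <= b ^+ q * e by rewrite mulr_ge0// exprn_ge0.
have i5 : 0 <= e ^+ q * a by rewrite mulr_ge0// exprn_ge0.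
have i6 : 0 <= e ^+ q * b by rewrite mulr_ge0// exprn_ge0.
rewrite !exprS; move: i1 i2 i3 i4 i5 i6.
set A := a ^+ q; set B := b ^+ q; set E := e ^+ q; set X := x ^+ q.
lra.
Qed.

Let sign_ind (Q : R -> Prop) :
  (forall x, 0 <= x -> Q x) -> (forall x, 0 <= x -> Q (- x)) -> forall x, Q x.
Proof.
move=> Qp Qn x; have [/Qp//|x0] := leP 0 x.
by rewrite -(opprK x); apply: Qn; rewrite oppr_ge0 ltW.
Qed.

Let exprN_odd q x : odd q -> (- x) ^+ q = - x ^+ q.
Proof. by move=> oq; rewrite exprNn -signr_odd oq expr1 mulN1r. Qed.

Let exprN_even q x : odd q -> (- x) ^+ q.+1 = x ^+ q.+1.
Proof. by move=> oq; rewrite exprNn -signr_odd /= oq expr0 mul1r. Qed.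

Let sumX_ge0 q a b e x : 0 <= a -> 0 <= b -> 0 <= e -> 0 <= x ->
  0 <= (a ^+ q + b ^+ q + e ^+ q + x ^+ q) * (a + b + e + x).
Proof. by move=> a0 b0 e0 x0; rewrite mulr_ge0// !addr_ge0// exprn_ge0. Qed.

(** Lets the constant of the two-against-two pattern serve for all sign patterns. *)
Let coef_le q : (3 <= q)%N -> (4%:R^-1 : R) ^+ q.+3 <= 100%:R^-1.
Proof.
move=> q3; apply: (@le_trans _ _ ((4%:R^-1 : R) ^+ 4)); last first.
  by rewrite !exprS expr0; lra.
have h0 : 0 <= 4%:R^-1 :> R by lra.
have h1 : 4%:R^-1 <= 1 :> R by lra.
by apply: ler_wiXn2l => //; rewrite !ltnS (leq_trans _ q3).
Qed.

(** In absolute values there are sixteen sign patterns, of three types up to a global sign: all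
    equal, one against three (four choices of the exceptional value), two against two (three
    pairings). The eight corresponding inequalities are supplied to every case, and [lra] selects
    the right one. *)
Let form4_coercive q a b e x : odd q -> q = 3%N \/ q = 5%N ->
  (4%:R^-1) ^+ q.+3 * (a ^+ q.+1 + b ^+ q.+1 + e ^+ q.+1 + x ^+ q.+1) <=
  a ^+ q.+1 + b ^+ q.+1 + e ^+ q.+1 + x ^+ q.+1 +
  (a ^+ q + b ^+ q + e ^+ q + x ^+ q) * (a + b + e + x).
Proof.
move=> oq q35; have q3 : (3 <= q)%N by case: q35 => ->.
have q0 : (0 < q)%N by exact: leq_trans q3.
have c0 : 0 <= (4%:R^-1 : R) ^+ q.+3 by rewrite exprn_ge0//; lra.
have cle := coef_le q3.
move: a; apply: sign_ind => a a0; move: b; apply: sign_ind => b b0;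
move: e; apply: sign_ind => e e0; move: x; apply: sign_ind => x x0.
all: rewrite ?(exprN_odd _ oq) ?(exprN_even _ oq).
all: have S0 : 0 <= a ^+ q.+1 + b ^+ q.+1 + e ^+ q.+1 + x ^+ q.+1
  by rewrite !addr_ge0// exprn_ge0.
all: have cS := ler_wpM2r S0 cle.
all: have h04 := sumX_ge0 q a0 b0 e0 x0.
all: have h1 := form13_coercive q35 a0 b0 e0 x0.
all: have h2 := form13_coercive q35 b0 e0 x0 a0.
all: have h3 := form13_coercive q35 e0 x0 a0 b0.
all: have h4 := form13_coercive q35 x0 a0 b0 e0.
all: have g1 := form22_coercive q0 a0 b0 e0 x0.
all: have g2 := form22_coercive q0 a0 e0 b0 x0.
all: have g3 := form22_coercive q0 a0 x0 b0 e0.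
all: move: c0 cle S0 cS h04 h1 h2 h3 h4 g1 g2 g3.
all: set c := _ ^+ q.+3; set a1 := a ^+ q.+1; set b1 := b ^+ q.+1;
  set e1 := e ^+ q.+1; set x1 := x ^+ q.+1; set a2 := a ^+ q; set b2 := b ^+ q;
  set e2 := e ^+ q; set x2 := x ^+ q => *; lra.
Qed.

(** With 0 added as a fourth value, two against one becomes an instance of two against two, which
    carries no upper bound on q. *)
Let form3_coercive q a b e : odd q -> (3 <= q)%N ->
  (4%:R^-1) ^+ q.+3 * (a ^+ q.+1 + b ^+ q.+1 + e ^+ q.+1) <=
  a ^+ q.+1 + b ^+ q.+1 + e ^+ q.+1 +
  (a ^+ q + b ^+ q + e ^+ q) * (a + b + e).
Proof.
move=> oq q3; have q0 : (0 < q)%N by exact: leq_trans q3.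
have c0 : 0 <= (4%:R^-1 : R) ^+ q.+3 by rewrite exprn_ge0//; lra.
have cle := coef_le q3.
have e00 : (0 : R) ^+ q = 0 by rewrite expr0n; case: (q) q0.
have e01 : (0 : R) ^+ q.+1 = 0 by rewrite expr0n.
move: a; apply: sign_ind => a a0; move: b; apply: sign_ind => b b0;
move: e; apply: sign_ind => e e0.
all: rewrite ?(exprN_odd _ oq) ?(exprN_even _ oq).
all: have S0 : 0 <= a ^+ q.+1 + b ^+ q.+1 + e ^+ q.+1
  by rewrite !addr_ge0// exprn_ge0.
all: have cS := ler_wpM2r S0 cle.
all: have h04 := sumX_ge0 q a0 b0 e0 (lexx 0).
all: have g1 := form22_coercive q0 a0 b0 e0 (lexx 0).
all: have g2 := form22_coercive q0 a0 e0 b0 (lexx 0).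
all: have g3 := form22_coercive q0 b0 e0 a0 (lexx 0).
all: rewrite e00 e01 !(addr0, subr0) in h04 g1 g2 g3.
all: move: c0 cle S0 cS h04 g1 g2 g3.
all: set c := _ ^+ q.+3; set a1 := a ^+ q.+1; set b1 := b ^+ q.+1;
  set e1 := e ^+ q.+1; set a2 := a ^+ q; set b2 := b ^+ q;
  set e2 := e ^+ q => *; lra.
Qed.

Lemma nodal_form_coercive d q (a : 'I_d.+1 -> R) : odd q -> (3 <= q)%N ->
  d = 2%N \/ (d = 3%N /\ (q = 3%N \/ q = 5%N)) ->
  (4%:R^-1) ^+ q.+3 * (\sum_k a k ^+ q.+1) <=
  \sum_k a k ^+ q.+1 + (\sum_k a k ^+ q) * (\sum_k a k).
Proof.
move=> oq q3 [dE|[dE q35]]; subst d; rewrite !big_ord_recl !big_ord0 !addr0 !addrA.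
  exact: form3_coercive.
exact: form4_coercive.
Qed.

End node_values.

(** * Lebesgue measure on row vectors *)

Section lebesgue_rV_theory.
Context {R : realType}.

Lemma lebesgue_measure_shift (a : R) (A : set R) : measurable A ->
  lebesgue_measure ((fun x => x + a) @^-1` A) = lebesgue_measure A.
Proof.
move=> mA.
have mf : measurable_fun setT (fun x : measurableTypeR R => x + a : measurableTypeR R).
  exact: measurable_funD.
apply/esym.
rewrite (lebesgue_measure_unique (mu := pushforward (@lebesgue_measure R)
  (fun x : measurableTypeR R => x + a : measurableTypeR R))) //.
move=> _ [[x y]] _ <- /=; rewrite /pushforward/=.
rewrite (_ : _ @^-1` _ = `]x - a, y - a]%classic); last first.
  by apply/seteqP; split => z /=; rewrite !in_itv/= ltrBlDr lerBrDr.
rewrite !lebesgue_measure_itv/= !lte_fin ltrD2r; case: ifP => // _.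
by rewrite -!EFinB; congr EFin; lra.
Qed.

Lemma rV_cons_eta n (v : 'rV[R]_n.+1) : v = rV_cons (v ord0 ord0, \row_j v ord0 (lift ord0 j)).
Proof.
apply/rowP => i; case: (unliftP ord0 i) => [j|] ->; rewrite ?rV_cons_head ?rV_cons_lift//.
by rewrite mxE.
Qed.

Lemma lebesgue_rVS n (A : set 'rV[R]_n.+1) :
  (lebesgue_rV n.+1 A = \int[@lebesgue_measure R]_h lebesgue_rV n [set v | A (rV_cons (h, v))])%E.
Proof.
rewrite /= /lebesgue_rV_step /pushforward/= /product_measure1.
apply: eq_integral => h _ /=; rewrite /xsection/=; congr (lebesgue_rV n _).
by apply/seteqP; split => v /=; rewrite inE.
Qed.

Lemma measurable_rV_slice n (A : set 'rV[R]_n.+1) : measurable A ->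
  measurable_fun setT (fun h : measurableTypeR R => lebesgue_rV n [set v | A (rV_cons (h, v))]).
Proof.
move=> mA.
have mB : measurable (@rV_cons R n @^-1` A).
  by rewrite -[X in measurable X]setTI; exact: measurable_rV_cons.
have := measurable_fun_xsection (lebesgue_rV n) mB.
apply: eq_measurable_fun => h _ /=; congr (lebesgue_rV n _).
by rewrite /xsection; apply/seteqP; split => v /=; rewrite inE.
Qed.

Lemma measurable_preimageT d1 d2 (T1 : measurableType d1) (T2 : measurableType d2)
    (f : T1 -> T2) (A : set T2) :
  measurable_fun setT f -> measurable A -> measurable (f @^-1` A).
Proof. by move=> mf mA; rewrite -[X in measurable X]setTI; exact: mf. Qed.

Lemma measurable_slice n (A : set 'rV[R]_n.+1) (h : R) : measurable A ->
  measurable [set v | A (rV_cons (h, v))].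
Proof.
move=> mA; have mB := measurable_preimageT (@measurable_rV_cons R n) mA.
exact: (measurable_preimageT (pair1_measurable (h : measurableTypeR R)) mB).
Qed.

(** Induction by slices along the first coordinate: the head of [a] shifts the slice parameter,
    which one-dimensional invariance absorbs, and the tail of [a] shifts each slice, where the
    induction hypothesis applies. *)
Lemma lebesgue_rV_shift n (a : 'rV[R]_n) (A : set 'rV[R]_n) : measurable A ->
  lebesgue_rV n ((fun x => x + a) @^-1` A) = lebesgue_rV n A.
Proof.
elim: n a A => [|n IH] a A mA.
  congr (lebesgue_rV 0 _); apply/funext => x /=; congr (A _).
  by apply/rowP => -[].
rewrite (rV_cons_eta a) !lebesgue_rVS.
set a0 := a _ _; set b := \row_j _.
pose F (h : R) := lebesgue_rV n [set v | A (rV_cons (h, v))].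
have mF : measurable_fun setT (F : measurableTypeR R -> \bar R) by exact: measurable_rV_slice.
pose s (x : measurableTypeR R) : measurableTypeR R := (x : R) + a0.
have ms : measurable_fun setT s by exact: measurable_funD.
transitivity (\int[@lebesgue_measure R]_(h in s @^-1` setT) (F \o s) h)%E.
  rewrite preimage_setT; apply: eq_integral => h _ /=.
  rewrite [RHS]/F -(IH b _ (measurable_slice (s h) mA)).
  congr (lebesgue_rV n _); apply/funext => v /=; congr (A _).
  apply/rowP => i; rewrite mxE; case: (unliftP ord0 i) => [j|] ->.
    by rewrite !rV_cons_lift [RHS]mxE.
  by rewrite !rV_cons_head.
rewrite -ge0_integral_pushforward//.
by apply: eq_measure_integral => //= B mB _; exact: lebesgue_measure_shift.
Qed.

Lemma measurable_rV_opp n : measurable_fun setT (fun x : 'rV[R]_n => - x).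
Proof.
apply/measurable_fun_rVP => i; under eq_fun do rewrite mxE.
by apply: measurable_funN => //; exact: measurable_coord.
Qed.

Lemma measurable_dotv n (b : 'rV[R]_n) : measurable_fun setT (dotv b).
Proof.
apply: measurable_sum => j; apply: measurable_funM => //; exact: measurable_coord.
Qed.

(** If the tail of [b] is nonzero, every slice is a hyperplane of one dimension less. Otherwise the
    hyperplane fixes the first coordinate, and all slices but one are empty. *)
Lemma lebesgue_rV_hyperplane n (b : 'rV[R]_n) (a : R) : b != 0 ->
  lebesgue_rV n [set x | dotv b x = a] = 0%E.
Proof.
elim: n b a => [|n IH] b a b0; first by rewrite thinmx0 eqxx in b0.
rewrite lebesgue_rVS.
have dotE (h : R) (v : 'rV_n) : dotv b (rV_cons (h, v)) =
    b ord0 ord0 * h + dotv (\row_j b ord0 (lift ord0 j)) v.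
  rewrite /dotv big_ord_recl rV_cons_head; congr (_ + _); apply: eq_bigr => i _.
  by rewrite rV_cons_lift mxE.
have [bt0|bt0] := eqVneq (\row_j b ord0 (lift ord0 j)) (0 : 'rV_n); last first.
  rewrite integral0_eq// => h _ /=.
  rewrite -[RHS](IH (\row_j b ord0 (lift ord0 j)) (a - b ord0 ord0 * h) bt0).
  by congr (lebesgue_rV n _); apply/seteqP; split => v /=; rewrite dotE; lra.
have b00 : b ord0 ord0 != 0.
  apply: contra b0 => /eqP b00; rewrite (rV_cons_eta b) bt0 b00; apply/eqP/rowP => i.
  by case: (unliftP ord0 i) => [j|] ->; rewrite ?rV_cons_head ?rV_cons_lift !mxE.
rewrite -[RHS](integral_set1
  (fun h : R => lebesgue_rV n [set v | [set x | dotv b x = a] (rV_cons (h, v))]) (a / b ord0 ord0)).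
rewrite [RHS]integral_mkcond; apply: eq_integral => h _; rewrite patchE.
case: ifPn => //; rewrite notin_setE/= => hn.
rewrite -[RHS](measure0 (lebesgue_rV n)); congr (lebesgue_rV n _).
apply/seteqP; split => v //=; rewrite dotE bt0 => e; apply: hn.
rewrite -e (_ : dotv 0 v = 0) ?addr0; first by rewrite mulrC mulKf.
by rewrite /dotv big1// => i _; rewrite mxE mul0r.
Qed.

(** The sigma-algebra is generated by the coordinates, so openness has to be expressed by countably
    many coordinate conditions. Balls of the max norm are boxes, and an open set is the union of the
    boxes with rational centre and radius 1/(k+1) that it contains. *)
Lemma open_measurable_rV n (A : set 'rV[R]_n) : open A -> measurable A.
Proof.
move=> oA.
pose bx (p : 'rV[rat]_n * nat) : set 'rV[R]_n :=
  [set x | forall i, `|x ord0 i - ratr (p.1 ord0 i)| < p.2.+1%:R^-1].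
have -> : A = \bigcup_(p in [set p | bx p `<=` A]) bx p.
  apply/seteqP; split; last by move=> x [p pA /pA].
  move=> x Ax.
  have [e /= e0 xeA] := (nbhs_ballP x A).1 (open_nbhs_nbhs (conj oA Ax)).
  have [k ke] : exists k : nat, k.+1%:R^-1 < e / 2.
    have [k _ /(_ k (leqnn _))] := near_infty_natSinv_lt (PosNum (divr_gt0 e0 (ltr0Sn R 1))).
    by exists k.
  have /choice[r rP] : forall i, exists r : rat, `|x ord0 i - ratr r| < k.+1%:R^-1.
    move=> i.
    have xk : x ord0 i - k.+1%:R^-1 < x ord0 i + k.+1%:R^-1.
      by rewrite ltrD2l gtrN// invr_gt0.
    have [r] := rat_in_itvoo xk; rewrite in_itv/= => /andP[r1 r2]; exists r.
    by move: r1 r2; set z := k.+1%:R^-1 => r1 r2; rewrite ltr_norml; apply/andP; split; lra.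
  exists (\row_i r i, k) => /=; last by move=> i; rewrite mxE; exact: rP.
  move=> y yr; apply: xeA; rewrite -ball_normE /= [ltLHS]mx_normrE.
  apply/bigmax_ltP; split=> // -[i j] _; rewrite !ord1 !mxE.
  have := yr j; have := rP j; rewrite /= mxE => h1 h2.
  move: ke h1 h2; set z := k.+1%:R^-1 => ke h1 h2.
  rewrite (_ : _ - _ = (x ord0 j - ratr (r j)) - (y ord0 j - ratr (r j))); last by lra.
  by rewrite (le_lt_trans (ler_normB _ _))//; lra.
rewrite bigcup_mkcond; apply: countable_bigcupT_measurable => // p.
case: ifP => // _.
rewrite (_ : bx p = \bigcap_(i in [set: 'I_n])
   ((fun v : 'rV[R]_n => `|v ord0 i - ratr (p.1 ord0 i)|) @^-1` `]-oo, p.2.+1%:R^-1[)); last first.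
  by apply/seteqP; split => [x h i _|x h i]; have := h i; rewrite /= in_itv//=; apply.
apply: fin_bigcap_measurable => // i _; apply: measurable_preimageT => //.
apply: measurableT_comp => //; apply: measurable_funB => //; exact: measurable_coord.
Qed.

Lemma bounded_lebesgue_rV_lty n (A : set 'rV[R]_n) : measurable A -> bounded_set A ->
  (lebesgue_rV n A < +oo)%E.
Proof.
move=> mA [M [_ /(_ (`|M| + 1))]]; rewrite (le_lt_trans (ler_norm _)) ?ltrDl// => /(_ isT) AM.
pose B : set 'rV[R]_n := [set x | forall i, x ord0 i \in `[- (`|M| + 1), `|M| + 1] ].
apply: (@le_lt_trans _ _ (lebesgue_rV n B)); last first.
  rewrite lebesgue_rV_box ?ltry// => i.
  by have := normr_ge0 M; lra.
have mB : measurable B.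
  rewrite (_ : B = \bigcap_(i in [set: 'I_n])
    ((fun v : 'rV[R]_n => v ord0 i) @^-1` `[- (`|M| + 1), `|M| + 1])); last first.
    by apply/seteqP; split => [x h i _|x h i]; have := h i; rewrite /=; apply.
  by apply: fin_bigcap_measurable => // i _; apply: measurable_preimageT => //; exact: measurable_coord.
rewrite le_measure ?inE// => x /AM /= xM i.
rewrite in_itv/= -ler_norml (le_trans _ xM)// [leRHS]mx_normrE.
by apply: le_trans (le_bigmax _ _ (ord0, i)).
Qed.

Lemma lebesgue_rV_unit_box n :
  lebesgue_rV n [set x : 'rV[R]_n | forall i, x ord0 i \in `[0, 1] ] = 1%E.
Proof.
by rewrite (lebesgue_rV_box (fun=> ler01)) big1// => i _; rewrite subr0.
Qed.

Lemma measurable_unit_box n :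
  measurable [set x : 'rV[R]_n | forall i, x ord0 i \in `[0, 1] ].
Proof.
rewrite (_ : mkset _ = \bigcap_(i in [set: 'I_n])
    ((fun v : 'rV[R]_n => v ord0 i) @^-1` `[0, 1])); last first.
  by apply/seteqP; split => [x h i _|x h i]; have := h i; rewrite /=; apply.
by apply: fin_bigcap_measurable => // i _; apply: measurable_preimageT => //; exact: measurable_coord.
Qed.

(** * Uniqueness of translation-invariant measures up to a factor *)

Section haar.
Variables (n : nat) (nu : {sigma_finite_measure set 'rV[R]_n -> \bar R}).
Hypothesis nu_shift : forall (a : 'rV[R]_n) (A : set 'rV[R]_n), measurable A ->
  nu ((fun x => x + a) @^-1` A) = nu A.
Local Notation mu := (lebesgue_rV n).

Let measurable_add2 : measurable_fun setT (fun z : 'rV[R]_n * 'rV[R]_n => z.1 + z.2).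
Proof.
apply/measurable_fun_rVP => i; under eq_fun do rewrite mxE.
by apply: measurable_funD; apply: (measurableT_comp (measurable_coord i)).
Qed.

Let measurable_sub2 : measurable_fun setT (fun z : 'rV[R]_n * 'rV[R]_n => z.1 - z.2).
Proof.
apply/measurable_fun_rVP => i; under eq_fun do rewrite !mxE.
by apply: measurable_funB; apply: (measurableT_comp (measurable_coord i)).
Qed.

(* Tonelli for the indicator of {(x, y) | x \in E, x - y \in B} under nu x mu. *)
Lemma shift_invariant_measure_opp (E B : set 'rV[R]_n) : measurable E -> measurable B ->
  (nu E * mu (-%R @^-1` B) = nu B * mu E)%E.
Proof.
move=> mE mB.
pose S1 : set ('rV[R]_n * 'rV[R]_n) := fst @^-1` E `&` (fun z => z.1 - z.2) @^-1` B.
pose S2 : set ('rV[R]_n * 'rV[R]_n) := fst @^-1` B `&` (fun z => z.1 + z.2) @^-1` E.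
have mS1 : measurable S1.
  by apply: measurableI; apply: measurable_preimageT => //; exact: measurable_fst.
have mS2 : measurable S2.
  by apply: measurableI; apply: measurable_preimageT => //; exact: measurable_fst.
have mNB : measurable (-%R @^-1` B) by apply: measurable_preimageT => //; exact: measurable_rV_opp.
have sec_aux (m : {measure set 'rV[R]_n -> \bar R}) (C : set 'rV[R]_n) (r : \bar R)
    (F : 'rV[R]_n -> \bar R) : measurable C -> (0 <= r)%E ->
    (forall x, F x = if x \in C then r else 0%E) -> (\int[m]_x F x = r * m C)%E.
  move=> mC r0 FE; under eq_integral => x _ do rewrite FE.
  rewrite -[in RHS](setIT C) -integral_indic// -ge0_integralZl//.
  - by apply: eq_integral => x _; rewrite indicE; case: ifP => _; rewrite ?mule1 ?mule0.
  - exact/measurable_EFinP/measurable_indic.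
have e1 : (\int[nu]_x (mu \o xsection S1) x = mu (-%R @^-1` B) * nu E)%E.
  apply: sec_aux => // x.
  rewrite /=; case: ifPn => [/set_mem Ex|].
    rewrite -(lebesgue_rV_shift (- x) mNB); congr (mu _); rewrite /xsection.
    by apply/seteqP; split => y /=; rewrite inE /S1/= ?opprB//; case.
  rewrite notin_setE => Ex; rewrite -[RHS](measure0 mu); congr (mu _).
  by rewrite /xsection; apply/seteqP; split => y //=; rewrite inE => -[].
have e2 : (\int[nu]_x (mu \o xsection S2) x = mu E * nu B)%E.
  apply: sec_aux => // x.
  rewrite /=; case: ifPn => [/set_mem Bx|].
    rewrite -(lebesgue_rV_shift x mE); congr (mu _); rewrite /xsection.
    by apply/seteqP; split => y /=; rewrite inE /S2/= addrC//; case.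
  rewrite notin_setE => Bx; rewrite -[RHS](measure0 mu); congr (mu _).
  by rewrite /xsection; apply/seteqP; split => y //=; rewrite inE => -[].
rewrite muleC -e1 [RHS]muleC -e2.
have swap S : measurable S ->
    (\int[nu]_x (mu \o xsection S) x = \int[mu]_y (nu \o ysection S) y)%E.
  move=> mS; rewrite -(indic_fubini_tonelli_FE mu mS) -(indic_fubini_tonelli_GE nu mS).
  exact: indic_fubini_tonelli.
rewrite !swap//.
apply: eq_integral => y _ /=.
rewrite -(nu_shift y); last exact: measurable_ysection.
congr (nu _); rewrite /ysection; apply/seteqP; split => x /=; rewrite !inE /S1 /S2/= addrK => -[]//.
Qed.

End haar.

(** The exchange identity applied to Lebesgue measure itself, with [E] the unit box: both factors
    equal to 1 disappear. It then removes the reflection from the identity for a general invariant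
    measure. *)
Lemma lebesgue_rV_opp n (B : set 'rV[R]_n) : measurable B ->
  lebesgue_rV n (-%R @^-1` B) = lebesgue_rV n B.
Proof.
move=> mB; have := shift_invariant_measure_opp (@lebesgue_rV_shift n) (@measurable_unit_box n) mB.
by rewrite lebesgue_rV_unit_box mul1e mule1.
Qed.

Lemma shift_invariant_measureE n (nu : {sigma_finite_measure set 'rV[R]_n -> \bar R}) :
  (forall (a : 'rV[R]_n) (A : set 'rV[R]_n), measurable A ->
    nu ((fun x => x + a) @^-1` A) = nu A) ->
  forall E B, measurable E -> measurable B ->
  (nu E * lebesgue_rV n B = nu B * lebesgue_rV n E)%E.
Proof. by move=> nuS E B mE mB; rewrite -(lebesgue_rV_opp mB) shift_invariant_measure_opp. Qed.

End lebesgue_rV_theory.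

(* Any measure invariant under translations is proportional to Lebesgue measure, so a
   bijection compatible with translations scales it by a factor that can be read off
   one set; this replaces the determinant formula. *)
Section change_of_variables.
Context {R : realType} (n : nat).
Local Notation mu := (@lebesgue_rV R n).
Variables (T T' : 'rV[R]_n -> 'rV[R]_n).
Hypothesis mT : measurable_fun setT T.
Hypothesis mT' : measurable_fun setT T'.
Hypothesis TK : cancel T T'.
Hypothesis T_shift : forall a, exists a', forall x, T (x + a') = T x + a.

Definition push_lebesgue_rV : set 'rV[R]_n -> \bar R := pushforward mu T.

Let push0 : push_lebesgue_rV set0 = 0%E.
Proof. by rewrite /push_lebesgue_rV /pushforward preimage_set0 measure0. Qed.

Let push_ge0 A : (0 <= push_lebesgue_rV A)%E.
Proof. exact: measure_ge0. Qed.

Let push_sigma_additive : semi_sigma_additive push_lebesgue_rV.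
Proof. exact: measure_semi_sigma_additive. Qed.

HB.instance Definition _ := isMeasure.Build _ _ _
  push_lebesgue_rV push0 push_ge0 push_sigma_additive.

Let push_sigma_finite : sigma_finite setT push_lebesgue_rV.
Proof.
have [F UF mF] := sigma_finiteT mu.
(* An exhaustion for the image measure: by [TK], pulling these sets back along [T] returns the sets
   [F k], which have finite measure. *)
exists (fun k => T' @^-1` F k).
  by rewrite -preimage_bigcup -UF preimage_setT.
move=> k; have [mFk Fk] := mF k; split; first exact: measurable_preimageT.
rewrite /push_lebesgue_rV /pushforward (_ : _ @^-1` _ = F k)//.
by apply/seteqP; split => x /=; rewrite TK.
Qed.

HB.instance Definition _ := Measure_isSigmaFinite.Build _ _ _
  push_lebesgue_rV push_sigma_finite.

Lemma preimage_measure_ratio E B : measurable E -> measurable B ->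
  (mu (T @^-1` E) * mu B = mu (T @^-1` B) * mu E)%E.
Proof.
move=> mE mB.
apply: (@shift_invariant_measureE _ _ push_lebesgue_rV) => // a A mA.
have [a' aa'] := T_shift a.
rewrite /= /push_lebesgue_rV /pushforward -[RHS](lebesgue_rV_shift a').
  by congr (mu _); apply/seteqP; split => x /=; rewrite aa'.
exact: measurable_preimageT.
Qed.

Lemma preimage_measureZ (r : R) B : measurable B -> 0 <= r ->
  mu B != 0%E -> (mu B < +oo)%E -> mu (T @^-1` B) = (r%:E * mu B)%E ->
  forall E, measurable E -> mu (T @^-1` E) = (r%:E * mu E)%E.
Proof.
move=> mB r0 B0 Boo TB E mE; have := preimage_measure_ratio mE mB.
rewrite TB -muleA [(mu B * _)%E]muleC muleA => /eqP.
have Bfin : mu B \is a fin_num by rewrite ge0_fin_numE.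
rewrite -(fineK Bfin).
have fB0 : fine (mu B) != 0.
  by apply: contra B0 => /eqP B0; rewrite -(fineK Bfin) B0.
move=> /eqP/(congr1 (fun z => z * ((fine (mu B))^-1)%:E)%E).
by rewrite -!muleA -!EFinM divff// !mule1.
Qed.

Lemma ge0_integral_preimage (r : R) (E : set 'rV[R]_n) (f : 'rV[R]_n -> \bar R) :
  0 <= r -> measurable E -> measurable_fun E f -> (forall x, E x -> 0 <= f x)%E ->
  (forall A, measurable A -> mu (T @^-1` A) = r%:E * mu A)%E ->
  (\int[mu]_(x in T @^-1` E) f (T x) = r%:E * \int[mu]_(x in E) f x)%E.
Proof.
move=> r0 mE mf f0 TA.
rewrite -(ge0_integral_pushforward mT)//; last by move=> y /set_mem; exact: f0.
rewrite -[RHS](@ge0_integral_mscale _ _ R mu E mE (NngNum r0) f mf f0).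
by apply: eq_measure_integral => A mA _ /=; rewrite /pushforward TA.
Qed.

End change_of_variables.

(** * Barycentric coordinates *)

Section barycentric.
Context {R : realType} (d : nat) (p : 'I_d.+1 -> 'rV[R]_d).
Hypothesis hp : affinely_independent p.
Local Notation mu := (@lebesgue_rV R d).
Implicit Types (c : 'rV[R]_d.+1) (x a : 'rV[R]_d) (k l : 'I_d.+1).

Definition baryv x : 'rV[R]_d.+1 := rV_cons (1, x) *m invmx (bary_mx p).
(** The linear part of [baryv]: the coordinates of a direction, whose sum is 0 instead of 1. *)
Definition bary_dir a : 'rV[R]_d.+1 := rV_cons (0, a) *m invmx (bary_mx p).
Definition bary_point c : 'rV[R]_d := \sum_k c ord0 k *: p k.

Lemma baryvE x k : baryv x ord0 k = bary p k x. Proof. by []. Qed.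

Let bary_mxE k : row k (bary_mx p) = rV_cons (1, p k).
Proof. by apply/rowP => i; rewrite !mxE. Qed.

Let rV_consZ (s t : R) x : s *: rV_cons (t, x) = rV_cons (s * t, s *: x).
Proof.
apply/rowP => i; rewrite mxE; case: (unliftP ord0 i) => [j|] ->.
  by rewrite !rV_cons_lift [RHS]mxE.
by rewrite !rV_cons_head.
Qed.

Let rV_consD (s t : R) x a : rV_cons (s, x) + rV_cons (t, a) = rV_cons (s + t, x + a).
Proof.
apply/rowP => i; rewrite mxE; case: (unliftP ord0 i) => [j|] ->.
  by rewrite !rV_cons_lift [RHS]mxE.
by rewrite !rV_cons_head.
Qed.

(** Row k of the matrix is (1, p k), so this single identity carries both the sum of the coordinates
    and the point they represent. All inversion formulas below are read off its two components. *)
Lemma mul_bary_mx c : c *m bary_mx p = rV_cons (\sum_k c ord0 k, bary_point c).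
Proof.
rewrite mulmx_sum_row (eq_bigr (fun k => rV_cons (c ord0 k, c ord0 k *: p k))); last first.
  by move=> k _; rewrite bary_mxE rV_consZ mulr1.
apply/rowP => i; rewrite summxE; case: (unliftP ord0 i) => [j|] ->.
  rewrite rV_cons_lift [RHS]summxE; apply: eq_bigr => k _.
  by rewrite rV_cons_lift.
by rewrite rV_cons_head; apply: eq_bigr => k _; rewrite rV_cons_head.
Qed.

Let unitB : bary_mx p \in unitmx. Proof. exact: hp. Qed.

Let eq_lr (s t : R) (x a : 'rV[R]_d) :
  rV_cons (s, x) = rV_cons (t, a) -> s = t /\ x = a.
Proof.
move=> e; split; first by have /rowP/(_ ord0) := e; rewrite !rV_cons_head.
by apply/rowP => j; have /rowP/(_ (lift ord0 j)) := e; rewrite !rV_cons_lift.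
Qed.

Let baryvK x : rV_cons (\sum_k baryv x ord0 k, bary_point (baryv x)) = rV_cons (1, x).
Proof. by rewrite -mul_bary_mx /baryv mulmxKV. Qed.

Lemma sum_bary x : \sum_k bary p k x = 1.
Proof. by have [] := eq_lr (baryvK x). Qed.

Lemma bary_pointK x : bary_point (baryv x) = x.
Proof. by have [] := eq_lr (baryvK x). Qed.

Lemma bary_point_inj c : \sum_k c ord0 k = 1 -> baryv (bary_point c) = c.
Proof. by move=> c1; rewrite /baryv -c1 -mul_bary_mx mulmxK. Qed.

Let bary_dirK a : rV_cons (\sum_k bary_dir a ord0 k, bary_point (bary_dir a)) = rV_cons (0, a).
Proof. by rewrite -mul_bary_mx /bary_dir mulmxKV. Qed.

Lemma sum_bary_dir a : \sum_k bary_dir a ord0 k = 0.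
Proof. by have [] := eq_lr (bary_dirK a). Qed.

Lemma bary_point_dir a : bary_point (bary_dir a) = a.
Proof. by have [] := eq_lr (bary_dirK a). Qed.

Lemma bary_dir_point c : \sum_k c ord0 k = 0 -> bary_dir (bary_point c) = c.
Proof. by move=> c0; rewrite /bary_dir -c0 -mul_bary_mx mulmxK. Qed.

Lemma baryvD x a : baryv (x + a) = baryv x + bary_dir a.
Proof. by rewrite /baryv /bary_dir -mulmxDl rV_consD addr0. Qed.

Lemma bary_pointD c c' : bary_point (c + c') = bary_point c + bary_point c'.
Proof.
by rewrite /bary_point -big_split/=; apply: eq_bigr => k _; rewrite mxE scalerDl.
Qed.

Lemma baryE x k : bary p k x = bary p k 0 + dotv (bary_grad p k) x.
Proof.
rewrite -!baryvE -{1}(add0r x) baryvD mxE; congr (_ + _).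
rewrite /bary_dir mxE big_ord_recl rV_cons_head mul0r add0r.
by apply: eq_bigr => j _; rewrite rV_cons_lift mulrC [in RHS]mxE.
Qed.

Lemma measurable_bary k : measurable_fun setT (bary p k).
Proof.
rewrite (_ : bary p k = fun x => bary p k 0 + dotv (bary_grad p k) x); last first.
  by apply/funext => x; exact: baryE.
by apply: measurable_funD => //; exact: measurable_dotv.
Qed.

Lemma bary_vertex k l : bary p k (p l) = (k == l)%:R.
Proof.
have e : bary_point (delta_mx ord0 l) = p l.
  rewrite /bary_point (bigD1 l)//= mxE !eqxx scale1r big1 ?addr0// => i il.
  by rewrite mxE (negbTE il) andbF scale0r.
rewrite -baryvE -e bary_point_inj ?mxE//.
rewrite (bigD1 l)//= mxE !eqxx big1 ?addr0// => i il.
by rewrite mxE (negbTE il) andbF.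
Qed.

Lemma affine_zero_null (f : 'rV[R]_d -> R) (s : R) (b x0 : 'rV[R]_d) :
  (forall x, f x = s + dotv b x) -> f x0 != 0 -> mu [set x | f x = 0] = 0%E.
Proof.
move=> fE fx0; have [b0|b0] := eqVneq b 0.
  rewrite -[RHS](measure0 mu); congr (mu _); apply/seteqP; split => x //=.
  have d0 y : dotv b y = 0 by rewrite b0 /dotv big1// => i _; rewrite mxE mul0r.
  by rewrite fE d0 => sx; move: fx0; rewrite fE d0 sx eqxx.
rewrite -[RHS](lebesgue_rV_hyperplane (- s) b0); congr (mu _).
by apply/seteqP; split => x /=; rewrite fE; lra.
Qed.

Lemma measurable_bary_eq0 k : measurable [set x | bary p k x = 0].
Proof.
have := measurable_preimageT (measurable_bary k) (measurable_set1 0).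
by congr measurable; apply/seteqP.
Qed.

Lemma bary_eq0_null k : mu [set x | bary p k x = 0] = 0%E.
Proof.
by apply: (affine_zero_null (x0 := p k) (baryE ^~ k)); rewrite bary_vertex eqxx oner_eq0.
Qed.

Lemma bary_eq_null k l : k != l -> mu [set x | bary p k x = bary p l x] = 0%E.
Proof.
move=> kl.
rewrite -[RHS](@affine_zero_null (fun x => bary p k x - bary p l x)
  (bary p k 0 - bary p l 0) (bary_grad p k - bary_grad p l) (p k)).
- by congr (mu _); apply/seteqP; split => x /= h; lra.
- move=> x; rewrite [in LHS](baryE x k) (baryE x l)
    (_ : dotv (_ - _) x = dotv (bary_grad p k) x - dotv (bary_grad p l) x); first lra.
  by rewrite /dotv -sumrB; apply: eq_bigr => i _; rewrite !mxE mulrBl.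
- by rewrite !bary_vertex eqxx [l == k]eq_sym (negbTE kl) subr0 oner_eq0.
Qed.

Definition open_simplex : set 'rV[R]_d := [set x | forall k, 0 < bary p k x].

Lemma measurable_open_simplex : measurable open_simplex.
Proof.
rewrite (_ : open_simplex = \bigcap_(k in [set: 'I_d.+1]) (bary p k @^-1` `]0, +oo[)); last first.
  by apply/seteqP; split => [x h k _|x h k]; have := h k; rewrite /= in_itv/= andbT//; apply.
by apply: fin_bigcap_measurable => // k _; apply: measurable_preimageT => //; exact: measurable_bary.
Qed.

Lemma open_simplex_le1 x k : open_simplex x -> bary p k x <= 1.
Proof.
move=> xS; rewrite -(sum_bary x) (bigD1 k)//= lerDl sumr_ge0// => l _.
exact/ltW/xS.
Qed.

Lemma bounded_open_simplex : bounded_set open_simplex.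
Proof.
exists (\sum_k `|p k|); split; first exact: num_real.
move=> M hM x xS /=; rewrite -(bary_pointK x) (le_trans (ler_norm_sum _ _ _))//.
rewrite (le_trans _ (ltW hM))//; apply: ler_sum => k _.
rewrite normrZ ler_piMl// baryvE ger0_norm ?open_simplex_le1//.
exact/ltW/xS.
Qed.

Lemma open_simplex_lty : (mu open_simplex < +oo)%E.
Proof.
apply: bounded_lebesgue_rV_lty; [exact: measurable_open_simplex|exact: bounded_open_simplex].
Qed.

Lemma measurable_baryv : measurable_fun setT baryv.
Proof. by apply/measurable_fun_rVP => k; exact: measurable_bary. Qed.

Lemma measurable_bary_point : measurable_fun setT bary_point.
Proof.
apply/measurable_fun_rVP => i.
rewrite (_ : (fun _ => _) = fun c : 'rV[R]_d.+1 => \sum_k c ord0 k * p k ord0 i); last first.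
  by apply/funext => c; rewrite summxE; apply: eq_bigr => k _; rewrite mxE.
by apply: measurable_sum => k; apply: measurable_funM => //; exact: measurable_coord.
Qed.

(** An additive bijection of coordinate vectors that preserves their sum acts on points through
    barycentric coordinates. Being compatible with translations, it scales Lebesgue measure by a
    constant, so knowing the factor [r] on one set [B] of finite nonzero measure gives the change of
    variables for all integrals. *)
Lemma bary_change (s s' : 'rV[R]_d.+1 -> 'rV[R]_d.+1) :
  {morph s : u v / u + v} ->
  (forall c, \sum_k s c ord0 k = \sum_k c ord0 k) ->
  (forall c, \sum_k s' c ord0 k = \sum_k c ord0 k) ->
  cancel s s' -> cancel s' s ->
  measurable_fun setT s -> measurable_fun setT s' ->
  exists2 T : 'rV[R]_d -> 'rV[R]_d,
    measurable_fun setT T /\ (forall x, baryv (T x) = s (baryv x)) &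
    forall r B, 0 <= r -> measurable B -> mu B != 0%E -> (mu B < +oo)%E ->
      mu (T @^-1` B) = (r%:E * mu B)%E ->
    forall (E : set 'rV[R]_d) f, measurable E -> measurable_fun E f ->
      (forall x, E x -> 0 <= f x)%E ->
      (\int[mu]_(x in T @^-1` E) f (T x) = r%:E * \int[mu]_(x in E) f x)%E.
Proof.
move=> sD sS s'S sK s'K ms ms'.
pose T x := bary_point (s (baryv x)); pose T' x := bary_point (s' (baryv x)).
have bT x : baryv (T x) = s (baryv x).
  by rewrite /T bary_point_inj// sS; exact: sum_bary.
have mT : measurable_fun setT T.
  apply: (measurableT_comp measurable_bary_point).
  exact: (measurableT_comp ms measurable_baryv).
have mT' : measurable_fun setT T'.
  apply: (measurableT_comp measurable_bary_point).
  exact: (measurableT_comp ms' measurable_baryv).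
have TK : cancel T T' by move=> x; rewrite /T' bT sK bary_pointK.
have T_shift a : exists a', forall x, T (x + a') = T x + a.
  (* The translation vector that the induced map turns into [a], found by applying the inverse [s']
     to the coordinates of the direction [a]. *)
  exists (bary_point (s' (bary_dir a))) => x.
  rewrite /T baryvD bary_dir_point; last by rewrite s'S sum_bary_dir.
  by rewrite sD s'K bary_pointD bary_point_dir.
exists T => // r B r0 mB B0 Boo TB E f mE mf f0.
apply: ge0_integral_preimage => // A mA.
exact: (preimage_measureZ mT mT' TK T_shift mB).
Qed.

Hypothesis mu_neq0 : mu open_simplex != 0%E.

(** Permuting the coordinates maps the open simplex onto itself, so the simplex serves as the
    reference set and the factor is 1. *)
Lemma bary_perm (s : {perm 'I_d.+1}) :
  exists2 T : 'rV[R]_d -> 'rV[R]_d,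
    measurable_fun setT T /\ (forall k x, bary p k (T x) = bary p (s k) x) &
    forall (E : set 'rV[R]_d) f, measurable E -> measurable_fun E f ->
      (forall x, E x -> 0 <= f x)%E ->
      (\int[mu]_(x in T @^-1` E) f (T x) = \int[mu]_(x in E) f x)%E.
Proof.
pose pm (s : {perm 'I_d.+1}) (c : 'rV[R]_d.+1) : 'rV[R]_d.+1 := \row_k c ord0 (s k).
have pmS t c : \sum_k pm t c ord0 k = \sum_k c ord0 k.
  by rewrite [RHS](reindex_perm t); apply: eq_bigr => k _; rewrite mxE.
have mpm t : measurable_fun setT (pm t).
  apply/measurable_fun_rVP => k.
  rewrite (_ : (fun _ => _) = fun c : 'rV[R]_d.+1 => c ord0 (t k)); first exact: measurable_coord.
  by apply/funext => c; rewrite mxE.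
have [|||T [mT bT] TI] := @bary_change (pm s) (pm s^-1%g) _ (pmS s) (pmS _) _ _ (mpm s) (mpm _).
- by move=> u v; apply/rowP => k; rewrite !mxE.
- by move=> c; apply/rowP => k; rewrite !mxE permKV.
- by move=> c; apply/rowP => k; rewrite !mxE permK.
have bT' k x : bary p k (T x) = bary p (s k) x.
  by rewrite -!baryvE bT mxE.
exists T => // E f mE mf f0.
rewrite (TI 1 open_simplex)// ?mul1e//.
- exact: measurable_open_simplex.
- exact: open_simplex_lty.
congr (mu _); apply/seteqP; split => x /= h k; last by rewrite bT'.
by rewrite -(permKV s k) -bT'.
Qed.

Let moment k l : \bar R := (\int[mu]_(x in open_simplex) (bary p k x * bary p l x)%:E)%E.

Let measurable_mul_bary k l (E : set 'rV[R]_d) :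
  measurable_fun E (fun x => (bary p k x * bary p l x)%:E).
Proof.
apply/measurable_EFinP; apply: measurable_funTS.
by apply: measurable_funM; exact: measurable_bary.
Qed.

Let mul_bary_ge0 k l x : open_simplex x -> (0 <= (bary p k x * bary p l x)%:E)%E.
Proof. by move=> xS; rewrite lee_fin mulr_ge0// ltW. Qed.

Let moment_perm (s : {perm 'I_d.+1}) k l : moment (s k) (s l) = moment k l.
Proof.
have [T [mT bT] TI] := bary_perm s.
rewrite /moment -[RHS]TI//; last 2 first.
- exact: measurable_open_simplex.
- by move=> x xS; exact: mul_bary_ge0.
rewrite (_ : T @^-1` _ = open_simplex); last first.
  apply/seteqP; split => x /= h k'; last by rewrite bT.
  by rewrite -(permKV s k') -bT.
by apply: eq_integral => x _; rewrite !bT.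
Qed.

Lemma moment_diag k l : moment k k = moment l l.
Proof. by rewrite -(moment_perm (tperm k l)) tpermL. Qed.

(** The transposition of [k] and [k'] moves [l] to some [m] different from [k']; the transposition
    of [m] and [l'] then fixes [k']. Their product carries the pair (k, l) to (k', l'). *)
Lemma moment_offdiag k l k' l' : k != l -> k' != l' -> moment k l = moment k' l'.
Proof.
move=> kl kl'; pose m := tperm k k' l.
have km : k' != m.
  apply: contra kl => /eqP e; apply/eqP/(@perm_inj _ (tperm k k')).
  by rewrite tpermL.
rewrite -(moment_perm (tperm k k' * tperm m l')%g k) !permM tpermL -/m tpermL tpermD//.
  by rewrite eq_sym.
by rewrite eq_sym.
Qed.

Variables (i j : 'I_d.+1).
Hypothesis ij : i != j.

Let half := open_simplex `&` [set x | bary p j x < bary p i x].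

Let measurable_half : measurable half.
Proof.
apply: measurableI; first exact: measurable_open_simplex.
rewrite (_ : mkset _ = (fun x => bary p i x - bary p j x) @^-1` `]0, +oo[); last first.
  by apply/seteqP; split => x /=; rewrite in_itv/= andbT subr_gt0.
by apply: measurable_preimageT => //; apply: measurable_funB; exact: measurable_bary.
Qed.

(** Outside the null set where the coordinates i and j agree, the simplex is the disjoint union of
    [half] and its mirror image under the transposition of i and j, and [f] has the same integral on
    both. *)
Lemma integral_half (f : 'rV[R]_d -> \bar R) :
  measurable_fun open_simplex f -> (forall x, open_simplex x -> 0 <= f x)%E ->
  (forall x y, bary p i y = bary p j x -> bary p j y = bary p i x ->
    (forall k, k != i -> k != j -> bary p k y = bary p k x) -> f y = f x) ->
  (\int[mu]_(x in open_simplex) f x = 2%:E * \int[mu]_(x in half) f x)%E.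
Proof.
move=> mf f0 fsym.
have [T [mT bT] TI] := bary_perm (tperm i j).
have mT' E : measurable E -> measurable (T @^-1` E) by exact: measurable_preimageT.
pose Z := [set x | bary p i x = bary p j x].
have mZ : measurable Z.
  have mB : measurable_fun setT (fun x => bary p i x - bary p j x).
    by apply: measurable_funB; exact: measurable_bary.
  have := measurable_preimageT mB (measurable_set1 0).
  by congr measurable; apply/seteqP; split => x; rewrite /Z /= => h; lra.
have TE x : open_simplex (T x) <-> open_simplex x.
  split => h k; last by rewrite bT.
  by rewrite -(tpermK i j k) -bT.
have halfE : open_simplex `\` Z = half `|` T @^-1` half.
  apply/seteqP; split => x /=.
    rewrite /half /Z /= => -[xS /eqP]; rewrite neq_lt => /orP[h|h]; [right|by left].
    by split; [exact/TE|rewrite !bT tpermL tpermR].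
  rewrite /half /Z /= => -[[xS h]|[/TE xS]].
    by split => // e; rewrite e ltxx in h.
  by rewrite !bT tpermL tpermR => h; split => // e; rewrite e ltxx in h.
have subS : half `|` T @^-1` half `<=` open_simplex.
  by rewrite -halfE; exact: subDsetl.
rewrite (ge0_negligible_integral mZ measurable_open_simplex mf f0 (bary_eq_null ij)).
rewrite halfE ge0_integral_setU//=; first last.
- apply/disj_setPS => x [[_ /= h] [_ /=]].
  by rewrite !bT tpermL tpermR => /(lt_trans h); rewrite ltxx.
- by move=> x /subS; exact: f0.
- by apply: measurable_funS mf => //; exact: measurable_open_simplex.
- exact: mT'.
rewrite (_ : \int[mu]_(x in T @^-1` half) f x = \int[mu]_(x in half) f x)%E.
  by rewrite -mule2n -mule_natl.
rewrite -[RHS]TI//; first last.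
- by move=> x [xS _]; exact: f0.
- by apply: measurable_funS mf => //; [exact: measurable_open_simplex|exact: subIsetl].
apply: eq_integral => x _; rewrite (fsym x (T x)) ?bT ?tpermL ?tpermR//.
by move=> k ki kj; rewrite bT tpermD// eq_sym.
Qed.

(* The bisection x_i' = x_i + x_j / 2, x_j' = x_j / 2 maps the simplex onto its
   half x_j < x_i, which fixes the ratio of the two kinds of moments. *)
Lemma moment_diag_offdiag : moment j j = (2%:E * moment i j)%E.
Proof.
pose s (c : 'rV[R]_d.+1) : 'rV[R]_d.+1 := \row_k (if k == i then c ord0 i + c ord0 j / 2
  else if k == j then c ord0 j / 2 else c ord0 k).
pose s' (c : 'rV[R]_d.+1) : 'rV[R]_d.+1 := \row_k (if k == i then c ord0 i - c ord0 j
  else if k == j then 2 * c ord0 j else c ord0 k).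
have ji : (j == i) = false by rewrite eq_sym (negbTE ij).
have sumE (c c' : 'rV[R]_d.+1) : c ord0 i + c ord0 j = c' ord0 i + c' ord0 j ->
    (forall k, k != i -> k != j -> c ord0 k = c' ord0 k) ->
    \sum_k c ord0 k = \sum_k c' ord0 k.
  move=> e1 e2; rewrite (bigD1 i)//= (bigD1 j) ?ji//= [RHS](bigD1 i)//= [in RHS](bigD1 j) ?ji//=.
  by rewrite !addrA e1; congr (_ + _); apply: eq_bigr => k /andP[]; exact: e2.
have ms : measurable_fun setT s.
  apply/measurable_fun_rVP => k; under eq_fun do rewrite mxE.
  case: eqP => _; last case: eqP => _; last exact: measurable_coord.
    apply: measurable_funD; first exact: measurable_coord.
    by apply: measurable_funM => //; exact: measurable_coord.
  by apply: measurable_funM => //; exact: measurable_coord.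
have ms' : measurable_fun setT s'.
  apply/measurable_fun_rVP => k; under eq_fun do rewrite mxE.
  case: eqP => _; last case: eqP => _; last exact: measurable_coord.
    by apply: measurable_funB; exact: measurable_coord.
  by apply: measurable_funM => //; exact: measurable_coord.
have [|||||T [mT bT] TI] := @bary_change s s' _ _ _ _ _ ms ms'.
- move=> u v; apply/rowP => k; rewrite !mxE.
  by case: ifP => _; [lra|case: ifP => _ //; lra].
- move=> c; apply: sumE => [|k /negbTE ki /negbTE kj]; rewrite !mxE ?ki ?kj// ji !eqxx; lra.
- move=> c; apply: sumE => [|k /negbTE ki /negbTE kj]; rewrite !mxE ?ki ?kj// ji !eqxx; lra.
- move=> c; apply/rowP => k; rewrite !mxE !eqxx ji.
  by case: eqP => [->|_]; [lra|case: eqP => [->|_] //; lra].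
- move=> c; apply/rowP => k; rewrite !mxE !eqxx ji.
  by case: eqP => [->|_]; [lra|case: eqP => [->|_] //; lra].
have bTE k x : bary p k (T x) = if k == i then bary p i x + bary p j x / 2
    else if k == j then bary p j x / 2 else bary p k x.
  by rewrite -!baryvE bT mxE.
have preE : T @^-1` half = open_simplex.
  apply/seteqP; split => x.
    move=> [h1 /=]; rewrite !bTE eqxx ji eqxx => h2 k.
    have := h1 k; have := h1 j; rewrite !bTE ji eqxx.
    by case: eqP => [->|_]; [move=> *; lra|case: eqP => [->|_] //; move=> *; lra].
  move=> h; split => [k|] /=; rewrite !bTE ?eqxx ?ji; have := h i; have := h j; last by move=> *; lra.
  by case: ifP => _; [move=> *; lra|case: ifP => _; [move=> *; lra|move=> *; exact: h]].
(* Since the simplex is the preimage of [half], this equation says that the bisection map has factor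
   2, with [half] as reference set. *)
have muE : mu open_simplex = (2%:E * mu half)%E.
  have := @integral_half (cst 1%E) (@measurable_cst _ _ _ _ _ _) (fun _ _ => lee01) (fun _ _ _ _ _ => erefl).
  by rewrite !integral_cst ?mul1e//; exact: measurable_open_simplex.
have half0 : mu half != 0%E.
  by apply: contra mu_neq0 => /eqP e; rewrite muE e mule0.
have halfoo : (mu half < +oo)%E.
  apply: le_lt_trans open_simplex_lty; apply: le_measure; rewrite ?inE//.
    exact: measurable_open_simplex.
  exact: subIsetl.
have mS := measurable_open_simplex.
have := TI 2 half (ler0n _ _) measurable_half half0 halfoo.
rewrite preE => /(_ muE half (fun x => (bary p i x * bary p j x)%:E) measurable_half).
move=> /(_ (@measurable_mul_bary i j half)) TIf.
have {TIf} := TIf (fun x xh => mul_bary_ge0 i j xh.1).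
rewrite -[RHS]integral_half//; first last.
- by move=> x y -> -> _; rewrite mulrC.
- by move=> x; exact: mul_bary_ge0.
rewrite -/(moment i j).
have mfin k l : moment k l \is a fin_num.
  rewrite ge0_fin_numE; last by apply: integral_ge0 => x; exact: mul_bary_ge0.
  apply: le_lt_trans open_simplex_lty; rewrite -[leRHS]mul1e -integral_cst//.
  apply: ge0_le_integral => //; first by move=> x; exact: mul_bary_ge0.
  move=> x xS; rewrite lee_fin mulr_ile1 ?open_simplex_le1//; exact/ltW/xS.
(* With m_ij the moments, the change of variables equates the integral of x_i' x_j' = x_i x_j / 2 +
   x_j^2 / 4 over the simplex with twice the integral of x_i x_j over [half], which is m_ij. Hence
   m_ij / 2 + m_jj / 4 = m_ij. *)
rewrite preE (_ : integral _ _ _ = \int[mu]_(x in open_simplex)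
    (2^-1%:E * (bary p i x * bary p j x)%:E + 4^-1%:E * (bary p j x * bary p j x)%:E))%E; last first.
  apply: eq_integral => x _; rewrite !bTE !eqxx ji -!EFinM -EFinD; congr EFin; by field.
rewrite ge0_integralD//.
all: try by move=> x xS; apply: mule_ge0; [rewrite lee_fin; lra|exact: mul_bary_ge0].
all: try by apply: measurable_funeM; exact: measurable_mul_bary.
rewrite !ge0_integralZl//.
all: try by move=> x; exact: mul_bary_ge0.
all: try by rewrite lee_fin; lra.
rewrite -/(moment i j) -/(moment j j) -(fineK (mfin i j)) -(fineK (mfin j j)) -!EFinM -EFinD.
by move=> [e]; congr EFin; lra.
Qed.

End barycentric.

(** The scalar [b] is the common off-diagonal moment. Its value is not computed here; the coercivity
    estimate relates it to the volume of the simplex. *)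
Lemma bary_moments {R : realType} (d : nat) (p : 'I_d.+1 -> 'rV[R]_d) : (0 < d)%N ->
  affinely_independent p -> exists2 b : R, 0 <= b &
  forall k l, \int[lebesgue_rV d]_(x in open_simplex p) (bary p k x * bary p l x) =
    b * (1 + (k == l)%:R).
Proof.
move=> d0 hp; have mS : measurable (open_simplex p) by exact: measurable_open_simplex.
have mf k l : measurable_fun (open_simplex p) (fun x => (bary p k x * bary p l x)%:E).
  apply/measurable_EFinP; apply: measurable_funTS.
  by apply: measurable_funM; exact: measurable_bary.
(* The change of variables requires a reference set of nonzero measure. If the simplex were null,
   all moments would vanish and [b] = 0 would do, so both alternatives are covered without a volume
   formula. *)
have [mu0|mu0] := eqVneq (lebesgue_rV d (open_simplex p)) 0%E.
  exists 0 => // k l; rewrite mul0r /Rintegral.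
  by rewrite null_set_integral.
have ij : (ord0 : 'I_d.+1) != ord_max by rewrite -val_eqE /= eq_sym -lt0n.
exists (\int[lebesgue_rV d]_(x in open_simplex p) (bary p ord0 x * bary p ord_max x)).
  by apply: Rintegral_ge0 => x xS; rewrite mulr_ge0// ltW.
move=> k l; rewrite /Rintegral; have [->|kl] := eqVneq k l.
  rewrite (moment_diag hp mu0 l ord_max) (moment_diag_offdiag hp mu0 ij).
  set I := (\int[_]_(_ in _) _)%E.
  have : (0 <= I)%E by apply: integral_ge0 => x xS; rewrite lee_fin mulr_ge0// ltW.
  case: I => [r| |]//= _; first by ring.
  by rewrite mulry gtr0_sg// mul1e/= mul0r.
by rewrite (moment_offdiag hp mu0 kl ij) addr0 mulr1.
Qed.

(** * Finite element functions *)

Section bounded_measurable.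
Context {R : realType} dT (T : measurableType dT).
Variables (mu : {measure set T -> \bar R}) (D : set T).
Hypotheses (mD : measurable D) (Doo : (mu D < +oo)%E).

(** A class stable under ring operations and contained in the integrable functions on a set of
    finite measure: integrability of polynomial expressions in finite element functions then follows
    without estimates. *)
Definition bounded_measurable (f : T -> R) :=
  measurable_fun D f /\ exists M, forall x, D x -> `|f x| <= M.

Lemma bounded_measurable_cst r : bounded_measurable (fun=> r).
Proof. by split => //; exists `|r|. Qed.

Lemma bounded_measurableD f g : bounded_measurable f -> bounded_measurable g ->
  bounded_measurable (fun x => f x + g x).
Proof.
move=> [mf [Mf fM]] [mg [Mg gM]]; split; first exact: measurable_funD.
exists (Mf + Mg) => x Dx; rewrite (le_trans (ler_normD _ _))// lerD//; [exact: fM|exact: gM].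
Qed.

Lemma bounded_measurableM f g : bounded_measurable f -> bounded_measurable g ->
  bounded_measurable (fun x => f x * g x).
Proof.
move=> [mf [Mf fM]] [mg [Mg gM]]; split; first exact: measurable_funM.
exists (Mf * Mg) => x Dx; rewrite normrM ler_pM//; [exact: fM|exact: gM].
Qed.

Lemma bounded_measurableZ r f : bounded_measurable f -> bounded_measurable (fun x => r * f x).
Proof. exact/bounded_measurableM/bounded_measurable_cst. Qed.

Lemma bounded_measurableB f g : bounded_measurable f -> bounded_measurable g ->
  bounded_measurable (fun x => f x - g x).
Proof.
move=> bf /(bounded_measurableZ (-1)) bg.
have := bounded_measurableD bf bg.
by congr bounded_measurable; apply/funext => x; rewrite mulN1r.
Qed.

Lemma bounded_measurableX n f : bounded_measurable f -> bounded_measurable (fun x => f x ^+ n).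
Proof.
move=> bf; elim: n => [|n IH]; first exact: (bounded_measurable_cst 1).
have := bounded_measurableM bf IH.
by congr bounded_measurable; apply/funext => x; rewrite exprS.
Qed.

Lemma bounded_measurable_sum (I : Type) (r : seq I) (f : I -> T -> R) :
  (forall i, bounded_measurable (f i)) -> bounded_measurable (fun x => \sum_(i <- r) f i x).
Proof.
move=> bf; elim: r => [|i r IH].
  have := bounded_measurable_cst 0.
  by congr bounded_measurable; apply/funext => x; rewrite big_nil.
have := bounded_measurableD (bf i) IH.
by congr bounded_measurable; apply/funext => x; rewrite big_cons.
Qed.

Lemma eq_bounded_measurable f g : (forall x, D x -> f x = g x) ->
  bounded_measurable f -> bounded_measurable g.
Proof.
move=> fg [mf [M fM]]; split.
  by apply: eq_measurable_fun mf => x /set_mem; exact: fg.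
by exists M => x Dx; rewrite -fg//; exact: fM.
Qed.

Lemma bounded_measurable_integrable f : bounded_measurable f -> mu.-integrable D (EFin \o f).
Proof.
move=> [mf [M fM]]; apply: measurable_bounded_integrable => //.
exists M; split; first exact: num_real.
by move=> x Mx y Dy /=; rewrite (le_trans (fM _ Dy))// ltW.
Qed.

Lemma Rintegral_sum (I : Type) (r : seq I) (f : I -> T -> R) :
  (forall i, bounded_measurable (f i)) ->
  \int[mu]_(x in D) (\sum_(i <- r) f i x) = \sum_(i <- r) \int[mu]_(x in D) f i x.
Proof.
move=> bf; elim: r => [|i r IH].
  rewrite big_nil; under eq_Rintegral do rewrite big_nil.
  by rewrite Rintegral_cst// mul0r.
under eq_Rintegral do rewrite big_cons.
rewrite big_cons RintegralD ?IH//; apply: bounded_measurable_integrable => //.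
exact: bounded_measurable_sum.
Qed.

End bounded_measurable.

(** * Cells, nodal basis and integration over the triangulation *)

Section mesh_geometry.
Context {R : realType} {d : nat} (D : set 'rV[R]_d) (M : mesh R d).
Hypotheses (oD : open D) (bD : bounded_set D) (TM : triangulation D M).
Local Notation mu := (@lebesgue_rV R d).
Implicit Types (K : 'I_(ncell M)) (i : 'I_(nvert M)) (k : 'I_d.+1).

Let hK K : affinely_independent (corner K).
Proof. by case: TM. Qed.

Let inT k : k \in in_set [set: 'I_d.+1].
Proof. exact/asboolP. Qed.

Lemma cell_inj K : injective (cell K).
Proof.
move=> k l kl; apply/eqP; have := bary_vertex (hK K) k l.
rewrite /corner -kl -/(corner K) -/(corner K k) (bary_vertex (hK K)) eqxx => /eqP.
by case: (k == l) => //; rewrite oner_eq0.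
Qed.

Lemma sum_cell K (V : nmodType) (f : 'I_(nvert M) -> V) :
  (forall i, i \notin cell_verts K -> f i = 0) -> \sum_i f i = \sum_k f (cell K k).
Proof.
move=> f0; rewrite (bigID (mem (cell_verts K)))/= [X in _ + X]big1// addr0.
rewrite /cell_verts big_imset/=; last by move=> x y _ _; exact: cell_inj.
by apply: eq_bigl => k; rewrite inT.
Qed.

Lemma bary_convex_comb K (c : 'I_(nvert M) -> R) k :
  (forall i, i \notin cell_verts K -> c i = 0) -> \sum_i c i = 1 ->
  bary (corner K) k (\sum_i c i *: vert i) = c (cell K k).
Proof.
move=> c0 c1; pose c' : 'rV[R]_d.+1 := \row_k c (cell K k).
have -> : \sum_i c i *: vert i = bary_point (corner K) c'.
  rewrite (sum_cell (K := K)); last by move=> i /c0 ->; rewrite scale0r.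
  by apply: eq_bigr => l _; rewrite mxE.
rewrite -baryvE bary_point_inj ?mxE//.
by rewrite -c1 (sum_cell c0); apply: eq_bigr => l _; rewrite mxE.
Qed.

Lemma hull_bary K (S : {set 'I_(nvert M)}) x : S \subset cell_verts K -> hull S x ->
  forall k, 0 <= bary (corner K) k x /\ (cell K k \notin S -> bary (corner K) k x = 0).
Proof.
move=> SK [c [c0 cS c1 ->]] k; rewrite bary_convex_comb//; first by split => // /cS.
by move=> i iK; apply: cS; apply: contra iK; exact/fintype.subsetP.
Qed.

Lemma simplex_bary_ge0 K x : simplex K x <-> forall k, 0 <= bary (corner K) k x.
Proof.
split=> [xK k|x0]; first by have [] := hull_bary (subxx _) xK k.
exists (fun i => \sum_(k | cell K k == i) bary (corner K) k x); split.
- by move=> i; apply: sumr_ge0.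
- move=> i iK; apply: big1 => k /eqP ki; case/negP: iK; apply/imsetP.
  by exists k; rewrite ?inT.
- rewrite -(sum_bary (hK K) x).
  rewrite [RHS](partition_big (cell K) xpredT)//.
- rewrite -[LHS](bary_pointK (hK K)) /bary_point [LHS](partition_big (cell K) xpredT)//=.
  apply: eq_bigr => i _; rewrite scaler_suml; apply: eq_bigr => k /eqP <-.
  by rewrite baryvE.
Qed.

(** The basis function is defined through an arbitrarily picked cell containing x. By conformity, a
    point common to two cells is a convex combination of their common vertices, and in either cell
    the value is the weight of the vertex i in that combination. *)
Lemma nodal_basisE K x i : simplex K x ->
  nodal_basis i x = \sum_(k | cell K k == i) bary (corner K) k x.
Proof.
move=> xK; rewrite /nodal_basis; case: pickP => [K' /asboolP xK'|/(_ K)]; last first.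
  by move/asboolP.
have : (simplex K `&` simplex K') x by [].
have [_ _ _ -> _] := TM; move=> [c [c0 cS c1 xE]].
have side (L : 'I_(ncell M)) : cell_verts K :&: cell_verts K' \subset cell_verts L ->
    \sum_(k | cell L k == i) bary (corner L) k x = c i.
  move=> sL; have cL j : j \notin cell_verts L -> c j = 0.
    by move=> jL; apply: cS; apply: contra jL; exact/fintype.subsetP.
  rewrite (eq_bigr (fun k => c (cell L k))); last first.
    by move=> k _; rewrite xE bary_convex_comb.
  have [/imsetP[k _ ->]|iL] := boolP (i \in cell_verts L).
    rewrite (bigD1 k)//= big1 ?addr0// => l /andP[/eqP/cell_inj ->].
    by rewrite eqxx.
  rewrite cL// big1// => k /eqP ki; case/negP: iL; apply/imsetP.
  by exists k; rewrite ?inT.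
by rewrite !side ?subsetIl ?subsetIr.
Qed.

Lemma open_simplex_simplex K : open_simplex (corner K) `<=` simplex K.
Proof. by move=> x xK; apply/simplex_bary_ge0 => k; exact/ltW/xK. Qed.

(** A common point lies in the hull of the common vertices. A vertex of [K] missing from [K'] would
    have barycentric coordinate 0 there, which is excluded inside [K]; so the vertices of [K] are
    among those of [K'], and both sets have d + 1 elements. *)
Lemma open_simplex_eq K K' x : open_simplex (corner K) x -> simplex K' x -> K' = K.
Proof.
move=> xK xK'; have [[_ cvinj] _ _ hI _] := TM.
have : (simplex K `&` simplex K') x by split => //; exact: open_simplex_simplex.
rewrite hI => /(hull_bary (subsetIl _ _)) xI.
apply/esym/cvinj/eqP; rewrite eqEcard; apply/andP; split; last first.
  by rewrite !card_imset//; exact: cell_inj.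
apply/fintype.subsetP => _ /imsetP[k _ ->]; have [_ k0] := xI k.
apply: contraTT (xK k) => kK'; rewrite k0 ?ltxx//.
by rewrite inE (negbTE kK') andbF.
Qed.

Lemma continuous_bary K k : continuous (bary (corner K) k).
Proof.
pose b := bary_grad (corner K) k.
have cdot (r : seq 'I_d) : continuous (fun y : 'rV[R]_d => \sum_(j <- r) b ord0 j * y ord0 j).
  elim: r => [|j r IH].
    rewrite (_ : (fun _ => _) = cst 0); last by apply/funext => y; rewrite big_nil.
    exact: cst_continuous.
  rewrite (_ : (fun _ => _) = cst (b ord0 j) * (fun y : 'rV[R]_d => y ord0 j) +
      (fun y : 'rV[R]_d => \sum_(j <- r) b ord0 j * y ord0 j)); last first.
    by apply/funext => y; rewrite big_cons.
  move=> y; apply: continuousD; last exact: IH.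
  by apply: continuousM; [exact: cst_continuous|exact: coord_continuous].
rewrite (_ : bary (corner K) k = cst (bary (corner K) k 0) + dotv b); last first.
  by apply/funext => y; exact: baryE.
by move=> x; apply: continuousD; [exact: cst_continuous|exact: cdot].
Qed.

Lemma open_open_simplex K : open (open_simplex (corner K)).
Proof.
rewrite openE => x xS.
apply: (@filter_forall _ _ (fun k y => 0 < bary (corner K) k y) (nbhs x)) => k.
have oS : open (bary (corner K) k @^-1` `]0, +oo[).
  by apply: open_comp => // y _; exact: continuous_bary.
have : nbhs x (bary (corner K) k @^-1` `]0, +oo[).
  by apply: open_nbhs_nbhs; split => //=; rewrite in_itv/= andbT; exact: xS.
by apply: filterS => y /=; rewrite in_itv/= andbT.
Qed.

Lemma open_simplex_sub K : open_simplex (corner K) `<=` D.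
Proof.
have [_ _ _ _ [_ iD]] := TM.
apply: subset_trans (iD K).
rewrite -open_subsetE; [exact: open_simplex_simplex|exact: open_open_simplex].
Qed.

Lemma domain_simplex x : D x -> exists K, simplex K x.
Proof.
move=> /subset_closure; have [_ _ _ _ [-> _]] := TM.
by move=> [K _ xK]; exists K.
Qed.

Let U := \big[setU/set0]_(K < ncell M) open_simplex (corner K).

Let UP x : U x <-> exists K, open_simplex (corner K) x.
Proof.
rewrite /U -bigcup_seq; split=> [[K _ xK]|[K xK]]; first by exists K.
by exists K => //=; rewrite mem_index_enum.
Qed.

Let mS K : measurable (open_simplex (corner K)).
Proof. exact: measurable_open_simplex. Qed.

Let mU : measurable U.
Proof. exact: bigsetU_measurable. Qed.

Let mD : measurable D.
Proof. exact: open_measurable_rV. Qed.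

(** Every point of [D] lies in a closed simplex; if it lies in no open one, some barycentric
    coordinate vanishes. The exceptional set is thus contained in finitely many null sets. *)
Let null : mu (D `\` U) = 0%E.
Proof.
pose N := \big[setU/set0]_(K < ncell M)
  \big[setU/set0]_(k < d.+1) [set x | bary (corner K) k x = 0].
have DN : D `\` U `<=` N.
  move=> x [Dx Ux]; have [K /simplex_bary_ge0 xK] := domain_simplex Dx.
  rewrite /N -bigcup_seq; exists K; rewrite /= ?mem_index_enum//.
  apply: contrapT => xN; apply: Ux; apply/UP; exists K => k.
  rewrite lt_neqAle xK andbT eq_sym; apply: contra_notN xN => /eqP e.
  by rewrite -bigcup_seq; exists k; rewrite /= ?mem_index_enum.
have mN : measurable N.
  apply: bigsetU_measurable => K _; apply: bigsetU_measurable => k _.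
  exact: measurable_bary_eq0.
apply: (subset_measure0 _ mN DN); first exact: measurableD.
have bigU0 (I : finType) (F : I -> set 'rV[R]_d) : (forall e, measurable (F e)) ->
    (forall e, mu (F e) = 0%E) -> mu (\big[setU/set0]_e F e) = 0%E.
  move=> mF F0; pose Q B := measurable B /\ mu B = 0%E.
  suff [] : Q (\big[setU/set0]_e F e) by [].
  apply: (big_ind Q) => [|A B [mA A0] [mB B0]|e _]; first by split.
    by split; [exact: measurableU|rewrite measureU0].
  by split.
apply: (bigU0) => K.
  by apply: bigsetU_measurable => k _; exact: measurable_bary_eq0.
apply: (bigU0) => k; first exact: measurable_bary_eq0.
exact: bary_eq0_null.
Qed.

Lemma Rintegral_domain f : bounded_measurable D f ->
  \int[mu]_(x in D) f x = \sum_(K < ncell M) \int[mu]_(x in open_simplex (corner K)) f x.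
Proof.
move=> bf; have Doo := bounded_lebesgue_rV_lty mD bD.
have fi := bounded_measurable_integrable mD Doo bf.
rewrite /Rintegral (negligible_integral (measurableD mD mU) mD fi null).
rewrite setDD setIidr; last by move=> x /UP[K]; exact: open_simplex_sub.
have fiK (K : 'I_(ncell M)) : mu.-integrable (open_simplex (corner K)) (EFin \o f).
  by apply: integrableS fi => //; exact: open_simplex_sub.
rewrite integral_bigsetU_EFin//.
- rewrite (eq_bigr (fun K => (\int[mu]_(x in open_simplex (corner K)) f x)%:E)).
    by rewrite sumEFin.
  by move=> K _; rewrite fineK//; exact: integrable_fin_num.
- by rewrite index_enum_uniq.
- apply/trivIsetP => K K' _ _ KK'; apply/seteqP; split => x //= [xK /open_simplex_simplex xK'].
  by move: KK'; rewrite (open_simplex_eq xK xK') eqxx.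
- case: bf => mf _; apply/measurable_EFinP; apply: measurable_funS mf => // x /UP[K].
  exact: open_simplex_sub.
Qed.

Definition fe_fun (c : 'I_(nvert M) -> R) x := \sum_i c i * nodal_basis i x.

Lemma interpE (v : 'rV[R]_d -> R) : interp M v = fe_fun (fun i => v (vert i)).
Proof. by []. Qed.

Lemma fe_funE K c x : simplex K x ->
  fe_fun c x = \sum_k c (cell K k) * bary (corner K) k x.
Proof.
move=> xK; rewrite /fe_fun; under eq_bigr => i _ do rewrite (nodal_basisE _ xK).
rewrite [RHS](partition_big (cell K) xpredT)//=; apply: eq_bigr => i _.
by rewrite mulr_sumr; apply: eq_bigr => k /eqP ->.
Qed.

Lemma corner_simplex K k : simplex K (corner K k).
Proof. by apply/simplex_bary_ge0 => l; rewrite bary_vertex ?ler0n. Qed.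

Lemma vert_closure i : closure D (vert i).
Proof.
have [_ iK _ _ [-> _]] := TM; have [K /imsetP[k _ ->]] := iK i.
by exists K => //; exact: corner_simplex.
Qed.

Lemma Vh_fe_fun v x : Vh D M v -> D x -> v x = fe_fun (fun i => v (vert i)) x.
Proof.
move=> [_ P1v] /domain_simplex[K xK]; rewrite (fe_funE _ xK).
have [a [b vE]] := P1v K.
rewrite vE// -{1}(bary_pointK (hK K) x).
rewrite (eq_bigr (fun k => (a + dotv b (corner K k)) * bary (corner K) k x)); last first.
  by move=> k _; rewrite -/(corner K k) vE//; exact: corner_simplex.
rewrite -[in LHS](mulr1 a) -(sum_bary (hK K) x) mulr_sumr.
rewrite (_ : dotv b _ = \sum_k dotv b (corner K k) * bary (corner K) k x).
  by rewrite -big_split/=; apply: eq_bigr => k _; rewrite mulrDl.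
rewrite /dotv /bary_point; under eq_bigr => j _ do rewrite summxE mulr_sumr.
rewrite exchange_big/=; apply: eq_bigr => k _; rewrite mulr_suml.
by apply: eq_bigr => j _; rewrite mxE baryvE; ring.
Qed.

Let simplex_D_measurable K : measurable (D `&` simplex K).
Proof.
apply: measurableI => //.
rewrite (_ : simplex K = \bigcap_(k in [set: 'I_d.+1])
  (bary (corner K) k @^-1` `[0, +oo[)); last first.
  apply/seteqP; split => [x /simplex_bary_ge0 h k _|x h].
    by rewrite /= in_itv/= andbT.
  by apply/simplex_bary_ge0 => k; have := h k I; rewrite /= in_itv/= andbT.
by apply: fin_bigcap_measurable => // k _; apply: measurable_preimageT => //; exact: measurable_bary.
Qed.

Lemma nodal_basis_ge0_le1 i x : D x -> 0 <= nodal_basis i x <= 1.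
Proof.
move=> /domain_simplex[K xK]; rewrite (nodal_basisE _ xK).
have x0 := (simplex_bary_ge0 K x).1 xK.
rewrite sumr_ge0//= -(sum_bary (hK K) x) [leRHS](bigID (fun k => cell K k == i))/=.
by rewrite lerDl sumr_ge0.
Qed.

Lemma bounded_measurable_nodal_basis i : bounded_measurable D (nodal_basis i).
Proof.
split; last first.
  by exists 1 => x /(nodal_basis_ge0_le1 i)/andP[x0 x1]; rewrite ger0_norm.
move=> _ Y mY.
(* The choice of a cell depends on x, so the preimage is split along the finitely many closed
   simplices, on each of which the basis function is a fixed sum of barycentric coordinates. *)
rewrite (_ : D `&` _ = \bigcup_(K in [set: 'I_(ncell M)]) ((D `&` simplex K) `&`
    ((fun x => \sum_(k | cell K k == i) bary (corner K) k x) @^-1` Y))); last first.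
  apply/seteqP; split => [x [Dx Yx]|x [K _ [[Dx xK]]]].
    have [K xK] := domain_simplex Dx; exists K => //; split => //=.
    by rewrite -nodal_basisE.
  by rewrite /= -nodal_basisE// => Yx; split.
apply: fin_bigcup_measurable => // K _; apply: measurableI => //.
apply: measurable_preimageT => //.
rewrite (_ : (fun _ => _) = fun x =>
    \sum_k (if cell K k == i then bary (corner K) k x else 0)); last first.
  by apply/funext => x; rewrite big_mkcond.
by apply: measurable_sum => k; case: (cell K k == i) => //; exact: measurable_bary.
Qed.

Lemma bounded_measurable_fe_fun c : bounded_measurable D (fe_fun c).
Proof.
apply: bounded_measurable_sum => // i; apply: bounded_measurableZ => //.
exact: bounded_measurable_nodal_basis.
Qed.

(** A convex combination is bounded by the largest nodal value in modulus, whose even power is one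
    of the summands on the right. The bound does not depend on x, so integrating it produces only
    the volume of the simplex. *)
Let simplex_sum_le K (c : 'I_d.+1 -> R) n x : ~~ odd n -> (0 < n)%N ->
  open_simplex (corner K) x ->
  (\sum_k c k * bary (corner K) k x) ^+ n <= \sum_k c k ^+ n.
Proof.
move=> on n0 xK.
have en (y : R) : 0 <= y ^+ n by exact: exprn_even_ge0.
have normX (y : R) : `|y| ^+ n = y ^+ n by rewrite -normrX ger0_norm.
pose m := [arg max_(k > ord0) `|c k|]%O.
have cm k : `|c k| <= `|c m|.
  by rewrite /m; case: Order.TotalTheory.arg_maxP => // l _; apply.
rewrite (@le_trans _ _ (c m ^+ n))//; last first.
  by rewrite (bigD1 m)//= lerDl sumr_ge0.
rewrite -normX -[leRHS]normX lerXn2r ?nnegrE//.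
rewrite (le_trans (ler_norm_sum _ _ _))//.
rewrite -[leRHS]mulr1 -(sum_bary (hK K) x) mulr_sumr; apply: ler_sum => k _.
by rewrite normrM (ger0_norm (ltW (xK k))) ler_wpM2r// ltW// xK.
Qed.

(** On each simplex the left side is at most the volume b (d+1)(d+2) times the sum of the nodal
    powers, and the right integral is [b] times the scalar form of [nodal_form_coercive]. The scalar
    [b], and with it the shape and size of the cell, cancels; the constant depends on d and q
    only. *)
Lemma fe_fun_coercive q (c : 'I_(nvert M) -> R) : odd q -> (3 <= q)%N ->
  d = 2%N \/ (d = 3%N /\ (q = 3%N \/ q = 5%N)) ->
  \int[mu]_(x in D) (fe_fun c x ^+ q.+1) <=
  (4 ^+ q.+3 * (d.+1 * d.+2)%:R) *
  \int[mu]_(x in D) (fe_fun (fun i => c i ^+ q) x * fe_fun c x).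
Proof.
move=> oq q3 dq; have d0 : (0 < d)%N by case: dq => [->//|[->//]].
have bf := bounded_measurable_fe_fun.
have Doo := bounded_lebesgue_rV_lty mD bD.
rewrite !Rintegral_domain; first last.
- exact: bounded_measurableX.
- exact: bounded_measurableM.
rewrite mulr_sumr; apply: ler_sum => K _.
have [b b0 bE] := bary_moments d0 (hK K).
have sD := @open_simplex_sub K.
have bmS f : bounded_measurable D f -> bounded_measurable (open_simplex (corner K)) f.
  by move=> [mf [B fB]]; split; [exact: measurable_funS mf|exists B => x /sD/fB].
have Soo : (mu (open_simplex (corner K)) < +oo)%E by exact: open_simplex_lty.
have bmb k : bounded_measurable (open_simplex (corner K)) (bary (corner K) k).
  split; first by apply: measurable_funTS; exact: measurable_bary.
  by exists 1 => x xS; rewrite ger0_norm ?(open_simplex_le1 (hK K))//; exact/ltW/xS.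
have int_ab (u v : 'I_d.+1 -> R) :
    \int[mu]_(x in open_simplex (corner K))
      ((\sum_k u k * bary (corner K) k x) * (\sum_k v k * bary (corner K) k x)) =
    b * (\sum_k u k * v k + (\sum_k u k) * (\sum_k v k)).
  have bmm k l : bounded_measurable (open_simplex (corner K))
      (fun x => u k * v l * (bary (corner K) k x * bary (corner K) l x)).
    by apply: bounded_measurableZ => //; exact: bounded_measurableM.
  transitivity (\sum_k \sum_l u k * v l * (b * (1 + (k == l)%:R))).
    under eq_Rintegral => x _.
      rewrite mulr_suml (eq_bigr (fun k =>
        \sum_l u k * v l * (bary (corner K) k x * bary (corner K) l x))); last first.
        by move=> k _; rewrite mulr_sumr; apply: eq_bigr => l _; ring.
      over.
    rewrite Rintegral_sum//; last by move=> k; exact: bounded_measurable_sum.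
    apply: eq_bigr => k _; rewrite Rintegral_sum//; apply: eq_bigr => l _.
    rewrite RintegralZl ?bE//; apply: bounded_measurable_integrable => //.
    exact: bounded_measurableM.
  rewrite mulrDr mulr_suml !mulr_sumr -big_split/=; apply: eq_bigr => k _.
  rewrite !mulr_sumr (bigD1 k)//= [X in _ = _ + X](bigD1 k)//= eqxx addrA.
  congr (_ + _); first by rewrite (_ : true%:R = 1 :> R)//; ring.
  by apply: eq_bigr => l; rewrite eq_sym => /negbTE ->; rewrite (_ : false%:R = 0 :> R)//; ring.
(* Integrate 1 as the square of the sum of the barycentric coordinates: the entries b (1 + delta_kl)
   add up to b ((d+1) + (d+1)^2). *)
have muS : fine (mu (open_simplex (corner K))) = b * (d.+1 * d.+2)%:R.
  rewrite -[LHS]mul1r -Rintegral_cst//.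
  under eq_Rintegral => x _ do rewrite -[1]mulr1 -{1 2}(sum_bary (hK K) x).
  transitivity (\int[mu]_(x in open_simplex (corner K))
      ((\sum_k 1 * bary (corner K) k x) * (\sum_k 1 * bary (corner K) k x))).
    by apply: eq_Rintegral => x _; congr (_ * _); apply: eq_bigr => k _; rewrite mul1r.
  rewrite int_ab; congr (b * _).
  under [X in X + _]eq_bigr => k _ do rewrite mulr1.
  rewrite (_ : \sum_(_ < d.+1) 1 = d.+1%:R :> R); last by rewrite sumr_const card_ord.
  by rewrite -natrM -natrD [in RHS]mulnS.
pose a k := c (cell K k).
have feS e x : open_simplex (corner K) x -> fe_fun e x = \sum_k e (cell K k) * bary (corner K) k x.
  by move=> xS; apply: fe_funE; exact: open_simplex_simplex.
have -> : \int[mu]_(x in open_simplex (corner K)) (fe_fun (fun i => c i ^+ q) x * fe_fun c x)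
    = b * (\sum_k a k ^+ q.+1 + (\sum_k a k ^+ q) * (\sum_k a k)).
  rewrite (eq_bigr (fun k => a k ^+ q * a k)); last by move=> k _; rewrite exprSr.
  by rewrite -int_ab; apply: eq_Rintegral => x /set_mem xS; rewrite !feS.
apply: (@le_trans _ _ (\int[mu]_(x in open_simplex (corner K)) \sum_k a k ^+ q.+1)).
  apply: le_Rintegral => //.
  - by apply: bounded_measurable_integrable => //; apply/bmS/bounded_measurableX.
  - by apply: bounded_measurable_integrable => //; exact: bounded_measurable_cst.
  - by move=> x xS; rewrite feS// simplex_sum_le//= oq.
rewrite Rintegral_cst// muS.
have := nodal_form_coercive a oq q3 dq.
set S := \sum_k _ ^+ q.+1; set Q := S + _ => SQ.
have c4 : 0 < 4 ^+ q.+3 :> R by rewrite exprn_gt0.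
have {}SQ : S <= 4 ^+ q.+3 * Q.
  by rewrite -(ler_pM2l (_ : 0 < (4^-1) ^+ q.+3 :> R)) ?exprn_gt0// mulrA -exprMn mulVf// expr1n mul1r.
rewrite (_ : _ * (b * Q) = (4 ^+ q.+3 * Q) * (b * (d.+1 * d.+2)%:R)); last by ring.
by rewrite ler_wpM2r// mulr_ge0.
Qed.

End mesh_geometry.

(** * Integration and Gaussian increments *)

Section integral_complements.
Context {R : realType} dT (T : measurableType dT).
Local Open Scope ereal_scope.
Import HBNNSimple.

(* Only the larger function is assumed measurable: the left integral is a supremum
   over simple functions below [f]. *)
Lemma ge0_integral_le_ae (mu : {measure set T -> \bar R}) (f g : T -> \bar R) :
  (forall x, 0 <= f x) -> (forall x, 0 <= g x) -> measurable_fun setT g ->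
  {ae mu, forall x, f x <= g x} -> \int[mu]_x f x <= \int[mu]_x g x.
Proof.
move=> f0 g0 mg fg; rewrite ge0_integralTE//.
apply: ge_ereal_sup => _ [h /= hf <-]; rewrite -integralT_nnsfun.
apply: ae_ge0_le_integral => //.
- by move=> x _; rewrite lee_fin.
- exact/measurable_EFinP.
- by apply: filterS fg => x fgx _; exact: le_trans (hf x) fgx.
Qed.

(** Both integrals are monotone limits along the same simple functions approximating [f], which
    reduces the claim to indicators, where it is the assumption on [nu]. *)
Lemma ge0_integral_density (mu nu : {measure set T -> \bar R}) (p : T -> R)
    (f : T -> \bar R) :
  (forall x, 0 <= p x)%R -> measurable_fun setT p ->
  (forall A, measurable A -> nu A = \int[mu]_(x in A) (p x)%:E) ->
  (forall x, 0 <= f x) -> measurable_fun setT f ->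
  \int[nu]_x f x = \int[mu]_x (f x * (p x)%:E).
Proof.
move=> p0 mp nuE f0 mf; have mpE : measurable_fun setT (EFin \o p) by exact/measurable_EFinP.
pose h := nnsfun_approx measurableT mf.
have hf x : (h n x)%:E @[n --> \oo] --> f x by exact: cvg_nnsfun_approx.
have -> : \int[nu]_x f x = lim (\int[nu]_x (h n x)%:E @[n --> \oo]).
  under eq_integral => x _ do rewrite -(cvg_lim _ (hf x))//.
  apply: monotone_convergence => //.
  - by move=> n; exact/measurable_EFinP.
  - by move=> n x _; rewrite lee_fin.
  - by move=> x _ a b ab; rewrite lee_fin; exact/lefP/nd_nnsfun_approx.
have -> : \int[mu]_x (f x * (p x)%:E) = lim (\int[mu]_x ((h n x)%:E * (p x)%:E) @[n --> \oo]).
  have fp x : ((h n x)%:E * (p x)%:E) @[n --> \oo] --> f x * (p x)%:E.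
    exact: cvgeZr.
  under eq_integral => x _ do rewrite -(cvg_lim _ (fp x))//.
  apply: monotone_convergence => //.
  - by move=> n; apply: emeasurable_funM => //; exact/measurable_EFinP.
  - by move=> n x _; rewrite mule_ge0// lee_fin.
  - by move=> x _ a b ab; rewrite lee_wpmul2r ?lee_fin//; exact/lefP/nd_nnsfun_approx.
congr (lim (_ @ \oo)); apply/funext => n.
under eq_integral do rewrite fimfunE -fsumEFin//.
rewrite ge0_integral_fsum//; last 2 first.
- by move=> y; apply/measurable_EFinP; exact: measurable_funM.
- by move=> y x _; exact: nnfun_muleindic_ge0.
under [RHS]eq_integral => x _.
  rewrite fimfunE -fsumEFin// ge0_mule_fsuml; last by move=> y; exact: nnfun_muleindic_ge0.
  over.
rewrite ge0_integral_fsum//; last 2 first.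
- by move=> y; apply: emeasurable_funM => //; apply/measurable_EFinP; exact: measurable_funM.
- by move=> y x _; rewrite mule_ge0 ?lee_fin//; exact: nnfun_muleindic_ge0.
apply: eq_fsbigr => r /set_mem[t _ htr].
have r0 : (0 <= r)%R by rewrite -htr.
under eq_integral do rewrite EFinM.
under [RHS]eq_integral do rewrite EFinM -muleA.
have mi : measurable_fun setT (fun x => (\1_(h n @^-1` [set r]) x)%:E : \bar R).
  exact/measurable_EFinP.
rewrite (ge0_integralZl _ _ mi)//.
rewrite (ge0_integralZl _ _ (emeasurable_funM mi mpE))//; last first.
  by move=> x _; rewrite mule_ge0 ?lee_fin.
rewrite integral_indic// setIT nuE//; congr (_ * _).
rewrite [LHS]integral_mkcond; apply: eq_integral => x _.
by rewrite patchE indicE; case: ifP => _; rewrite ?mul1e ?mul0e.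
Qed.

End integral_complements.

(** The integral is the difference of the integrals of the positive and negative parts, each
    measurable in z by Tonelli, composed with the measurable map [fine]. *)
Lemma measurable_Rintegral_param d1 d2 (T1 : measurableType d1) (T2 : measurableType d2)
    (R : realType) (m2 : {sigma_finite_measure set T2 -> \bar R}) (h : T1 * T2 -> R) :
  measurable_fun setT h -> measurable_fun setT (fun z => \int[m2]_x h (z, x)).
Proof.
move=> mh; apply: (measurableT_comp (@fine_measurable _ _ measurableT)).
have mhE : measurable_fun setT (EFin \o h) by exact/measurable_EFinP.
rewrite (_ : (fun _ => _) = (fun z => (\int[m2]_x (EFin \o h)^\+ (z, x))
   - (\int[m2]_x (EFin \o h)^\- (z, x)))%E); last first.
  apply/funext => z; rewrite [LHS]integralE.
  by congr (_ - _)%E; apply: eq_integral => x _; rewrite ?funeposE ?funenegE.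
apply: emeasurable_funB.
- exact: (measurable_fun_fubini_tonelli_F (EFin \o h)^\+%E (measurable_funepos mhE)).
- exact: (measurable_fun_fubini_tonelli_F (EFin \o h)^\-%E (measurable_funeneg mhE)).
Qed.

(** * Symmetry and second moment of the centred normal law *)

Section normal_moments.
Context {R : realType}.
Variable s : R.
Hypothesis s0 : 0 < s.
Local Notation N := (normal_prob 0 s).

Lemma normal_prob_opp (B : set R) : measurable B -> N (-%R @^-1` B) = N B.
Proof.
move=> mB; rewrite /normal_prob.
pose op : measurableTypeR R -> measurableTypeR R := -%R.
have mop : measurable_fun setT op by exact: oppr_measurable.
rewrite [RHS](_ : _ = \int[pushforward lebesgue_measure op]_(x in B) (normal_pdf 0 s x)%:E)%E; last first.
  by apply: eq_measure_integral => A mA _; apply/esym; exact: lebesgue_measureN.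
rewrite (ge0_integral_pushforward mop)//; last 2 first.
- by apply: measurable_funTS; apply/measurable_EFinP; exact: measurable_normal_pdf.
- by move=> x _; rewrite lee_fin normal_pdf_ge0.
apply: eq_integral => x _ /=; congr EFin.
by rewrite !normal_pdfE ?gt_eqF// /normal_fun !subr0 /op sqrrN.
Qed.

(* Compare with the Gaussian density of standard deviation [2 s]. *)
Lemma normal_prob_sqr : (\int[N]_y (y ^+ 2)%:E <= (8 * s ^+ 2)%:E)%E.
Proof.
have mpdf (t : R) : measurable_fun setT (normal_pdf 0 t : measurableTypeR R -> R)
  by exact: measurable_normal_pdf.
have msq : measurable_fun setT (fun y : measurableTypeR R => ((y : R) ^+ 2)%:E).
  by apply/measurable_EFinP; exact: exprn_measurable.
rewrite (@ge0_integral_density _ _ _ (@lebesgue_measure R) _ (normal_pdf 0 s))//; first last.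
- by move=> y; rewrite lee_fin sqr_ge0.
- by move=> y; exact: normal_pdf_ge0.
pose t := s * 2.
have t0 : 0 < t by rewrite mulr_gt0.
rewrite -[leRHS]mule1 -(integral_normal_pdf 0 t) -ge0_integralZl//; first last.
- by rewrite lee_fin mulr_ge0// sqr_ge0.
- by move=> y _; rewrite lee_fin normal_pdf_ge0.
- exact/measurable_EFinP.
apply: ge0_le_integral => //.
- by move=> y _; rewrite mule_ge0// lee_fin ?sqr_ge0 ?normal_pdf_ge0.
- by apply: emeasurable_funM => //; exact/measurable_EFinP.
- by apply: emeasurable_funM => //; exact/measurable_EFinP.
move=> y _; rewrite -!EFinM lee_fin !normal_pdfE ?gt_eqF// /normal_fun !subr0.
have peakE : normal_peak s = 2 * normal_peak t.
  rewrite /normal_peak (_ : t ^+ 2 * pi *+ 2 = 2 ^+ 2 * (s ^+ 2 * pi *+ 2)); last first.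
    by rewrite /t exprMn mulrnAr; congr (_ *+ _); ring.
  by rewrite sqrtrM ?sqr_ge0// sqrtr_sqr ger0_norm// invfM mulrA divff// mul1r.
rewrite peakE.
have pt0 : 0 <= normal_peak t by exact: normal_peak_ge0.
(* In this variable the two exponents are -4 z and -z, and the peaks differ by a factor 2, so the
   pointwise comparison of the integrands becomes 2 z exp(-3 z) <= 1. *)
set z := y ^+ 2 / (8 * s ^+ 2).
have s2 : s ^+ 2 != 0 by rewrite sqrf_eq0 gt_eqF.
have e1 : - y ^+ 2 / (s ^+ 2 *+ 2) = - z - 3 * z.
  by rewrite /z (_ : s ^+ 2 *+ 2 = 2 * s ^+ 2); [field; rewrite gt_eqF|ring].
have e2 : - y ^+ 2 / (t ^+ 2 *+ 2) = - z.
  by rewrite /z /t (_ : (s * 2) ^+ 2 *+ 2 = 8 * s ^+ 2); [field; rewrite gt_eqF|ring].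
have e3 : y ^+ 2 = 8 * s ^+ 2 * z by rewrite /z; field; rewrite gt_eqF.
rewrite e1 e2 {1}e3 expRD.
have z0 : 0 <= z by rewrite divr_ge0 ?sqr_ge0// mulr_ge0// sqr_ge0.
have key : 2 * z * expR (- 3 * z) <= 1.
  rewrite mulNr expRN ler_pdivrMr ?expR_gt0// mul1r.
  by apply: le_trans (expR_ge1Dx _); lra.
rewrite -/z mulNr in key *; move: key z0.
have E0 : 0 <= expR (- z) by exact: expR_ge0.
set a := expR (- z) in E0 *; set b := expR (- (3 * z)); move=> key z0.
rewrite (_ : 8 * s ^+ 2 * z * (2 * normal_peak t * (a * b)) =
  8 * s ^+ 2 * (normal_peak t * a) * (2 * z * b)); last by ring.
rewrite -[leRHS]mulr1; apply: ler_wpM2l => //.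
by apply: mulr_ge0; [apply: mulr_ge0 => //; exact: sqr_ge0|exact: mulr_ge0].
Qed.

End normal_moments.

(** * Products of a past-dependent variable with an independent normal increment *)

Section independent_normal.
Context {R : realType} {dO : measure_display} {Omega : measurableType dO}.
Variable P : probability Omega R.
Context {dS : measure_display} {S : measurableType dS}.
Variables (X : {mfun Omega >-> S}) (Y : {mfun Omega >-> measurableTypeR R}) (s : R).
Hypothesis s0 : 0 < s.
Hypothesis XY : forall A B, measurable A -> measurable B ->
  P (X @^-1` A `&` Y @^-1` B) = (P (X @^-1` A) * normal_prob 0%R s B)%E.
Local Open Scope ereal_scope.

Let N : probability (measurableTypeR R) R := normal_prob 0%R s.
Let PX : probability S R := distribution P X.

Let mY : measurable_fun setT (Y : Omega -> R).
Proof. exact: (measurable_funP Y). Qed.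

Let mXY : measurable_fun setT (fun w => (X w, Y w)).
Proof. exact: measurable_fun_pair. Qed.

Let mXoY : measurable_fun setT (fun w => (X w, - (Y w) : measurableTypeR R)%R).
Proof.
apply: measurable_fun_pair => //.
exact: (measurable_funN mY).
Qed.

Lemma joint_law (f : S * measurableTypeR R -> \bar R) : measurable_fun setT f ->
  (forall z, 0 <= f z) -> \int[P]_w f (X w, Y w) = \int[PX \x N]_z f z.
Proof.
move=> mf f0.
transitivity (\int[pushforward P (fun w => (X w, Y w))]_z f z).
  by rewrite ge0_integral_pushforward// preimage_setT.
apply: eq_measure_integral => A mA _; apply/esym.
by apply: product_measure_unique => // B C mB mC; rewrite /pushforward -XY.
Qed.

(** By symmetry of the normal law, (X, -Y) has the same joint law as (X, Y). This replaces the
    computation of a first moment. *)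
Lemma joint_law_opp (f : S * measurableTypeR R -> \bar R) : measurable_fun setT f ->
  (forall z, 0 <= f z) -> \int[P]_w f (X w, - Y w)%R = \int[PX \x N]_z f z.
Proof.
move=> mf f0.
transitivity (\int[pushforward P (fun w => (X w, - (Y w) : measurableTypeR R)%R)]_z f z).
  by rewrite (ge0_integral_pushforward mXoY)// preimage_setT.
apply: eq_measure_integral => A mA _; apply/esym.
apply: product_measure_unique => // B C mB mC.
transitivity (PX B * N (-%R @^-1` C)); last by congr (_ * _); exact: normal_prob_opp.
rewrite /N /PX /= /distribution /pushforward -XY//.
exact: (measurable_preimageT (@oppr_measurable R setT)).
Qed.

Lemma expectation_mul_sqr (eta : S -> R) : measurable_fun setT eta ->
  (forall z, 0 <= eta z)%R ->
  \int[P]_w (eta (X w) * Y w ^+ 2)%:E <= (8 * s ^+ 2)%:E * \int[P]_w (eta (X w))%:E.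
Proof.
move=> meta eta0.
have mE : measurable_fun setT (EFin \o eta) by exact/measurable_EFinP.
have msq : measurable_fun setT (fun y : measurableTypeR R => ((y : R) ^+ 2)%:E).
  by apply/measurable_EFinP; exact: exprn_measurable.
pose f (z : S * measurableTypeR R) := (eta z.1)%:E * ((z.2 : R) ^+ 2)%:E.
have mf : measurable_fun setT f.
  apply: emeasurable_funM; first exact: (measurableT_comp mE measurable_fst).
  exact: (measurableT_comp msq measurable_snd).
have f0 z : 0 <= f z by rewrite mule_ge0// lee_fin// sqr_ge0.
under eq_integral do rewrite EFinM.
rewrite (joint_law mf f0) fubini_tonelli1// /fubini_F.
have -> : \int[P]_w (eta (X w))%:E = \int[PX]_z (eta z)%:E.
  rewrite [RHS]ge0_integral_pushforward// => z _; exact: eta0.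
rewrite -ge0_integralZl//; last 2 first.
- by move=> z _; rewrite lee_fin.
- by rewrite lee_fin mulr_ge0// sqr_ge0.
apply: ge0_le_integral => //.
- by move=> z _; apply: integral_ge0.
- exact: measurable_fun_fubini_tonelli_F.
- exact: measurable_funeM.
move=> z _; rewrite /f/= ge0_integralZl ?lee_fin//; last first.
  by move=> y _; rewrite lee_fin sqr_ge0.
by rewrite muleC lee_wpmul2r ?lee_fin//; exact: normal_prob_sqr.
Qed.

(** Dominated by |xi| (1 + Y^2), using |y| <= 1 + y^2; the second moment bound thus makes
    integrability of [xi] alone sufficient. *)
Lemma integrable_mul_increment (xi : S -> R) : measurable_fun setT xi ->
  P.-integrable setT (fun w => (xi (X w))%:E) ->
  P.-integrable setT (fun w => (xi (X w) * Y w)%:E).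
Proof.
move=> mxi ixi.
have mn : measurable_fun setT (fun z => `|xi z|)%R by exact: measurableT_comp.
have h := expectation_mul_sqr mn (fun z => normr_ge0 _).
have mxX : measurable_fun setT (fun w => xi (X w)) by exact: measurableT_comp.
have nfin : \int[P]_w (`|xi (X w)|)%:E < +oo by case/integrableP: ixi.
have i2 : P.-integrable setT (fun w => (`|xi (X w)| * Y w ^+ 2)%:E).
  apply/integrableP; split.
    apply/measurable_EFinP; apply: measurable_funM.
      exact: (measurableT_comp mn).
    exact: (measurable_funX 2 mY).
  rewrite (eq_integral (fun w => (`|xi (X w)| * Y w ^+ 2)%:E)); last first.
    by move=> w _; rewrite gee0_abs// lee_fin mulr_ge0// sqr_ge0.
  apply: (le_lt_trans h); apply: lte_mul_pinfty => //.
  by rewrite lee_fin mulr_ge0// sqr_ge0.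
have i1 : P.-integrable setT (fun w => (`|xi (X w)|)%:E) by exact: integrable_norm.
apply: le_integrable (integrableD measurableT i1 i2) => //.
  by apply/measurable_EFinP; exact: measurable_funM.
move=> w _ /=; rewrite lee_fin normrM.
rewrite [leRHS]ger0_norm; last by rewrite addr_ge0// mulr_ge0// sqr_ge0.
rewrite -{2}[`|xi (X w)|%R]mulr1 -mulrDr ler_wpM2l//.
have := sqr_ge0 (`|Y w| - 1)%R; rewrite sqrrB1 real_normK ?num_real// => ?.
by have := sqr_ge0 (Y w); lra.
Qed.

(** Replacing Y by -Y exchanges the positive and the negative part of the product while preserving
    the joint law, so the two parts have equal integrals, finite by integrability. *)
Lemma expectation_mul_increment (xi : S -> R) : measurable_fun setT xi ->
  P.-integrable setT (fun w => (xi (X w))%:E) ->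
  \int[P]_w (xi (X w) * Y w)%:E = 0.
Proof.
move=> mxi ixi; have iY := integrable_mul_increment mxi ixi.
pose f (z : S * measurableTypeR R) := (xi z.1 * (z.2 : R))%:E.
have mf : measurable_fun setT f.
  apply/measurable_EFinP; apply: measurable_funM.
    exact: (measurableT_comp mxi measurable_fst).
  exact: measurable_snd.
have fo w : f (X w, - Y w)%R = - f (X w, Y w) by rewrite /f/= mulrN EFinN.
have pos : \int[P]_w f^\+ (X w, Y w) = \int[P]_w f^\- (X w, Y w).
  rewrite (joint_law (f := f^\+))//; last exact: measurable_funepos.
  rewrite -(joint_law_opp (f := f^\+))//; last exact: measurable_funepos.
  by apply: eq_integral => w _; rewrite funeposE funenegE fo.
have -> : \int[P]_w (xi (X w) * Y w)%:E =
    \int[P]_w f^\+ (X w, Y w) - \int[P]_w f^\- (X w, Y w).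
  rewrite integralE; congr (_ - _); apply: eq_integral => w _.
    by rewrite !funeposE.
  by rewrite !funenegE.
rewrite pos subee//.
have := integrable_neg_fin_num measurableT iY.
rewrite (_ : \int[P]_w _ = \int[P]_w f^\- (X w, Y w))//.
by apply: eq_integral => w _; rewrite !funenegE.
Qed.

End independent_normal.

(** * Powers of Lp norms as integrals, adapted vectors, a discrete Gronwall inequality *)

Lemma poweR_natE {R : realType} (x : \bar R) n : (0 <= x)%E ->
  (x `^ n.+1%:R = x ^+ n.+1)%E.
Proof.
case: x => [r| |] // r0; first by rewrite poweR_EFin powR_mulrn// EFin_expe.
rewrite poweRyr ?pnatr_eq0//; elim: n => [|n IH]; first by [].
by rewrite expeS -IH mulyy.
Qed.

Lemma Lpnorm_expE {R : realType} d (D : set 'rV[R]_d) n (v : 'rV[R]_d -> R) :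
  (Lpnorm D n.+1 v ^+ n.+1 = \int[lebesgue_rV d]_(x in D) (`|v x| ^+ n.+1)%:E)%E.
Proof.
rewrite -poweR_natE ?Lnorm_ge0// /Lpnorm poweR_Lnorm ?pnatr_eq0//.
rewrite [RHS]integral_mkcond; apply: eq_integral => x _; rewrite !patchE.
case: ifP => _.
  by rewrite -[LHS]/(`|v x|%:E `^ n.+1%:R)%E poweR_EFin powR_mulrn.
by rewrite -[LHS]/(`|0| `^ n.+1%:R)%E abse0 poweR0r// pnatr_eq0.
Qed.

(** Passes from coordinatewise adaptedness to events of the whole vector. [G] is a member of the
    filtration, given as a family of sets and not as a measurable structure, so the argument on
    generators is made directly. *)
Lemma rV_preimage_sigma {R : realType} dO (Omega : measurableType dO) (G : set (set Omega)) n
    (X : Omega -> 'rV[R]_n) : sigma_algebra setT G ->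
  (forall i, measurable_wrt G (fun w => X w ord0 i)) ->
  forall A, measurable A -> G (X @^-1` A).
Proof.
move=> [G0 GC GU] GX A mA.
have : [set A | G (X @^-1` A)] A.
  have sH : sigma_algebra setT [set A | G (X @^-1` A)].
    split => [|B /= GB|B GB] /=; first by rewrite preimage_set0.
      by rewrite setTD preimage_setC -setTD; exact: GC.
    by rewrite preimage_bigcup; exact: GU.
  move: mA; apply: smallest_sub => //.
  rewrite -bigcup_seq; apply: bigcup_sub => i _ _ [B mB <-] /=.
  by rewrite setTI; exact: GX.
by [].
Qed.

(** The accumulated dissipation is carried inside the induction together with [a n]: multiplying the
    earlier sum by 1 + c can only enlarge it, so a single bound controls both. *)
Lemma discrete_gronwall {R : realType} (a e : nat -> R) (c : R) N :
  0 <= c -> 0 <= a 0%N -> (forall n, (n < N)%N -> 0 <= e n) ->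
  (forall n, (n < N)%N -> a n.+1 + e n <= (1 + c) * a n + c) ->
  forall n, (n <= N)%N -> a n + \sum_(k < n) e k <= (1 + c) ^+ n * (a 0%N + n%:R * c).
Proof.
move=> c0 a0 e0 step; elim=> [|n IH] nN.
  by rewrite big_ord0 expr0 mul0r !addr0 mul1r.
have {}IH := IH (ltnW nN); have {}step := step n nN.
rewrite big_ord_recr/= exprS.
have s0 : 0 <= \sum_(k < n) e k.
  by apply: sumr_ge0 => i _; apply: e0; exact: ltn_trans (ltn_ord i) nN.
have p1 : 1 <= (1 + c) ^+ n by apply: exprn_ege1; lra.
have p2 : c <= (1 + c) * (1 + c) ^+ n * c by rewrite ler_peMl// mulr_ege1//; lra.
set S := \sum_(k < n) e k in IH s0 *; set Q := (1 + c) ^+ n in IH p1 p2 *.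
have : (1 + c) * (a n + S) <= (1 + c) * (Q * (a 0%N + n%:R * c)).
  by apply: ler_wpM2l => //; lra.
have : 0 <= c * S by exact: mulr_ge0.
rewrite -[n.+1%:R]natr1; nra.
Qed.

(** * The expectation of one time step, in abstract form *)

Section expectation_step.
Context {R : realType} {dO : measure_display} {Omega : measurableType dO}.
Variable P : probability Omega R.
Context {dS : measure_display} {S : measurableType dS}.
Variables (X : {mfun Omega >-> S}) (Y : {mfun Omega >-> measurableTypeR R}) (tau : R).
Hypothesis tau0 : 0 < tau.
Hypothesis XY : forall A B, measurable A -> measurable B ->
  P (X @^-1` A `&` Y @^-1` B) = (P (X @^-1` A) * normal_prob 0%R (Num.sqrt tau) B)%E.
(** Intended meaning: [A] and [A'] are the squared L2 norms at the two ends of a step, [Dl] that of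
    the difference, [Gr] that of the gradient, [B] the nodal form. [X] is the vector of nodal values
    at the old time and [Y] the Wiener increment; [xi] and [eta] are the products of g(u) with u and
    with itself. *)
Variables (A A' Dl Gr B : Omega -> R) (xi eta : S -> R) (k c : R).
Hypotheses (mA : measurable_fun setT A) (mA' : measurable_fun setT A')
  (mDl : measurable_fun setT Dl) (mGr : measurable_fun setT Gr)
  (mB : measurable_fun setT B) (mxi : measurable_fun setT xi)
  (meta : measurable_fun setT eta).
Hypotheses (A0 : forall w, 0 <= A w) (A'0 : forall w, 0 <= A' w)
  (Dl0 : forall w, 0 <= Dl w) (Gr0 : forall w, 0 <= Gr w)
  (B0 : forall w, 0 <= B w) (eta0 : forall z, 0 <= eta z).
Hypotheses (k0 : 0 <= k) (c0 : 0 <= c).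
Hypothesis xiA : forall w, `|xi (X w)| <= c * (1 + A w).
Hypothesis etaA : forall w, eta (X w) <= c * (1 + A w).
Hypothesis iA : P.-integrable setT (EFin \o A).
Hypothesis step : {ae P, forall w,
  A' w + 2^-1 * Dl w + 2 * tau * Gr w + tau * B w <=
  A w + k * tau + 2 * xi (X w) * Y w + 2 * eta (X w) * Y w ^+ 2}.

Let iC (r : R) : P.-integrable setT (fun=> r%:E).
Proof. exact: finite_measure_integrable_cst. Qed.

Let icst (r : R) : (\int[P]_w r%:E = r%:E)%E.
Proof. by rewrite integral_cst//= probability_setT mule1. Qed.

Let iDf (f g : Omega -> R) : P.-integrable setT (EFin \o f) -> P.-integrable setT (EFin \o g) ->
  P.-integrable setT (EFin \o (fun w => f w + g w)).
Proof. by move=> hf hg; exact: (integrableD measurableT hf hg). Qed.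

Let iZf r (f : Omega -> R) : P.-integrable setT (EFin \o f) ->
  P.-integrable setT (EFin \o (fun w => r * f w)).
Proof. by move=> hf; exact: (integrableZl measurableT r hf). Qed.

Let icA : P.-integrable setT (fun w => (c * (1 + A w))%:E).
Proof.
have := integrableZl measurableT c (integrableD measurableT (iC 1) iA).
by congr (integrable _ _ _); apply/funext => w /=.
Qed.

Let mxiX : measurable_fun setT (fun w => xi (X w)).
Proof. exact: measurableT_comp. Qed.

Let metaX : measurable_fun setT (fun w => eta (X w)).
Proof. exact: measurableT_comp. Qed.

Let mY : measurable_fun setT (Y : Omega -> R).
Proof. exact: (measurable_funP Y). Qed.

Let ixi : P.-integrable setT (fun w => (xi (X w))%:E).
Proof.
apply: le_integrable icA => //; first exact/measurable_EFinP.
move=> w _ /=; rewrite lee_fin (le_trans (xiA w))// ler_norm//.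
Qed.

Let s0 : 0 < Num.sqrt tau. Proof. by rewrite sqrtr_gt0. Qed.

Let s2 : Num.sqrt tau ^+ 2 = tau. Proof. by rewrite sqr_sqrtr// ltW. Qed.

Let expA_eta : (\int[P]_w (eta (X w))%:E <= (c * (1 + \int[P]_w A w))%:E)%E.
Proof.
apply: (@le_trans _ _ (\int[P]_w (c * (1 + A w))%:E)%E).
  apply: ge0_le_integral => //.
  - by move=> w _; rewrite lee_fin.
  - exact/measurable_EFinP.
  - by apply/measurable_EFinP; apply: measurable_funM => //; exact: measurable_funD.
  - by move=> w _; rewrite lee_fin.
under eq_integral do rewrite EFinM EFinD.
rewrite integralZl//; last exact: (integrableD measurableT (iC 1) iA).
rewrite (integralD measurableT (iC 1) iA) icst.
by rewrite /Rintegral EFinM EFinD fineK//; exact: integrable_fin_num.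
Qed.

Let ieta : P.-integrable setT (fun w => (eta (X w) * Y w ^+ 2)%:E).
Proof.
have mE : measurable_fun setT (fun w => (eta (X w) * Y w ^+ 2)%:E).
  by apply/measurable_EFinP; apply: measurable_funM => //; exact: measurable_funX.
apply/integrableP; split => //.
rewrite (eq_integral (fun w => (eta (X w) * Y w ^+ 2)%:E)); last first.
  by move=> w _; rewrite gee0_abs// lee_fin mulr_ge0// sqr_ge0.
apply: le_lt_trans (expectation_mul_sqr s0 XY meta eta0) _.
apply: lte_mul_pinfty; [by rewrite lee_fin mulr_ge0// sqr_ge0|by []|].
by apply: le_lt_trans expA_eta _; rewrite ltry.
Qed.

Let Lw w := A' w + 2^-1 * Dl w + 2 * tau * Gr w + tau * B w.
Let Rw w := A w + k * tau + 2 * xi (X w) * Y w + 2 * eta (X w) * Y w ^+ 2.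

Let iXY := integrable_mul_increment s0 XY mxi ixi.

Let iR : P.-integrable setT (EFin \o Rw).
Proof.
have := integrableD measurableT (integrableD measurableT (integrableD measurableT iA (iC (k * tau)))
  (integrableZl measurableT 2 iXY)) (integrableZl measurableT 2 ieta).
by congr (integrable _ _ _); apply/funext => w /=; rewrite /Rw -!mulrA !EFinD !EFinM.
Qed.

Let Lw0 w : 0 <= Lw w.
Proof. by rewrite /Lw !addr_ge0// mulr_ge0// ?mulr_ge0// ltW. Qed.

Let mL : measurable_fun setT Lw.
Proof.
by apply: measurable_funD; [apply: measurable_funD; [apply: measurable_funD|]|] => //;
  exact: measurable_funM.
Qed.

Let mR : measurable_fun setT Rw.
Proof. by apply/measurable_EFinP; exact: measurable_int iR. Qed.

(** The term in [xi] has mean zero; the factor 16 is the 2 in front of [eta] times the 8 of the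
    second moment bound. *)
Let intR : (\int[P]_w (Rw w)%:E <= (\int[P]_w A w + k * tau
  + 16 * tau * (c * (1 + \int[P]_w A w)))%:E)%E.
Proof.
have -> : (\int[P]_w (Rw w)%:E = \int[P]_w (A w)%:E + (k * tau)%:E
    + 2%:E * \int[P]_w (xi (X w) * Y w)%:E + 2%:E * \int[P]_w (eta (X w) * Y w ^+ 2)%:E)%E.
  have i2 := integrableD measurableT iA (iC (k * tau)).
  have i3 := integrableD measurableT i2 (integrableZl measurableT 2 iXY).
  rewrite -(integralZl measurableT iXY) -(integralZl measurableT ieta) -(icst (k * tau)).
  rewrite -(integralD measurableT iA (iC _)).
  rewrite -(integralD measurableT i2 (integrableZl measurableT 2 iXY)).
  rewrite -(integralD measurableT i3 (integrableZl measurableT 2 ieta)).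
  by apply: eq_integral => w _; rewrite /Rw -!mulrA !EFinD !EFinM.
rewrite (expectation_mul_increment s0 XY mxi ixi) mule0 adde0.
have -> : (\int[P]_w (A w)%:E = (\int[P]_w A w)%:E)%E.
  by rewrite /Rintegral fineK//; exact: integrable_fin_num.
rewrite -[X in (X + _ <= _)%E]EFinD [leRHS]EFinD leeD2l//.
apply: (@le_trans _ _ (2%:E * ((8 * tau)%:E * (c * (1 + \int[P]_w A w))%:E))%E).
  apply: (@lee_wpmul2l _ 2%:E) => //; apply: le_trans (expectation_mul_sqr s0 XY meta eta0) _.
  by rewrite s2; apply: lee_wpmul2l => //; rewrite lee_fin mulr_ge0// ltW.
by rewrite -!EFinM lee_fin; lra.
Qed.

Let intL : (\int[P]_w (Lw w)%:E <= (\int[P]_w A w + k * tau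
  + 16 * tau * (c * (1 + \int[P]_w A w)))%:E)%E.
Proof.
apply: le_trans intR.
(* The comparison of integrals asks for nonnegative functions everywhere, whereas [Rw] is known to
   be nonnegative only where it dominates [Lw]. Its positive part agrees with it almost surely. *)
pose Rp w := Num.max (Rw w) 0.
have LR : {ae P, forall w, Lw w <= Rw w} by [].
apply: (@le_trans _ _ (\int[P]_w (Rp w)%:E)%E).
  apply: ge0_integral_le_ae.
  - by move=> w; rewrite lee_fin.
  - by move=> w; rewrite lee_fin le_max lexx orbT.
  - by apply/measurable_EFinP; exact: measurable_maxr.
  - by apply: filterS LR => w LRw; rewrite lee_fin le_max LRw.
rewrite le_eqVlt; apply/orP; left; apply/eqP.
apply: ae_eq_integral => //.
- by apply/measurable_EFinP; exact: measurable_maxr.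
- exact/measurable_EFinP.
- apply: filterS LR => w LRw _; rewrite /Rp max_l//.
  exact: le_trans LRw.
Qed.

(** Integrability at the new time is a conclusion of the energy inequality: every summand of [Lw] is
    nonnegative, hence dominated by a function of finite integral. This is what lets the time
    induction proceed. *)
Let part (f : Omega -> R) r : 0 < r -> measurable_fun setT f -> (forall w, 0 <= f w) ->
  (forall w, r * f w <= Lw w) -> P.-integrable setT (EFin \o f).
Proof.
move=> r0 mf f0 fL; apply/integrableP; split; first exact/measurable_EFinP.
apply: (@le_lt_trans _ _ (r^-1%:E * \int[P]_w (Lw w)%:E)%E).
  rewrite -ge0_integralZl//; last 3 first.
  - exact/measurable_EFinP.
  - by move=> w _; rewrite lee_fin.
  - by rewrite lee_fin invr_ge0 ltW.
  apply: ge0_le_integral => //.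
  - by do 2 apply: measurableT_comp => //.
  - by apply: measurable_funeM; exact/measurable_EFinP.
  move=> w _ /=; rewrite -EFinM lee_fin ger0_norm// mulrC ler_pdivlMr// mulrC.
  exact: fL.
by apply: lte_mul_pinfty => //; [rewrite lee_fin invr_ge0 ltW|apply: le_lt_trans intL _; rewrite ltry].
Qed.

Let t0 w : 0 <= 2^-1 * Dl w /\ 0 <= 2 * tau * Gr w /\ 0 <= tau * B w.
Proof. by split; [|split]; rewrite mulr_ge0// ?mulr_ge0// ltW. Qed.

Lemma energy_expectation :
  [/\ P.-integrable setT (EFin \o A'), P.-integrable setT (EFin \o Dl),
      P.-integrable setT (EFin \o Gr), P.-integrable setT (EFin \o B) &
  \int[P]_w A' w + (2^-1 * \int[P]_w Dl w + 2 * tau * \int[P]_w Gr w + tau * \int[P]_w B w)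
    <= (1 + (k + 16 * c) * tau) * \int[P]_w A w + (k + 16 * c) * tau].
Proof.
have iA' : P.-integrable setT (EFin \o A').
  by apply: (@part _ 1) => // w; rewrite mul1r /Lw; have [? []] := t0 w; lra.
have iDl : P.-integrable setT (EFin \o Dl).
  by apply: (@part _ 2^-1) => // w; rewrite /Lw; have [? []] := t0 w; have := A'0 w; lra.
have iGr : P.-integrable setT (EFin \o Gr).
  apply: (@part _ (2 * tau)) => // [|w]; first by rewrite mulr_gt0.
  by rewrite /Lw; have [? []] := t0 w; have := A'0 w; lra.
have iB : P.-integrable setT (EFin \o B).
  by apply: (@part _ tau) => // w; rewrite /Lw; have [? []] := t0 w; have := A'0 w; lra.
split => //.
have := intL; have -> : (\int[P]_w (Lw w)%:E)%E = (\int[P]_w A' w + (2^-1 * \int[P]_w Dl w +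
    2 * tau * \int[P]_w Gr w + tau * \int[P]_w B w))%:E.
  rewrite -(RintegralZl _ measurableT iDl) -(RintegralZl _ measurableT iGr) -(RintegralZl _ measurableT iB).
  have j1 := iDf iA' (iZf 2^-1 iDl); have j2 := iDf j1 (iZf (2 * tau) iGr).
  rewrite !addrA -(RintegralD measurableT iA' (iZf 2^-1 iDl)).
  rewrite -(RintegralD measurableT j1 (iZf (2 * tau) iGr)) -(RintegralD measurableT j2 (iZf tau iB)).
  rewrite /Rintegral fineK//; apply: integrable_fin_num => //.
  apply/integrableP; split; first exact/measurable_EFinP.
  rewrite (eq_integral (EFin \o Lw)); first by apply: le_lt_trans intL _; rewrite ltry.
  by move=> w _; rewrite gee0_abs// lee_fin; exact: Lw0.
have IA0 : 0 <= \int[P]_w A w by exact: Rintegral_ge0.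
rewrite lee_fin; move: IA0; set IA := \int[P]_w A w => IA0 h.
apply: le_trans h _; have : 0 <= k * tau * IA by rewrite mulr_ge0// mulr_ge0// ltW.
lra.
Qed.

End expectation_step.

(** * The energy estimate *)

Section energy_step.
Context {R : realType} {d : nat} (D : set 'rV[R]_d) (M : mesh R d) (q : nat)
  (g : R -> R) (kappa : R).
Hypotheses (oD : open D) (bD : bounded_set D) (TM : triangulation D M).
Hypotheses (oq : odd q) (q3 : (3 <= q)%N)
  (dq : d = 2%N \/ (d = 3%N /\ (q = 3%N \/ q = 5%N))).
Hypotheses (kappa0 : 0 < kappa)
  (glip : forall a b, `|g a - g b| <= kappa * `|a - b|) (gc : continuous g).
Local Notation mu := (@lebesgue_rV R d).
Local Notation fe := (@fe_fun R d M).
Local Notation bm := (bounded_measurable D).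

Let mD : measurable D. Proof. exact: open_measurable_rV. Qed.
Let Doo : (mu D < +oo)%E. Proof. exact: bounded_lebesgue_rV_lty. Qed.

Let J f := \int[mu]_(x in D) f x.

Let bmi f : bm f -> mu.-integrable D (EFin \o f).
Proof. exact: bounded_measurable_integrable. Qed.

Let JD f h : bm f -> bm h -> J (fun x => f x + h x) = J f + J h.
Proof. by move=> /bmi bf /bmi bh; rewrite /J RintegralD. Qed.

Let JZ r f : bm f -> J (fun x => r * f x) = r * J f.
Proof. by move=> /bmi bf; rewrite /J RintegralZl. Qed.

Let Jle f h : bm f -> bm h -> (forall x, D x -> f x <= h x) -> J f <= J h.
Proof. by move=> /bmi bf /bmi bh fh; apply: le_Rintegral. Qed.

Let Jeq f h : (forall x, D x -> f x = h x) -> J f = J h.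
Proof. by move=> fh; apply: eq_Rintegral => x /set_mem; exact: fh. Qed.

Let Jcst r : J (fun=> r) = r * fine (mu D).
Proof. exact: Rintegral_cst. Qed.

Let bmM := @bounded_measurableM R _ _ D.
Let bmD := @bounded_measurableD R _ _ D.
Let bmB := @bounded_measurableB R _ _ D.
Let bmZ := @bounded_measurableZ R _ _ D.
Let bmX := @bounded_measurableX R _ _ D.
Let bmC := @bounded_measurable_cst R _ _ D.

Definition coercivity_const : R := 4 ^+ q.+3 * (d.+1 * d.+2)%:R.

Lemma coercivity_const_gt0 : 0 < coercivity_const.
Proof. by rewrite mulr_gt0 ?exprn_gt0// ltr0n. Qed.

Lemma bounded_measurable_Vh v : Vh D M v -> bm v.
Proof.
move=> vV; apply: (@eq_bounded_measurable _ _ _ _ (fe (fun i => v (vert i)))).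
  by move=> x Dx; rewrite -(Vh_fe_fun TM vV Dx).
exact: bounded_measurable_fe_fun.
Qed.

Lemma bounded_measurable_lipschitz v : bm v -> bm (fun x => g (v x)).
Proof.
move=> [mv [B vB]]; split.
  by apply: (measurableT_comp (continuous_measurable_fun gc)).
exists (`|g 0| + kappa * B) => x Dx.
rewrite -[g (v x)](subrK (g 0)) addrC (le_trans (ler_normD _ _))// lerD2l.
by rewrite (le_trans (glip _ _))// subr0 ler_wpM2l ?vB// ltW.
Qed.

(** Interpolation reproduces the linear part of f on V_h, so only the power contributes a nodal
    form. *)
Lemma ip_interpE v : Vh D M v ->
  ip D (interp M (fun x => v x - v x ^+ q)) v =
  ip D v v - ip D (fe (fun i => v (vert i) ^+ q)) v.
Proof.
move=> vV; have bv := bounded_measurable_Vh vV.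
have bq := bounded_measurable_fe_fun oD TM (fun i => v (vert i) ^+ q).
rewrite /ip -/(J _) -/(J _) -[X in _ - X]/(J _) -[- J _]mulN1r -JZ; last exact: bmM.
rewrite -JD; [|exact: bmM|by apply: bmZ; exact: bmM].
apply: Jeq => x Dx; rewrite interpE mulN1r -mulrBl; congr (_ * _).
rewrite (Vh_fe_fun TM vV Dx) /fe_fun -sumrB; apply: eq_bigr => i _.
by rewrite mulrBl.
Qed.

(** If y^2 exceeds 1/e, then e y^4 >= y^2, and y^(q+1) >= y^4 because y^2 >= 1 and q >= 3. *)
Lemma sqr_le_expr (e y : R) : 0 < e <= 1 -> y ^+ 2 <= e * y ^+ q.+1 + e^-1.
Proof.
move=> /andP[e0 e1]; have ei : 1 <= e^-1 by rewrite invf_ge1.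
have ye : 0 <= y ^+ q.+1 by rewrite exprn_even_ge0//= oq.
have [y2|y2] := leP (y ^+ 2) e^-1.
  by apply: (le_trans y2); rewrite lerDr mulr_ge0// ltW.
have y1 : 1 <= y ^+ 2 by exact: le_trans ei (ltW y2).
have qE : (q.+1 = 2 * (q.+1)./2)%N by rewrite mul2n -[LHS]odd_double_half /= oq.
have q2 : (2 <= (q.+1)./2)%N by rewrite -(half_bit_double 2 false) half_leq.
have : y ^+ 2 * y ^+ 2 <= y ^+ q.+1.
  by rewrite qE exprM -expr2 ler_weXn2l.
move=> h; apply: (@le_trans _ _ (e * (y ^+ 2 * y ^+ 2))); last first.
  by rewrite -[leLHS]addr0 lerD ?invr_ge0 ?ler_wpM2l// ltW.
rewrite mulrA ler_peMl ?sqr_ge0//.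
by rewrite -(ler_pM2l (_ : 0 < e^-1)) ?invr_gt0// mulr1 mulrA mulVf ?mul1r ?gt_eqF// ltW.
Qed.

Let gu v : bm v -> bm (fun x => g (v x)). Proof. exact: bounded_measurable_lipschitz. Qed.

(** Twice the tested equation, with the polarization 2 (v - u, v) = |v|^2 - |u|^2 + |v - u|^2. The
    noise is split along v = u + (v - u): the product with u depends on the past only and is kept
    linear in [Y], while the product with v - u is absorbed by the difference term at the price of a
    term in Y^2. *)
Lemma energy_step u v tau Y G2 : Vh D M u -> Vh D M v -> 0 < tau ->
  ip D v v + tau * G2 = ip D u v + tau * ip D (interp M (fun x => v x - v x ^+ q)) v
    + ip D (fun x => g (u x)) v * Y ->
  ip D v v + 2^-1 * ip D (fun x => v x - u x) (fun x => v x - u x) + 2 * tau * G2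
    + tau * ip D (fe (fun i => v (vert i) ^+ q)) v <=
  ip D u u + 4 * coercivity_const * fine (mu D) * tau
    + 2 * ip D (fun x => g (u x)) u * Y
    + 2 * ip D (fun x => g (u x)) (fun x => g (u x)) * Y ^+ 2.
Proof.
move=> uV vV tau0; rewrite ip_interpE//.
have bu := bounded_measurable_Vh uV; have bv := bounded_measurable_Vh vV.
set B := ip D (fe _) v => eqn.
have bg := gu bu.
have C0 := coercivity_const_gt0.
have C1 : 1 <= coercivity_const.
  by rewrite mulr_ege1 ?exprn_ege1 ?ler1n// muln_gt0.
have vq : J (fun x => v x ^+ q.+1) <= coercivity_const * B.
  have := fe_fun_coercive oD bD TM (fun i => v (vert i)) oq q3 dq.
  rewrite -/coercivity_const => h; apply: le_trans (le_trans h _).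
    by rewrite le_eqVlt; apply/orP; left; apply/eqP/Jeq => x Dx; rewrite -(Vh_fe_fun TM vV Dx).
  rewrite ler_pM2l// le_eqVlt; apply/orP; left; apply/eqP/Jeq => x Dx.
  by rewrite -(Vh_fe_fun TM vV Dx).
have v2 : 2 * ip D v v <= B + 4 * coercivity_const * fine (mu D).
  (* With this choice twice the squared norm costs exactly one [B], so the reaction term consumes
     half of the available 2 tau B and the other half remains on the left. *)
  pose e := (2 * coercivity_const)^-1.
  have e01 : 0 < e <= 1.
    by apply/andP; split; [rewrite invr_gt0; lra|rewrite /e invf_le1; lra].
  have : ip D v v <= e * J (fun x => v x ^+ q.+1) + e^-1 * fine (mu D).
    rewrite -JZ; last exact: bmX.
    rewrite -Jcst -JD; [|by apply: bmZ; exact: bmX|exact: bmC].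
    apply: Jle => [|| x Dx]; [exact: bmM|by apply: bmD; [apply: bmZ; exact: bmX|exact: bmC]|].
    by rewrite -expr2; exact: sqr_le_expr.
  have : e * J (fun x => v x ^+ q.+1) <= e * (coercivity_const * B).
    by rewrite ler_wpM2l// ltW//; case/andP: e01.
  have -> : e * (coercivity_const * B) = B / 2 by rewrite /e; field; rewrite gt_eqF.
  by rewrite /e invrK; lra.
have dd : ip D (fun x => v x - u x) (fun x => v x - u x) = ip D v v + ip D u u - 2 * ip D u v.
  rewrite /ip -/(J _) -/(J _) -/(J _) -/(J _) -mulNr -JZ; last exact: bmM.
  rewrite -JD; [|exact: bmM|exact: bmM].
  rewrite -JD; [|by apply: bmD; exact: bmM|by apply: bmZ; exact: bmM].
  by apply: Jeq => x Dx; ring.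
have gv : ip D (fun x => g (u x)) v =
    ip D (fun x => g (u x)) u + ip D (fun x => g (u x)) (fun x => v x - u x).
  rewrite /ip -/(J _) -/(J _) -/(J _) -JD; [|exact: bmM|by apply: bmM => //; exact: bmB].
  by apply: Jeq => x Dx; ring.
(* After doubling, the weight 1/4 takes half of |v - u|^2 and leaves the factor 1/2 of the
   statement. *)
have yg : Y * ip D (fun x => g (u x)) (fun x => v x - u x) <=
    4^-1 * ip D (fun x => v x - u x) (fun x => v x - u x) +
    Y ^+ 2 * ip D (fun x => g (u x)) (fun x => g (u x)).
  have bd := bmB bv bu.
  rewrite /ip -/(J _) -/(J _) -/(J _) -!JZ; [|exact: bmM|exact: bmM|exact: bmM].
  rewrite -JD; [|by apply: bmZ; exact: bmM|by apply: bmZ; exact: bmM].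
  apply: Jle => [|| x Dx].
  - by apply: bmZ; exact: bmM.
  - by apply: bmD; apply: bmZ; exact: bmM.
  have := sqr_ge0 ((v x - u x) / 2 - Y * g (u x)); nra.
rewrite gv in eqn.
have tv : tau * (2 * ip D v v) <= tau * (B + 4 * coercivity_const * fine (mu D)).
  by rewrite ler_wpM2l// ltW.
lra.
Qed.

(** The first two terms come from g(a)^2 <= 2 g(0)^2 + 2 kappa^2 a^2. The summand 1 covers |u|^2
    itself in the bound of the linear noise term, so one constant serves for both estimates. *)
Definition noise_const : R := 2 * (g 0) ^+ 2 * fine (mu D) + 2 * kappa ^+ 2 + 1.

Let vol0 : 0 <= fine (mu D). Proof. exact: fine_ge0. Qed.

Lemma noise_const_ge0 : 0 <= noise_const.
Proof. have := mulr_ge0 (sqr_ge0 (g 0)) vol0; have := sqr_ge0 kappa.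
by rewrite /noise_const; lra. Qed.

Lemma noise_sqr_le u : bm u ->
  ip D (fun x => g (u x)) (fun x => g (u x)) <= noise_const * (1 + ip D u u).
Proof.
move=> bu; have bg := gu bu.
have uu0 : 0 <= ip D u u by apply: Rintegral_ge0 => x _; rewrite -expr2 sqr_ge0.
apply: (@le_trans _ _ (2 * g 0 ^+ 2 * fine (mu D) + 2 * kappa ^+ 2 * ip D u u)); last first.
  have : 0 <= g 0 ^+ 2 * fine (mu D) by rewrite mulr_ge0 ?sqr_ge0.
  have := sqr_ge0 kappa; rewrite /noise_const; nra.
rewrite /ip -/(J _) -/(J _) -Jcst -JZ; last exact: bmM.
rewrite -JD; [|exact: bmC|by apply: bmZ; exact: bmM].
apply: Jle => [|| x Dx]; [exact: bmM|by apply: bmD; [exact: bmC|apply: bmZ; exact: bmM]|].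
have : (g (u x) - g 0) ^+ 2 <= (kappa * u x) ^+ 2.
  rewrite -[leLHS]real_normK ?num_real// -[leRHS]real_normK ?num_real//.
  rewrite lerXn2r ?nnegrE// (le_trans (glip _ _))// subr0 normrM gtr0_norm//.
have := sqr_ge0 (g (u x) - 2 * g 0); rewrite exprMn; nra.
Qed.

Lemma noise_lin_le u : bm u -> `|ip D (fun x => g (u x)) u| <= noise_const * (1 + ip D u u).
Proof.
move=> bu; have bg := gu bu.
have uu0 : 0 <= ip D u u by apply: Rintegral_ge0 => x _; rewrite -expr2 sqr_ge0.
have nc : 2 * g 0 ^+ 2 * fine (mu D) + 2 * kappa ^+ 2 * ip D u u + ip D u u <=
    2 * (noise_const * (1 + ip D u u)).
  have : 0 <= g 0 ^+ 2 * fine (mu D) by rewrite mulr_ge0 ?sqr_ge0.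
  have := sqr_ge0 kappa; rewrite /noise_const; nra.
have h1 := noise_sqr_le bu.
have nc1 : ip D u u <= noise_const * (1 + ip D u u).
  have : 0 <= g 0 ^+ 2 * fine (mu D) by rewrite mulr_ge0 ?sqr_ge0.
  have := sqr_ge0 kappa; rewrite /noise_const; nra.
apply: (@le_trans _ _ (2^-1 * ip D (fun x => g (u x)) (fun x => g (u x))
  + 2^-1 * ip D u u)); last by lra.
apply: le_trans (le_normr_Rintegral mD (bmi (bmM bg bu))) _.
rewrite /ip -/(J _) -/(J _) -/(J _) -!JZ; [|exact: bmM|exact: bmM].
rewrite -JD; [|by apply: bmZ; exact: bmM|by apply: bmZ; exact: bmM].
apply: Jle => [|| x Dx].
- have [mh [B hB]] := bmM bg bu; split; first exact: measurableT_comp.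
  by exists B => x Dx; rewrite normr_id; exact: hB.
- by apply: bmD; apply: bmZ; exact: bmM.
rewrite normrM; have := sqr_ge0 (`|g (u x)| - `|u x|).
have := real_normK (num_real (g (u x))); have := real_normK (num_real (u x)); nra.
Qed.

Local Notation m := (nvert M).
Definition nodal_fun (z : 'rV[R]_m) : 'rV[R]_d -> R := fe (fun i => z ord0 i).

(** The integrand is jointly measurable in the nodal vectors and the point, after the basis
    functions are cut off outside [D], where their measurability has been proved. Every functional
    of the discrete solution except the gradient becomes a measurable function of finitely many
    nodal values in this way. *)
Lemma measurable_nodal_integral (Phi : R -> R -> R) :
  measurable_fun setT (fun p : R * R => Phi p.1 p.2) ->
  measurable_fun setT (fun z : 'rV[R]_m * 'rV[R]_m =>
    \int[mu]_(x in D) Phi (nodal_fun z.1 x) (nodal_fun z.2 x)).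
Proof.
move=> mPhi.
pose phi i : 'rV[R]_d -> R := (nodal_basis (M := M) i) \_ D.
have mphi i : measurable_fun setT (phi i).
  apply/(measurable_restrictT _ mD).
  by have [] := bounded_measurable_nodal_basis oD TM i.
pose Z (z : 'rV[R]_m) x := \sum_i z ord0 i * phi i x.
pose h (t : ('rV[R]_m * 'rV[R]_m) * 'rV[R]_d) : R :=
  \1_D t.2 * Phi (Z t.1.1 t.2) (Z t.1.2 t.2).
have mZ (p : ('rV[R]_m * 'rV[R]_m) * 'rV[R]_d -> 'rV[R]_m) : measurable_fun setT p ->
    measurable_fun setT (fun t => Z (p t) t.2).
  move=> mp; apply: measurable_sum => i; apply: measurable_funM.
    exact: (measurableT_comp (measurable_coord i) mp).
  exact: (measurableT_comp (mphi i) measurable_snd).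
have mh : measurable_fun setT h.
  apply: measurable_funM.
    have mi : measurable_fun setT (\1_D : 'rV[R]_d -> R) by exact: measurable_indic.
    exact: (measurableT_comp mi measurable_snd).
  have m1 := mZ _ (measurableT_comp measurable_fst measurable_fst).
  have m2 := mZ _ (measurableT_comp measurable_snd measurable_fst).
  exact: (measurableT_comp mPhi (measurable_fun_pair m1 m2)).
rewrite (_ : (fun _ => _) = fun z => \int[mu]_x h (z, x)).
  exact: measurable_Rintegral_param.
apply/funext => z; rewrite [LHS]Rintegral_mkcond; apply: eq_Rintegral => x _.
rewrite patchE /h /= indicE; case: ifPn => xD; last by rewrite mul0r.
rewrite mul1r; have ZE (z' : 'rV[R]_m) : Z z' x = nodal_fun z' x.
  by apply: eq_bigr => i _; rewrite /phi patchE xD.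
by rewrite !ZE.
Qed.

End energy_step.

(** Membership in H1 guarantees that the selected gradient is a genuine weak gradient with square
    integrable components, so the extended-real norm is the embedding of a real integral. *)
Lemma grad_sqr_integral {R : realType} d (D : set 'rV[R]_d) (v : 'rV[R]_d -> R) :
  measurable D -> inH1 D v ->
  (Lpnorm D 2 (fun x => enorm (grad D v x)) ^+ 2 = (ipv D (grad D v) (grad D v))%:E)%E
  /\ 0 <= ipv D (grad D v) (grad D v).
Proof.
move=> mD [_ G0]; set G := grad D v.
have [GL2 _] : L2_weak_gradient D v G by exact: xgetPex.
have dot0 x : 0 <= dotv (G x) (G x) by apply: sumr_ge0 => i _; rewrite -expr2 sqr_ge0.
split; last by apply: Rintegral_ge0 => x _; exact: dot0.
rewrite Lpnorm_expE (eq_integral (fun x => (dotv (G x) (G x))%:E)); last first.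
  by move=> x _; rewrite ger0_norm ?sqrtr_ge0// sqr_sqrtr.
rewrite /ipv /Rintegral fineK//; apply: integrable_fin_num => //.
have := @integrable_sum _ _ _ (lebesgue_rV d) D mD _ (index_enum 'I_d) xpredT
  (fun i x => (G x ord0 i * G x ord0 i)%:E).
have iG i : (lebesgue_rV d).-integrable D (fun x => (G x ord0 i * G x ord0 i)%:E).
  have [mG Goo] := GL2 i; apply/integrableP; split.
    by apply/measurable_EFinP; exact: measurable_funM.
  rewrite (eq_integral (fun x => (`|G x ord0 i| ^+ 2)%:E)); last first.
    by move=> x _; rewrite /= expr2 normrM.
  rewrite -(Lpnorm_expE D 1) expe2 lte_mul_pinfty// ?Lnorm_ge0//.
  by rewrite ge0_fin_numE ?Lnorm_ge0.
move=> /(_ (fun i _ => iG i)).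
by congr (integrable _ _ _); apply/funext => x; rewrite /= sumEFin.
Qed.

Lemma sup_le_fin {R : realType} (N : nat) (f : nat -> \bar R) (b : R) :
  (forall n, (n <= N)%N -> (f n <= b%:E)%E) ->
  (ereal_sup [set f n | n in [set n | (n <= N)%N]] <= b%:E)%E.
Proof. by move=> fb; apply: ge_ereal_sup => _ [n /= nN <-]; exact: fb. Qed.

(** * The discrete solution: measurability, integrability and the bound by the data *)

Section scheme.
Context {R : realType} {d : nat} (D : set 'rV[R]_d) (M : mesh R d) (q : nat)
  (g : R -> R) (kappa : R) (T : R).
Context {dO : measure_display} {Omega : measurableType dO} (P : probability Omega R).
Variables (F : R -> set (set Omega)) (W : R -> Omega -> R) (u0 : 'rV[R]_d -> R).
Hypotheses (oD : open D) (bD : bounded_set D) (TM : triangulation D M).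
Hypotheses (oq : odd q) (q3 : (3 <= q)%N)
  (dq : d = 2%N \/ (d = 3%N /\ (q = 3%N \/ q = 5%N))).
Hypotheses (kappa0 : 0 < kappa)
  (glip : forall a b, `|g a - g b| <= kappa * `|a - b|) (gc : continuous g).
Hypotheses (T0 : 0 < T) (FF : is_filtration F) (WW : is_wiener P F W) (u0L2 : inL2 D u0).
Variables (N : nat) (u : nat -> Omega -> 'rV[R]_d -> R).
Hypothesis N0 : (0 < N)%N.
Let tau := T / N%:R.
Hypothesis sol : fe_solution P D M F W q g u0 tau N u.
Local Notation mu := (@lebesgue_rV R d).
Local Notation m := (nvert M).
Local Notation fe := (@fe_fun R d M).

Let mD : measurable D. Proof. exact: open_measurable_rV. Qed.
Let Doo : (mu D < +oo)%E. Proof. exact: bounded_lebesgue_rV_lty. Qed.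
Let tau0 : 0 < tau. Proof. by rewrite divr_gt0// ltr0n. Qed.

Let uV n w : (n <= N)%N -> Vh D M (u n w). Proof. by case: sol => + _ _ _; exact. Qed.
Let bu n w : (n <= N)%N -> bounded_measurable D (u n w).
Proof. by move=> nN; exact: bounded_measurable_Vh (uV w nN). Qed.

Definition nodal_vec n w : 'rV[R]_m := \row_i u n w (vert i).

Let nodalE n w x : (n <= N)%N -> D x -> u n w x = nodal_fun (nodal_vec n w) x.
Proof.
move=> nN Dx; rewrite (Vh_fe_fun TM (uV w nN) Dx).
by apply: eq_bigr => i _; rewrite mxE.
Qed.

Let nodal_adapted n : (n <= N)%N -> forall i,
  measurable_wrt (F (n%:R * tau)) (fun w => nodal_vec n w ord0 i).
Proof.
move=> nN i; have [_ uF _ _] := sol.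
rewrite (_ : (fun _ => _) = fun w => u n w (vert i)); last by apply/funext => w; rewrite mxE.
apply: uF => //; exact: vert_closure.
Qed.

Let t_ge0 n : 0 <= n%:R * tau. Proof. by rewrite mulr_ge0// ltW. Qed.

Let measurable_nodal_vec n : (n <= N)%N -> measurable_fun setT (nodal_vec n).
Proof.
move=> nN; apply/measurable_fun_rVP => i _ B mB; rewrite setTI.
have [_ Fm _] := FF; apply: (Fm _ (t_ge0 n)); exact: nodal_adapted.
Qed.

Let Y n w : measurableTypeR R := increment W (n%:R * tau) (n.+1%:R * tau) w.

Let measurable_W t : 0 <= t -> measurable_fun setT (W t).
Proof.
move=> t0 _ B mB; rewrite setTI; have [_ Fm _] := FF; apply: (Fm _ t0).
by have [WF _ _ _ _] := WW; exact: WF.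
Qed.

Let measurable_Y n : measurable_fun setT (Y n : Omega -> R).
Proof. by apply: measurable_funB; exact: measurable_W. Qed.

Let A n w := ip D (u n w) (u n w).
Let Dl n w := ip D (fun x => u n.+1 w x - u n w x) (fun x => u n.+1 w x - u n w x).
Let B n w := ip D (fe (fun i => u n.+1 w (vert i) ^+ q)) (u n.+1 w).
Let X1 n w := ip D (fun x => g (u n w x)) (u n.+1 w).
Let Cr n w := ip D (u n w) (u n.+1 w).
Let G n w := ipv D (grad D (u n.+1 w)) (grad D (u n.+1 w)).
(* Almost surely equal to [G n w], by the scheme tested with [u n.+1 w]; unlike the weak
   gradient it is visibly measurable in [w]. *)
Let Gr n w := Num.max 0
  ((Cr n w + tau * (A n.+1 w - B n w) + X1 n w * Y n w - A n.+1 w) / tau).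
(** The coefficients of the noise are written as functions of the nodal vector because independence
    is established between [nodal_vec n] and the increment. *)
Let xi (z : 'rV[R]_m) := ip D (fun x => g (nodal_fun z x)) (nodal_fun z).
Let eta (z : 'rV[R]_m) := ip D (fun x => g (nodal_fun z x)) (fun x => g (nodal_fun z x)).

Let mPhi (Phi : R -> R -> R) (z z' : Omega -> 'rV[R]_m) :
  measurable_fun setT (fun p : R * R => Phi p.1 p.2) ->
  measurable_fun setT z -> measurable_fun setT z' ->
  measurable_fun setT (fun w => \int[mu]_(x in D) Phi (nodal_fun (z w) x) (nodal_fun (z' w) x)).
Proof.
move=> mP mz mz'.
exact: (measurableT_comp (measurable_nodal_integral oD TM mP) (measurable_fun_pair mz mz')).
Qed.

Let mg : measurable_fun setT g. Proof. exact: continuous_measurable_fun. Qed.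

Let eqJ (f h : 'rV[R]_d -> R) : (forall x, D x -> f x = h x) ->
  \int[mu]_(x in D) f x = \int[mu]_(x in D) h x.
Proof. by move=> fh; apply: eq_Rintegral => x /set_mem; exact: fh. Qed.

Let mA n : (n <= N)%N -> measurable_fun setT (A n).
Proof.
move=> nN; have mz := measurable_nodal_vec nN.
rewrite (_ : A n = fun w => \int[mu]_(x in D) (fun a b => a * b)
    (nodal_fun (nodal_vec n w) x) (nodal_fun (nodal_vec n w) x)).
  by apply: (mPhi _ mz mz); apply: measurable_funM.
by apply/funext => w; apply: eqJ => x Dx; rewrite -!nodalE.
Qed.

Let mCr n : (n < N)%N -> measurable_fun setT (Cr n).
Proof.
move=> nN; have mz := measurable_nodal_vec nN; have mz' := measurable_nodal_vec (ltnW nN).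
rewrite (_ : Cr n = fun w => \int[mu]_(x in D) (fun a b => a * b)
    (nodal_fun (nodal_vec n w) x) (nodal_fun (nodal_vec n.+1 w) x)).
  by apply: (mPhi _ mz' mz); apply: measurable_funM.
by apply/funext => w; apply: eqJ => x Dx; rewrite -!nodalE// ltnW.
Qed.

Let mX1 n : (n < N)%N -> measurable_fun setT (X1 n).
Proof.
move=> nN; have mz := measurable_nodal_vec nN; have mz' := measurable_nodal_vec (ltnW nN).
rewrite (_ : X1 n = fun w => \int[mu]_(x in D) (fun a b => g a * b)
    (nodal_fun (nodal_vec n w) x) (nodal_fun (nodal_vec n.+1 w) x)).
  by apply: (mPhi (Phi := fun a b => g a * b) _ mz' mz); apply: measurable_funM => //;
    exact: (measurableT_comp mg measurable_fst).
by apply/funext => w; apply: eqJ => x Dx; rewrite -!nodalE// ltnW.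
Qed.

Let mDl n : (n < N)%N -> measurable_fun setT (Dl n).
Proof.
move=> nN; have mz := measurable_nodal_vec nN; have mz' := measurable_nodal_vec (ltnW nN).
rewrite (_ : Dl n = fun w => \int[mu]_(x in D) (fun a b => (b - a) * (b - a))
    (nodal_fun (nodal_vec n w) x) (nodal_fun (nodal_vec n.+1 w) x)).
  by apply: (mPhi (Phi := fun a b => (b - a) * (b - a)) _ mz' mz); apply: measurable_funM; apply: measurable_funB.
by apply/funext => w; apply: eqJ => x Dx; rewrite -!nodalE// ltnW.
Qed.

Let mB n : (n < N)%N -> measurable_fun setT (B n).
Proof.
move=> nN; have mz := measurable_nodal_vec nN.
pose zq w : 'rV[R]_m := \row_i nodal_vec n.+1 w ord0 i ^+ q.
have mzq : measurable_fun setT zq.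
  apply/measurable_fun_rVP => i.
  rewrite (_ : (fun _ => _) = fun w => nodal_vec n.+1 w ord0 i ^+ q); last first.
    by apply/funext => w; rewrite mxE.
  by apply: measurable_funX; exact: (measurableT_comp (measurable_coord i) mz).
rewrite (_ : B n = fun w => \int[mu]_(x in D) (fun a b => a * b)
    (nodal_fun (zq w) x) (nodal_fun (nodal_vec n.+1 w) x)).
  by apply: (mPhi _ mzq mz); apply: measurable_funM.
apply/funext => w; apply: eqJ => x Dx; rewrite -nodalE//; congr (_ * _).
by apply: eq_bigr => i _; rewrite !mxE.
Qed.

Let mGr n : (n < N)%N -> measurable_fun setT (Gr n).
Proof.
move=> nN; apply: measurable_maxr => //; apply: measurable_funM => //.
apply: measurable_funB; last exact: mA.
apply: measurable_funD; last by apply: measurable_funM => //; exact: mX1.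
apply: measurable_funD; first exact: mCr.
by apply: measurable_funM => //; apply: measurable_funB; [exact: mA|exact: mB].
Qed.

Let mxi : measurable_fun setT xi.
Proof.
have := measurable_nodal_integral oD TM (Phi := fun a b => g a * b).
have mid := @measurable_id _ 'rV[R]_m setT.
move=> /(_ (measurable_funM (measurableT_comp mg measurable_fst) measurable_snd)) mh.
exact: (measurableT_comp mh (measurable_fun_pair mid mid)).
Qed.

Let meta : measurable_fun setT eta.
Proof.
have := measurable_nodal_integral oD TM (Phi := fun a b => g a * g b).
have mid := @measurable_id _ 'rV[R]_m setT.
move=> /(_ (measurable_funM (measurableT_comp mg measurable_fst) (measurableT_comp mg measurable_snd))) mh.
exact: (measurableT_comp mh (measurable_fun_pair mid mid)).
Qed.

Let sqr_ip_ge0 f : 0 <= ip D f f.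
Proof. by apply: Rintegral_ge0 => x _; rewrite -expr2 sqr_ge0. Qed.

Let coerc n w : (n < N)%N ->
  \int[mu]_(x in D) (u n.+1 w x ^+ q.+1) <= @coercivity_const R d q * B n w.
Proof.
move=> nN.
have := fe_fun_coercive oD bD TM (fun i => u n.+1 w (vert i)) oq q3 dq.
rewrite -/(@coercivity_const R d q) => h.
rewrite (_ : \int[mu]_(x in D) _ =
    \int[mu]_(x in D) fe (fun i => u n.+1 w (vert i)) x ^+ q.+1); last first.
  by apply: eqJ => x Dx; rewrite (Vh_fe_fun TM (uV w nN) Dx).
rewrite (_ : B n w = \int[mu]_(x in D) (fe (fun i => u n.+1 w (vert i) ^+ q) x *
    fe (fun i => u n.+1 w (vert i)) x))//.
by apply: eqJ => x Dx; rewrite -(Vh_fe_fun TM (uV w nN) Dx).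
Qed.

Let C0 : 0 < @coercivity_const R d q . Proof. exact: coercivity_const_gt0. Qed.

(** The sign of the nodal form is inherited from coercivity, since q + 1 is even. *)
Let B0 n w : (n < N)%N -> 0 <= B n w.
Proof.
move=> nN; rewrite -(pmulr_rge0 _ C0); apply: le_trans (coerc w nN).
by apply: Rintegral_ge0 => x _; rewrite exprn_even_ge0//= oq.
Qed.

Let k := 4 * @coercivity_const R d q * fine (mu D).
Let c := noise_const D g kappa.

Let step n : (n < N)%N -> {ae P, forall w,
  G n w <= Gr n w /\
  A n.+1 w + 2^-1 * Dl n w + 2 * tau * Gr n w + tau * B n w <=
  A n w + k * tau + 2 * xi (nodal_vec n w) * Y n w + 2 * eta (nodal_vec n w) * Y n w ^+ 2}.
Proof.
move=> nN; have [_ _ _ scheme] := sol; apply: filterS scheme => w /(_ n nN _ (uV w nN)) eqn.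
have nN' : (n <= N)%N by exact: ltnW.
have G0 : 0 <= G n w by have [] := grad_sqr_integral mD (uV w nN).1.
have GE : Gr n w = G n w.
  (* Where the scheme holds, the quotient equals [G n w], which is already nonnegative; the maximum
     with 0 serves to make [Gr] nonnegative on the exceptional null set too. *)
  rewrite /Gr -[RHS](max_r G0); congr Num.max.
  have eqn' : A n.+1 w + tau * G n w = Cr n w + tau * (A n.+1 w - B n w) + X1 n w * Y n w.
    by rewrite /A /B -(ip_interpE q oD bD TM (uV w nN)); exact: eqn.
  rewrite -eqn'; field; exact: lt0r_neq0.
split; first by rewrite GE.
have := energy_step oD bD TM oq q3 dq kappa0 glip gc (uV w nN') (uV w nN) tau0 eqn.
rewrite GE (_ : xi _ = ip D (fun x => g (u n w x)) (u n w)); last first.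
  by apply: eqJ => x Dx; rewrite -nodalE.
by rewrite (_ : eta _ = ip D (fun x => g (u n w x)) (fun x => g (u n w x))) // ;
  apply: eqJ => x Dx; rewrite -nodalE.
Qed.

Let k0 : 0 <= k.
Proof. by rewrite /k mulr_ge0 ?fine_ge0// mulr_ge0// ltW. Qed.

Let c0 : 0 <= c. Proof. exact: noise_const_ge0. Qed.

Let A0 n w : 0 <= A n w. Proof. exact: sqr_ip_ge0. Qed.
Let Dl0 n w : 0 <= Dl n w. Proof. exact: sqr_ip_ge0. Qed.
Let Gr0 n w : 0 <= Gr n w. Proof. by rewrite le_max lexx. Qed.

Let a0 := ip D u0 u0.

(** The L2 projection is a contraction: with p the projection, |p|^2 = (u0, p) and 2 (u0, p) <=
    |u0|^2 + |p|^2. As [u0] is only square integrable, integrability of the mixed product is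
    obtained by domination. *)
Let init w : A 0 w <= a0.
Proof.
have [_ _ /(_ w)[_ pE] _] := sol.
have bp := bu w (leq0n N); have [mu0 u0oo] := u0L2.
have iu : mu.-integrable D (EFin \o (fun x => u0 x * u0 x)).
  apply/integrableP; split; first by apply/measurable_EFinP; exact: measurable_funM.
  rewrite (eq_integral (fun x => (`|u0 x| ^+ 2)%:E)); last first.
    by move=> x _; rewrite /= expr2 normrM.
  by rewrite -(Lpnorm_expE D 1) expe2 lte_mul_pinfty// ?Lnorm_ge0// ge0_fin_numE ?Lnorm_ge0.
have ip2 : mu.-integrable D (EFin \o (fun x => u 0 w x * u 0 w x)).
  by apply: bounded_measurable_integrable => //; exact: bounded_measurableM.
have isum : mu.-integrable D (EFin \o (fun x => u0 x * u0 x + u 0 w x * u 0 w x)).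
  exact: (integrableD mD iu ip2).
have half r s : 2 * (r * s) <= r * r + s * s :> R.
  by have := sqr_ge0 (r - s); rewrite !expr2; nra.
have ic : mu.-integrable D (EFin \o (fun x => u0 x * u 0 w x)).
  apply: le_integrable isum => //.
    by apply/measurable_EFinP; apply: measurable_funM => //; case: bp.
  move=> x _ /=; rewrite lee_fin [leRHS]ger0_norm; last by rewrite -!expr2 addr_ge0 ?sqr_ge0.
  have := half (u0 x) (u 0 w x); have := half (- u0 x) (u 0 w x).
  by rewrite ler_norml => h1 h2; apply/andP; split;
    have := sqr_ge0 (u0 x); have := sqr_ge0 (u 0 w x); rewrite !expr2; nra.
have : 2 * ip D u0 (u 0 w) <= a0 + A 0 w.
  rewrite /ip -RintegralZl// /a0 /A /ip -RintegralD//.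
  by apply: le_Rintegral => //; exact: (integrableZl mD 2 ic).
by rewrite -(pE _ (uV w (leq0n N))) -/(A 0 w); lra.
Qed.

Let E f := \int[P]_w f w.

Let expectation_step n : (n < N)%N -> P.-integrable setT (EFin \o A n) ->
  [/\ P.-integrable setT (EFin \o A n.+1), P.-integrable setT (EFin \o Dl n),
      P.-integrable setT (EFin \o Gr n), P.-integrable setT (EFin \o B n) &
  E (A n.+1) + (2^-1 * E (Dl n) + 2 * tau * E (Gr n) + tau * E (B n))
    <= (1 + (k + 16 * c) * tau) * E (A n) + (k + 16 * c) * tau].
Proof.
move=> nN iA; have nN' := ltnW nN.
have mz := measurable_nodal_vec nN'.
pose mixX := isMeasurableFun.Build _ _ _ _ _ mz.
pose X : {mfun Omega >-> 'rV[R]_m} := HB.pack (nodal_vec n) mixX.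
have mYn : measurable_fun setT (Y n) by exact: measurable_Y.
pose mixY := isMeasurableFun.Build _ _ _ _ _ mYn.
pose Yn : {mfun Omega >-> measurableTypeR R} := HB.pack (Y n) mixY.
have XY S B' : measurable S -> measurable B' ->
    P (X @^-1` S `&` Yn @^-1` B') = (P (X @^-1` S) * normal_prob 0%R (Num.sqrt tau) B')%E.
  move=> mS mB'; have [_ _ Wn Wi _] := WW; have [Fs _ _] := FF.
  have lt_t : n%:R * tau < n.+1%:R * tau by rewrite ltr_pM2r// ltr_nat.
  have dt : n.+1%:R * tau - n%:R * tau = tau by rewrite -natr1; ring.
  have FX : F (n%:R * tau) (X @^-1` S).
    exact: (rV_preimage_sigma (Fs _ (t_ge0 n)) (nodal_adapted nN') mS).
  by rewrite (Wi _ _ _ _ (t_ge0 n) lt_t FX mB') (Wn _ _ _ (t_ge0 n) lt_t mB') dt.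
have xiE w : xi (nodal_vec n w) = ip D (fun x => g (u n w x)) (u n w).
  by apply: eqJ => x Dx; rewrite -nodalE.
have etaE w : eta (nodal_vec n w) = ip D (fun x => g (u n w x)) (fun x => g (u n w x)).
  by apply: eqJ => x Dx; rewrite -nodalE.
have AD w : bounded_measurable D (u n w) by exact: bu.
apply: (energy_expectation tau0 XY (xi := xi) (eta := eta)) => //.
- exact: mA.
- exact: mA.
- exact: mDl.
- exact: mGr.
- exact: mB.
- by move=> w; exact: B0.
- by move=> z; exact: sqr_ip_ge0.
- by move=> w; rewrite /= xiE; exact: noise_lin_le.
- by move=> w; rewrite /= etaE; exact: noise_sqr_le.
- by apply: filterS (step nN) => w [].
Qed.

(** At time 0 the norm is bounded by that of the data; afterwards each step of the energy estimate
    returns the integrability required by the next one. *)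
Let integrable_A n : (n <= N)%N -> P.-integrable setT (EFin \o A n).
Proof.
elim: n => [_|n IH nN]; last by have [] := expectation_step nN (IH (ltnW nN)).
apply: measurable_bounded_integrable => //.
- by rewrite (le_lt_trans (probability_le1 _ _))// ltry.
- exact: mA.
- exists a0; split; first exact: num_real.
  by move=> r ar w _ /=; rewrite ger0_norm// (le_trans (init w))// ltW.
Qed.

Let E_ge0 f : (forall w, 0 <= f w) -> 0 <= E f.
Proof. by move=> f0; apply: Rintegral_ge0 => w _; exact: f0. Qed.

Let e n := 2^-1 * E (Dl n) + 2 * tau * E (Gr n) + tau * E (B n).

(** Growth rate per unit of time: [k] stems from absorbing the reaction term and 16 [c] from the
    quadratic noise term. Neither depends on the mesh or on the time step. *)
Definition scheme_rate : R := k + 16 * c.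
Definition scheme_bound : R := expR (scheme_rate * T) * (a0 + scheme_rate * T).

Let rate0 : 0 <= scheme_rate. Proof. by rewrite addr_ge0// mulr_ge0. Qed.

Let e_terms n : (n < N)%N -> [/\ 0 <= E (Dl n), 0 <= E (Gr n) & 0 <= E (B n)].
Proof.
move=> nN; split; apply: E_ge0 => w; [exact: Dl0|exact: Gr0|exact: B0].
Qed.

(** Discrete Gronwall with constant rate times tau; since (1 + x)^n <= exp(n x) and n tau <= T, the
    bound is the same for all n up to N and for all N. *)
Let energy_bound n : (n <= N)%N -> E (A n) + \sum_(i < n) e i <= scheme_bound.
Proof.
move=> nN.
have rt0 : 0 <= scheme_rate * tau by rewrite mulr_ge0// ltW.
have EA0 : E (A 0) <= a0.
  apply: (@le_trans _ _ (\int[P]_w cst a0 w)); last first.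
    by rewrite Rintegral_cst// [X in fine X](_ : _ = 1%E) ?mulr1//; exact: probability_setT.
  by apply: le_Rintegral => //; [exact: integrable_A|exact: finite_measure_integrable_cst].
have Tn : n%:R * tau <= T.
  rewrite /tau mulrCA ler_piMr ?(ltW T0)// ler_pdivrMr ?ltr0n// mul1r ler_nat//.
apply: (@le_trans _ _ ((1 + scheme_rate * tau) ^+ n * (E (A 0) + n%:R * (scheme_rate * tau)))).
  apply: (discrete_gronwall (a := fun n => E (A n)) (N := N)) => //.
  - exact: E_ge0.
  - move=> j jN; have [d0 g0 b0] := e_terms jN.
    by rewrite /e !addr_ge0// mulr_ge0// ?mulr_ge0// ltW.
  - by move=> j jN; have [_ _ _ _] := expectation_step jN (integrable_A (ltnW jN)).
have rT : n%:R * (scheme_rate * tau) <= scheme_rate * T.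
  by rewrite mulrCA ler_wpM2l.
apply: ler_pM.
- by rewrite exprn_ge0// addr_ge0.
- by rewrite addr_ge0 ?E_ge0// mulr_ge0.
- apply: (@le_trans _ _ (expR (scheme_rate * tau) ^+ n)).
    by rewrite lerXn2r ?nnegrE ?expR_ge0// ?addr_ge0// expR_ge1Dx.
  by rewrite -expRM_natl ler_expR.
- exact: lerD.
Qed.

Let Lpnorm_even (f : 'rV[R]_d -> R) j : bounded_measurable D f -> ~~ odd j.+1 ->
  (Lpnorm D j.+1 f ^+ j.+1 = (\int[mu]_(x in D) f x ^+ j.+1)%:E)%E.
Proof.
move=> bf oj; rewrite Lpnorm_expE (eq_integral (fun x => (f x ^+ j.+1)%:E)); last first.
  by move=> x _; rewrite -normrX ger0_norm// exprn_even_ge0.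
rewrite /Rintegral fineK//; apply: integrable_fin_num => //.
by apply: bounded_measurable_integrable => //; exact: bounded_measurableX.
Qed.

Let E_fin f : P.-integrable setT (EFin \o f) -> (\int[P]_w (f w)%:E = (E f)%:E)%E.
Proof. by move=> iF; rewrite /E /Rintegral fineK//; exact: integrable_fin_num. Qed.

Let expect_A n : (n <= N)%N ->
  expect P (fun w => Lpnorm D 2 (u n w) ^+ 2)%E = (E (A n))%:E.
Proof.
move=> nN; rewrite /expect -E_fin; last exact: integrable_A.
apply: eq_integral => w _; by rewrite (Lpnorm_even (bu w nN)).
Qed.

Let expect_Dl n : (n < N)%N ->
  expect P (fun w => Lpnorm D 2 (fun x => (u n.+1 w x - u n w x)%R) ^+ 2)%E = (E (Dl n))%:E.
Proof.
move=> nN; rewrite /expect -E_fin; last by have [] := expectation_step nN (integrable_A (ltnW nN)).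
apply: eq_integral => w _; rewrite Lpnorm_even//.
by apply: bounded_measurableB; apply: bu => //; exact: ltnW.
Qed.

(** An inequality between integrals, and not an equation: the left integrand involves the selected
    weak gradient, whose measurability in w is not established, so it is compared almost surely with
    [Gr]. *)
Let expect_Gr n : (n < N)%N ->
  (expect P (fun w => Lpnorm D 2 (fun x => enorm (grad D (u n.+1 w) x)) ^+ 2)
   <= (E (Gr n))%:E)%E.
Proof.
move=> nN; rewrite /expect -E_fin; last by have [] := expectation_step nN (integrable_A (ltnW nN)).
apply: ge0_integral_le_ae.
- by move=> w; rewrite expe_ge0// Lnorm_ge0.
- by move=> w; rewrite lee_fin.
- by apply/measurable_EFinP; exact: mGr.
apply: filterS (step nN) => w [GrG _].
by have [-> _] := grad_sqr_integral mD (uV w nN).1; rewrite lee_fin.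
Qed.

Let expect_B n : (n < N)%N ->
  (expect P (fun w => Lpnorm D q.+1 (u n.+1 w) ^+ q.+1)
   <= (@coercivity_const R d q * E (B n))%:E)%E.
Proof.
move=> nN; have iB : P.-integrable setT (EFin \o B n).
  by have [] := expectation_step nN (integrable_A (ltnW nN)).
rewrite /expect EFinM -E_fin// -ge0_integralZl//; last 3 first.
- by apply/measurable_EFinP; exact: mB.
- by move=> w _; rewrite lee_fin B0.
- by rewrite lee_fin ltW.
apply: ge0_integral_le_ae.
- by move=> w; rewrite expe_ge0// Lnorm_ge0.
- by move=> w; rewrite mule_ge0// lee_fin ?B0// ltW.
- by apply: measurable_funeM; apply/measurable_EFinP; exact: mB.
apply: aeW => w; rewrite Lpnorm_even//=; [|exact: bu|by rewrite oq].
by rewrite -EFinM lee_fin coerc.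
Qed.

(** With b the energy bound, the four terms are controlled by b, 2 b, b / 2 and K b / 2, where K is
    the coercivity constant that converts the nodal form into the L^(q+1) norm. *)
Lemma scheme_energy_bound :
  (ereal_sup [set expect P (fun w => Lpnorm D 2 (u n w) ^+ 2)
                   | n in [set n | (n <= N)%N]]
       + \sum_(n < N) expect P (fun w =>
            Lpnorm D 2 (fun x => (u n.+1 w x - u n w x)%R) ^+ 2)
       + tau%:E * \sum_(n < N) expect P (fun w =>
            Lpnorm D 2 (fun x => enorm (grad D (u n.+1 w) x)) ^+ 2)
       + (tau / 2)%:E * \sum_(n < N) expect P (fun w =>
            Lpnorm D q.+1 (u n.+1 w) ^+ q.+1)
       <= ((4 + @coercivity_const R d q) * scheme_bound)%:E)%E.
Proof.
have := energy_bound (leqnn N); set b := scheme_bound; set K := @coercivity_const R d q.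
have EAN := E_ge0 (A0 N).
have eE : \sum_(i < N) e i = 2^-1 * (\sum_(i < N) E (Dl i)) +
    2 * tau * (\sum_(i < N) E (Gr i)) + tau * (\sum_(i < N) E (B i)).
  by rewrite !mulr_sumr -!big_split.
have sD : 0 <= \sum_(i < N) E (Dl i) by apply: sumr_ge0 => i _; have [] := e_terms (ltn_ord i).
have sG : 0 <= \sum_(i < N) E (Gr i) by apply: sumr_ge0 => i _; have [] := e_terms (ltn_ord i).
have sB : 0 <= \sum_(i < N) E (B i) by apply: sumr_ge0 => i _; have [] := e_terms (ltn_ord i).
rewrite eE => eb.
have tG : 0 <= tau * \sum_(i < N) E (Gr i) by rewrite mulr_ge0// ltW.
have tB : 0 <= tau * \sum_(i < N) E (B i) by rewrite mulr_ge0// ltW.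
apply: (@le_trans _ _ (b%:E + (\sum_(i < N) E (Dl i))%:E + tau%:E * (\sum_(i < N) E (Gr i))%:E
    + (tau / 2)%:E * (K * \sum_(i < N) E (B i))%:E)%E).
  have t2 : 0 <= tau / 2 by rewrite divr_ge0// ltW.
  apply: leeD; [apply: leeD; [apply: leeD|]|].
  - apply: sup_le_fin => n nN; rewrite expect_A// lee_fin.
    apply: le_trans (energy_bound nN); rewrite lerDl; apply: sumr_ge0 => i _.
    have [d0 g0 b0] := e_terms (leq_trans (ltn_ord i) nN).
    by rewrite /e !addr_ge0// mulr_ge0// ?mulr_ge0// ltW.
  - by rewrite -sumEFin; apply: lee_sum => i _; rewrite expect_Dl.
  - apply: lee_wpmul2l; first by rewrite lee_fin ltW.
    by rewrite -sumEFin; apply: lee_sum => i _; exact: expect_Gr.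
  - apply: lee_wpmul2l => //.
    by rewrite mulr_sumr -sumEFin; apply: lee_sum => i _; exact: expect_B.
rewrite -!EFinM -!EFinD lee_fin.
rewrite (_ : tau / 2 * _ = 2^-1 * (K * (tau * \sum_(i < N) E (B i)))); last by field.
move: (\sum_(i < N) E (Dl i)) (\sum_(i < N) E (Gr i)) (\sum_(i < N) E (B i)) sD tG tB eb => x y z.
rewrite -(mulrA 2 tau) => x0.
move: (tau * y) (tau * z) => y' z' y0 z0 eb.
have b0 : z' <= b by lra.
have := ler_wpM2l (ltW C0) b0; rewrite -/K.
have : 0 <= K * b by rewrite mulr_ge0 ?(ltW C0)// (le_trans z0).
lra.
Qed.

End scheme.

Theorem theorem3p3 (R : realType) (d q : nat) (D : set 'rV[R]_d) (T : R)
    (dO : measure_display) (Omega : measurableType dO) (P : probability Omega R)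
    (F : R -> set (set Omega)) (W : R -> Omega -> R)
    (g : R -> R) (kappa1 : R) (u0 : 'rV[R]_d -> R) (sigma : R) :
  odd q -> (3 <= q)%N ->
  d = 2%N \/ (d = 3%N /\ (q = 3%N \/ q = 5%N)) ->
  is_domain D -> bounded_set D -> 0 < T ->
  is_filtration F -> is_wiener P F W ->
  (forall a, derivable g a 1) -> continuous (g^`())%classic ->
  0 < kappa1 -> (forall a b, `|g a - g b| <= kappa1 * `|a - b|) ->
  inL2 D u0 ->
  exists C : R, 0 < C /\
    forall (h : R) (M : mesh R d) (N : nat) (u : nat -> Omega -> 'rV[R]_d -> R),
      triangulation D M -> shape_regular sigma M -> mesh_size M = h ->
      mesh_assumption M -> (0 < N)%N ->
      let tau := T / N%:R in
      fe_solution P D M F W q g u0 tau N u ->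
      (ereal_sup [set expect P (fun w => Lpnorm D 2 (u n w) ^+ 2)
                   | n in [set n | (n <= N)%N]]
       + \sum_(n < N) expect P (fun w =>
            Lpnorm D 2 (fun x => (u n.+1 w x - u n w x)%R) ^+ 2)
       + tau%:E * \sum_(n < N) expect P (fun w =>
            Lpnorm D 2 (fun x => enorm (grad D (u n.+1 w) x)) ^+ 2)
       + (tau / 2)%:E * \sum_(n < N) expect P (fun w =>
            Lpnorm D q.+1 (u n.+1 w) ^+ q.+1)
       <= C%:E)%E.
Proof.
move=> oq q3 dq domD bD T0 FF WW dg _ kappa0 glip u0L2.
have [oD _ _] := domD.
have gc : continuous g.
  by move=> a; apply: differentiable_continuous; exact/derivable1_diffP.
have K0 : 0 < @coercivity_const R d q by exact: coercivity_const_gt0.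
have a0 : 0 <= ip D u0 u0 by apply: Rintegral_ge0 => x _; rewrite -expr2 sqr_ge0.
have rate0 : 0 <= @scheme_rate R d D q g kappa1.
  rewrite /scheme_rate addr_ge0//; first by rewrite mulr_ge0 ?fine_ge0// mulr_ge0// ltW.
  by rewrite mulr_ge0// noise_const_ge0.
have b0 : 0 <= @scheme_bound R d D q g kappa1 T u0.
  by rewrite mulr_ge0 ?expR_ge0// addr_ge0// mulr_ge0// ltW.
(* The constant involves only d, q, T, the measure of [D], g(0), [kappa1] and the L2 norm of [u0],
   and is fixed before the mesh and [N]. The summand 1 makes it strictly positive. *)
exists ((4 + @coercivity_const R d q) * @scheme_bound R d D q g kappa1 T u0 + 1); split.
  by rewrite ltr_wpDl// mulr_ge0// addr_ge0// ltW.
move=> h M N u TM _ _ _ N0 tau sol.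
apply: (le_trans (scheme_energy_bound oD bD TM oq q3 dq kappa0 glip gc T0 FF WW u0L2 N0 sol)).
by rewrite lee_fin lerDl.
Qed.
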